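(* Let $s\neq 1$ be a complex number with real part $\sigma=\Re(s)$, and let $x\geq 1$ be real. For $t\geq 1$ put $$Q_s(t)=(s-1)\zeta(s)t^{s}-(s-1)\sum_{k\leq t}\Big(\frac{t}{k}\Big)^s-t.$$ (i) One has $$\zeta(s)\bigg(\sum_{n\leq x}\frac{\mu(n)}{n^s}-\frac{m(x)}{x^{s-1}}\bigg)-1=\frac{\check{m}(x)-1}{x^{s-1}}+\frac{1}{x^{s-1}}\int_1^x m(x/t)\,Q_s(t)\,\frac{dt}{t^2}.$$ (ii) If $\sigma>0$, then $$\zeta(s)\bigg(\sum_{n\leq x}\frac{\mu(n)}{n^s}-\frac{m(x)}{x^{s-1}}-(s-1)\frac{\check{m}(x)-1}{x^{s-1}}\bigg)-1=\frac{s-1}{x^{s-1}}\Big(\tfrac12\check{\check{m}}(x)-\log x+\gamma\Big)+\frac{s-1}{x^{s-1}}\int_1^x[\check{m}(x/t)-1]\,Q_s(t)\,\frac{dt}{t^2}-(s-1)^2\int_x^{\infty}\Big[\log t-\sum_{j\leq t}\frac1j+\gamma\Big]t^{-s}\,dt.$$ (iii) If $\sigma>0$, then $|Q_s(t)|\leq \dfrac{|s|}{|\sigma|}\,|s-1|$ for all $t\geq 1$; and if moreover $\zeta(s)\neq 0$, then $$\bigg|\sum_{n\leq x}\frac{\mu(n)}{n^s}-\frac{m(x)}{x^{s-1}}-\frac{1}{\zeta(s)}\bigg|\leq\frac{|s|}{|\sigma|}\,\frac{|s-1|}{|\zeta(s)|}\,\frac{1}{x^{\sigma-1}}\,\frac1x\int_1^x|m(t)|\,dt+\frac{|\check{m}(x)-1|}{|\zeta(s)|\,x^{\sigma-1}}$$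 and $$\bigg|\sum_{n\leq x}\frac{\mu(n)}{n^s}-\frac{m(x)}{x^{s-1}}-(s-1)\frac{\check{m}(x)-1}{x^{s-1}}-\frac{1}{\zeta(s)}\bigg|\leq\frac{|s|}{|\sigma|}\,\frac{|s-1|^2}{|\zeta(s)|}\,\frac{1}{x^{\sigma-1}}\,\frac1x\int_1^x|\check{m}(t)-1|\,dt+\frac{|s-1|}{|\zeta(s)|\,x^{\sigma-1}}\Big|\tfrac12\check{\check{m}}(x)-\log x+\gamma\Big|+\frac{0.55\,|s-1|^2}{|\zeta(s)|\,|\sigma|\,x^{\sigma}}.$$
   Context: $\mu$ is the Möbius function, $\zeta$ the (meromorphically continued) Riemann zeta function, $\gamma$ Euler's constant. For real $x\geq 1$: $m(x)=\sum_{n\leq x}\frac{\mu(n)}{n}$, $\check{m}(x)=\sum_{n\leq x}\frac{\mu(n)}{n}\log(x/n)$, $\check{\check{m}}(x)=\sum_{n\leq x}\frac{\mu(n)}{n}\log^2(x/n)$. *)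

(* Defs.v *)
From mathcomp Require ssreflect ssrbool eqtype ssrnat seq prime.
From Stdlib Require Import Reals.
From Coquelicot Require Import Coquelicot.

Open Scope R_scope.

(* Only meaningful for t > 0 (Stdlib's ln is 0 on the nonpositive reals). *)
Definition cpow (t : R) (s : C) : C :=
  (exp (Re s * ln t) * cos (Im s * ln t),
   exp (Re s * ln t) * sin (Im s * ln t)).

(* The meromorphic continuation is unique (C minus a point is connected), so
   it is characterised by being the Dirichlet series for Re s > 1 and complex
   differentiable on C minus {1}. The value at s = 1 is left unconstrained. *)
Definition is_riemann_zeta (zeta : C -> C) : Prop :=
  (forall s : C, 1 < Re s ->
     is_series (K := C_AbsRing) (V := C_NormedModule)
       (fun n : nat => cpow (INR (S n)) (Copp s)) (zeta s)) /\
  (forall s : C, s <> RtoC 1 ->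
     ex_derive (K := C_AbsRing) (V := C_NormedModule) zeta s).

Definition moebius (n : nat) : R :=
  if andb (ssrnat.leq 1 n)
       (seq.all (fun p => Nat.eqb (prime.logn p n) 1) (prime.primes n))
  then (-1) ^ (seq.size (prime.primes n))
  else 0.

Definition sum_upto {G : AbelianMonoid} (f : nat -> G) (x : R) : G :=
  sum_n_m f 1 (Z.to_nat (Zfloor x)).

Definition m (x : R) : R :=
  sum_upto (fun n => moebius n / INR n) x.

Definition m1 (x : R) : R :=
  sum_upto (fun n => moebius n / INR n * ln (x / INR n)) x.

Definition m2 (x : R) : R :=
  sum_upto (fun n => moebius n / INR n * (ln (x / INR n)) ^ 2) x.

Definition euler_gamma : R :=
  real (Lim_seq (fun n => sum_n_m (fun k => / INR k) 1 n - ln (INR n))).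

Definition moebius_dirichlet_sum (s : C) (x : R) : C :=
  sum_upto (G := C_AbelianMonoid)
    (fun n => Cdiv (moebius n) (cpow (INR n) s)) x.

Definition Q (zeta : C -> C) (s : C) (t : R) : C :=
  ((s - 1) * zeta s * cpow t s
   - (s - 1) * sum_upto (G := C_AbelianMonoid)
                 (fun k => cpow (t / INR k)%R s) t
   - t)%C.

(* Main.v *)
Require Import Defs.
From Stdlib Require Import Reals Lra Lia Psatz ZArith ClassicalEpsilon.
From Coquelicot Require Import Coquelicot.
From mathcomp Require ssreflect ssrfun ssrbool eqtype ssrnat seq div prime.

(** The identities come from integrating the means of mu against Q termwise.
    As a function of t, m(x/t) is a sum over n <= x/t and Q contains a sum
    over k <= t, so the integral is a finite sum of integrals of powers of t
    (times log(x/(nt)) for the second identity) over [k, x/n].  Each of these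
    depends on n and k through x/(nk) only, up to a factor 1/(nk), and Moebius
    inversion ([moebius_inversion_upto]) collapses the double sum to the single
    term nk = 1.  This is [is_CInt_moebius_kernel], a statement about an
    arbitrary kernel kappa, used with kappa = 1 and kappa = log.  What
    remains of the first identity is algebra.

    The remainder of the second identity, and the bound on Q, need the link
    between zeta(s) and its partial sums on Re s > 0.  Put
    D(t) = sum_(k <= t) k^-s + t^(1-s)/(s-1)  ([zeta_partial]); Abel summation
    gives D(y) - D(t), up to a term of modulus at most y^-sigma, as an integral
    of ({u} - {t}) (-s) u^(-s-1) over [t, y], so that D(t) converges, with error
    at most |s| t^-sigma / sigma.  As
    Q_s(t) = (s-1) t^s (zeta(s) - D(t)), this is the bound on Q
    ([Cmod_Q_le]) as soon as the limit is zeta(s).  A second Abel summation,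
    with weights 1/k, expresses zeta(s) - D(x) through the integral of
    log t - H(t) + gamma against t^-s ([is_RInt_gen_defect]), which is the
    improper integral of the second identity.

    That D(t) tends to zeta(s) for Re s > 1 is the definition of zeta; the
    extension to Re s > 0 is analytic continuation ([zeta_eq_zeta_ext]).
    The limit is holomorphic because the integrals of {u} u^(-s-1) over [1, N]
    have quadratic remainders in s that are bounded uniformly in N
    ([holo_limit]).  The identity theorem is obtained from Goursat's theorem
    without power series: pulling f back along w |-> p + e^w turns an annulus
    into a rectangle with a period, whence the mean value property on circles
    and |f(p)| <= max |f| on a circle around p; applied to f(z)/(z-q)^n, where
    f vanishes near q and |p - q| is a fraction of the radius, it forces
    f(p) = 0 ([vanish_propagates]).  Vanishing thus spreads by steps of fixed
    length from Re s > 1 to the open quadrants above and below the real axis,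
    and to the real axis by continuity, so the point 1 is never met.

    The inequalities follow from the identities by taking absolute values.
    The constant 0.55 is a bound for t |log t - H(t) + gamma| on t >= 1, from
    the first two Euler-Maclaurin terms of H ([euler_gamma_bounds]). *)

Notation is_CInt := (is_RInt (V := C_R_NormedModule)).
Notation CInt := (RInt (V := C_R_CompleteNormedModule)).

(** The algebra tactics of C do not see through the carriers of the structures
    on C that unification leaves in the type of an equation. *)
Ltac Cchange := match goal with |- @eq _ ?a ?b => change (@eq C a b) end.

(** * Complex-valued functions of a real variable, exponential and powers *)

Section ComplexCalculus.
Local Open Scope C_scope.

Lemma Ceq (a b : C) : fst a = fst b -> snd a = snd b -> a = b.
Proof. destruct a, b; simpl; intros; subst; reflexivity. Qed.

Lemma norm_C_Cmod (z : C) : norm (V := C_R_NormedModule) z = Cmod z.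
Proof.
unfold norm; simpl; unfold prod_norm, Cmod, norm; simpl; unfold abs; simpl.
f_equal; rewrite !Rmult_1_r.
now rewrite <- 2!Rabs_mult, 2!Rabs_pos_eq by apply Rle_0_sqr.
Qed.

Lemma Cmod_triangle_minus (a b : C) : (Cmod (a - b) <= Cmod a + Cmod b)%R.
Proof. unfold Cminus; rewrite <- (Cmod_opp b); apply Cmod_triangle. Qed.

Lemma Cmod_minus_sym (a b : C) : Cmod (a - b) = Cmod (b - a).
Proof. rewrite <- (Cmod_opp (b - a)); f_equal; ring. Qed.

Lemma Cmod_RtoC_pos (r : R) : (0 <= r)%R -> Cmod (RtoC r) = r.
Proof. intros; rewrite Cmod_R; now apply Rabs_pos_eq. Qed.

Lemma Cmod_le_sum (z : C) : (Cmod z <= Rabs (fst z) + Rabs (snd z))%R.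
Proof.
replace z with (RtoC (fst z) + Ci * RtoC (snd z)) at 1.
- eapply Rle_trans; [apply Cmod_triangle|].
  rewrite Cmod_mult, Cmod_Ci, !Cmod_R; lra.
- apply Ceq; simpl; ring.
Qed.

Lemma fst_le_Cmod (z : C) : (Rabs (fst z) <= Cmod z)%R.
Proof. eapply Rle_trans; [apply Rmax_l|apply Rmax_Cmod]. Qed.

Lemma snd_le_Cmod (z : C) : (Rabs (snd z) <= Cmod z)%R.
Proof. eapply Rle_trans; [apply Rmax_r|apply Rmax_Cmod]. Qed.

Section Continuity.
Context {T : UniformSpace}.

Lemma continuous_C (f : T -> C) (x : T) :
  continuous (fun t => fst (f t)) x -> continuous (fun t => snd (f t)) x ->
  continuous (U := C_UniformSpace) f x.
Proof.
intros Hf Hg.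
apply (continuous_ext (U := C_UniformSpace) (fun t => (fst (f t), snd (f t)))).
{ intros t; symmetry; apply surjective_pairing. }
intros P [eps HP].
specialize (Hf (ball (fst (f x)) eps) (locally_ball _ _)).
specialize (Hg (ball (snd (f x)) eps) (locally_ball _ _)).
unfold filtermap in *.
generalize (filter_and _ _ Hf Hg); apply filter_imp.
intros t [H1 H2]; apply HP; split; assumption.
Qed.

Lemma continuous_C_fst (f : T -> C) (x : T) :
  continuous (U := C_UniformSpace) f x -> continuous (fun t => fst (f t)) x.
Proof.
intros H; apply (continuous_comp (V := C_UniformSpace) f fst); [exact H|].
apply (continuous_fst (U := R_UniformSpace) (V := R_UniformSpace)).
Qed.

Lemma continuous_C_snd (f : T -> C) (x : T) :
  continuous (U := C_UniformSpace) f x -> continuous (fun t => snd (f t)) x.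
Proof.
intros H; apply (continuous_comp (V := C_UniformSpace) f snd); [exact H|].
apply (continuous_snd (U := R_UniformSpace) (V := R_UniformSpace)).
Qed.

Lemma continuous_Cplus (f g : T -> C) (x : T) :
  continuous (U := C_UniformSpace) f x -> continuous (U := C_UniformSpace) g x ->
  continuous (U := C_UniformSpace) (fun t => f t + g t) x.
Proof.
intros Hf Hg; apply continuous_C; simpl;
  apply (continuous_plus (V := R_NormedModule));
  auto using continuous_C_fst, continuous_C_snd.
Qed.

Lemma continuous_Copp (f : T -> C) (x : T) :
  continuous (U := C_UniformSpace) f x ->
  continuous (U := C_UniformSpace) (fun t => - f t) x.
Proof.
intros Hf; apply continuous_C; simpl;
  apply (continuous_opp (V := R_NormedModule));
  auto using continuous_C_fst, continuous_C_snd.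
Qed.

Lemma continuous_Cminus (f g : T -> C) (x : T) :
  continuous (U := C_UniformSpace) f x -> continuous (U := C_UniformSpace) g x ->
  continuous (U := C_UniformSpace) (fun t => f t - g t) x.
Proof. intros; apply continuous_Cplus; [|apply continuous_Copp]; assumption. Qed.

Lemma continuous_Cmult (f g : T -> C) (x : T) :
  continuous (U := C_UniformSpace) f x -> continuous (U := C_UniformSpace) g x ->
  continuous (U := C_UniformSpace) (fun t => f t * g t) x.
Proof.
intros Hf Hg; apply continuous_C; simpl.
- apply (continuous_minus (V := R_NormedModule));
  apply (continuous_mult (K := R_AbsRing));
  auto using continuous_C_fst, continuous_C_snd.
- apply (continuous_plus (V := R_NormedModule));
  apply (continuous_mult (K := R_AbsRing));
  auto using continuous_C_fst, continuous_C_snd.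
Qed.

Lemma continuous_RtoC (f : T -> R) (x : T) :
  continuous f x -> continuous (U := C_UniformSpace) (fun t => RtoC (f t)) x.
Proof.
intros Hf; apply continuous_C; simpl; [exact Hf|apply continuous_const].
Qed.

Lemma continuous_Cmod (f : T -> C) (x : T) :
  continuous (U := C_UniformSpace) f x -> continuous (fun t => Cmod (f t)) x.
Proof.
intros Hf; apply (continuous_ext (fun t => norm (V := C_R_NormedModule) (f t))).
{ intros t; apply norm_C_Cmod. }
apply (continuous_comp (V := C_UniformSpace) f (norm (V := C_R_NormedModule)));
  [exact Hf|].
apply (filterlim_norm (V := C_R_NormedModule)).
Qed.

Lemma continuous_Cinv (f : T -> C) (x : T) :
  continuous (U := C_UniformSpace) f x -> f x <> 0 ->
  continuous (U := C_UniformSpace) (fun t => / f t) x.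
Proof.
intros Hf H0.
assert (H1 : (fst (f x) ^ 2 + snd (f x) ^ 2 <> 0)%R).
{ intros E; apply H0, Cmod_eq_0; unfold Cmod; rewrite E; apply sqrt_0. }
assert (Hn : continuous (fun t => / (fst (f t) ^ 2 + snd (f t) ^ 2))%R x).
{ apply (continuous_comp (fun t => fst (f t) ^ 2 + snd (f t) ^ 2)%R Rinv).
  - simpl; apply (continuous_plus (V := R_NormedModule));
    repeat apply (continuous_mult (K := R_AbsRing));
    auto using continuous_C_fst, continuous_C_snd, continuous_const.
  - apply continuity_pt_filterlim, continuity_pt_inv; [|exact H1].
    apply derivable_continuous_pt, derivable_pt_id. }
apply continuous_C; unfold Cinv, Rdiv; simpl fst; simpl snd;
  apply (continuous_mult (K := R_AbsRing)); try exact Hn;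
  [|apply (continuous_opp (V := R_NormedModule))];
  auto using continuous_C_fst, continuous_C_snd.
Qed.

Lemma continuous_C_iff (f : T -> C) (x : T) :
  continuous (U := C_UniformSpace) f x <->
  (forall eps : R, (0 < eps)%R -> locally x (fun t => (Cmod (f t - f x) < eps)%R)).
Proof.
split.
- intros H eps Heps.
  assert (H1 : continuous (fun t => Cmod (f t - f x)) x).
  { apply continuous_Cmod, continuous_Cminus; [exact H|apply continuous_const]. }
  specialize (H1 (ball (Cmod (f x - f x)) (mkposreal _ Heps)) (locally_ball _ _)).
  unfold filtermap in H1; revert H1; apply filter_imp; intros t Ht.
  replace (f x - f x) with (RtoC 0) in Ht by ring; rewrite Cmod_0 in Ht.
  unfold ball in Ht; simpl in Ht; unfold AbsRing_ball, abs, minus, plus, opp in Ht.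
  simpl in Ht; rewrite Ropp_0, Rplus_0_r in Ht.
  now rewrite Rabs_pos_eq in Ht by apply Cmod_ge_0.
- intros H; apply continuous_C; intros P [eps HP]; unfold filtermap;
  generalize (H eps (cond_pos eps)); apply filter_imp; intros t Ht; apply HP;
  unfold ball; simpl; unfold AbsRing_ball, abs, minus, plus, opp; simpl;
  (eapply Rle_lt_trans; [|exact Ht]); [apply (fst_le_Cmod (f t - f x))|
   apply (snd_le_Cmod (f t - f x))].
Qed.
End Continuity.

Lemma is_CInt_components (f : R -> C) (a b : R) (l : C) :
  is_RInt (fun t => fst (f t)) a b (fst l) ->
  is_RInt (fun t => snd (f t)) a b (snd l) -> is_CInt f a b l.
Proof.
intros H1 H2; rewrite (surjective_pairing l).
exact (is_RInt_fct_extend_pair (U := R_NormedModule) (V := R_NormedModule)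
  f a b _ _ H1 H2).
Qed.

Lemma is_CInt_fst (f : R -> C) (a b : R) (l : C) :
  is_CInt f a b l -> is_RInt (fun t => fst (f t)) a b (fst l).
Proof.
exact (is_RInt_fct_extend_fst (U := R_NormedModule) (V := R_NormedModule) f a b l).
Qed.

Lemma is_CInt_snd (f : R -> C) (a b : R) (l : C) :
  is_CInt f a b l -> is_RInt (fun t => snd (f t)) a b (snd l).
Proof.
exact (is_RInt_fct_extend_snd (U := R_NormedModule) (V := R_NormedModule) f a b l).
Qed.

Lemma is_CInt_plus (f g : R -> C) (a b : R) (lf lg : C) :
  is_CInt f a b lf -> is_CInt g a b lg ->
  is_CInt (fun t => f t + g t) a b (lf + lg).
Proof. apply (is_RInt_plus (V := C_R_NormedModule)). Qed.

Lemma is_CInt_minus (f g : R -> C) (a b : R) (lf lg : C) :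
  is_CInt f a b lf -> is_CInt g a b lg ->
  is_CInt (fun t => f t - g t) a b (lf - lg).
Proof. apply (is_RInt_minus (V := C_R_NormedModule)). Qed.

(** The module structure behind [is_RInt] only has real scalars, hence the
    passage through real and imaginary parts. *)
Lemma is_CInt_cmul (c : C) (f : R -> C) (a b : R) (l : C) :
  is_CInt f a b l -> is_CInt (fun t => c * f t) a b (c * l).
Proof.
intros H; apply is_CInt_components; simpl.
- apply (is_RInt_minus (V := R_NormedModule));
  apply (is_RInt_scal (V := R_NormedModule));
  [apply is_CInt_fst|apply is_CInt_snd]; exact H.
- apply (is_RInt_plus (V := R_NormedModule));
  apply (is_RInt_scal (V := R_NormedModule));
  [apply is_CInt_snd|apply is_CInt_fst]; exact H.
Qed.

Lemma is_RInt_constR (c a b : R) : is_RInt (fun _ => c) a b ((b - a) * c)%R.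
Proof. exact (is_RInt_const (V := R_NormedModule) a b c). Qed.

Lemma is_RInt_eq (f : R -> R) (a b l1 l2 : R) :
  is_RInt f a b l1 -> l1 = l2 -> is_RInt f a b l2.
Proof. intros H <-; exact H. Qed.

Lemma is_CInt_RtoC (f : R -> R) (a b l : R) :
  is_RInt f a b l -> is_CInt (fun t => RtoC (f t)) a b (RtoC l).
Proof.
intros H; apply is_CInt_components; simpl; [exact H|].
eapply is_RInt_eq; [apply is_RInt_constR|apply Rmult_0_r].
Qed.

Lemma is_CInt_const (c : C) (a b : R) : is_CInt (fun _ => c) a b (RtoC (b - a) * c).
Proof.
rewrite <- scal_R_Cmult; apply (is_RInt_const (V := C_R_NormedModule)).
Qed.

Lemma is_CInt_unique (f : R -> C) (a b : R) (l1 l2 : C) :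
  is_CInt f a b l1 -> is_CInt f a b l2 -> l1 = l2.
Proof.
intros H1 H2.
apply (is_RInt_unique (V := C_R_CompleteNormedModule)) in H1.
apply (is_RInt_unique (V := C_R_CompleteNormedModule)) in H2.
now rewrite <- H1, <- H2.
Qed.

Lemma is_CInt_eq (f : R -> C) (a b : R) (l1 l2 : C) :
  is_CInt f a b l1 -> l1 = l2 -> is_CInt f a b l2.
Proof. intros H <-; exact H. Qed.

(** The hypothesis is asked on the open interval only, so that the end points,
    where step functions jump, never matter. *)
Lemma Cmod_CInt_le (f : R -> C) (g : R -> R) (a b : R) (lf : C) (lg : R) :
  (a <= b)%R -> (forall t, (a < t < b)%R -> (Cmod (f t) <= g t)%R) ->
  is_CInt f a b lf -> is_RInt g a b lg -> (Cmod lf <= lg)%R.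
Proof.
intros Hab Hle Hf Hg.
rewrite <- norm_C_Cmod.
pose (g' := fun t => if Rlt_dec a t then if Rlt_dec t b then g t
                     else Cmod (f t) else Cmod (f t)).
apply (norm_RInt_le (V := C_R_NormedModule) f g' a b); auto.
- intros t Ht; rewrite norm_C_Cmod; unfold g'.
  destruct (Rlt_dec a t), (Rlt_dec t b); try apply Rle_refl; auto.
- apply is_RInt_ext with (2 := Hg); intros t Ht.
  rewrite Rmin_left, Rmax_right in Ht by exact Hab.
  unfold g'; destruct (Rlt_dec a t), (Rlt_dec t b); try reflexivity; lra.
Qed.

Lemma ex_CInt_continuous (f : R -> C) (a b : R) :
  (forall t, (Rmin a b <= t <= Rmax a b)%R -> continuous (U := C_UniformSpace) f t) ->
  exists l, is_CInt f a b l.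
Proof. apply (ex_RInt_continuous (V := C_R_CompleteNormedModule)). Qed.

(** Derivative along the real line, read on the two components so that the
    real differentiation rules apply. *)
Definition is_curve_derive (F : R -> C) (x : R) (l : C) : Prop :=
  is_derive (fun t => fst (F t)) x (fst l) /\ is_derive (fun t => snd (F t)) x (snd l).

Lemma curve_derive_continuous F x l : is_curve_derive F x l -> continuous (U := C_UniformSpace) F x.
Proof.
intros [H1 H2]; apply continuous_C;
apply (ex_derive_continuous (K := R_AbsRing) (V := R_NormedModule));
eexists; eassumption.
Qed.

Lemma is_CInt_derive (F f : R -> C) (a b : R) :
  (forall x, (Rmin a b <= x <= Rmax a b)%R -> is_curve_derive F x (f x)) ->
  (forall x, (Rmin a b <= x <= Rmax a b)%R -> continuous (U := C_UniformSpace) f x) ->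
  is_CInt f a b (F b - F a).
Proof.
intros H1 H2; apply is_CInt_components; simpl.
- apply (is_RInt_derive (V := R_CompleteNormedModule) (fun t => fst (F t)));
  intros x Hx; [apply H1, Hx|apply continuous_C_fst, H2, Hx].
- apply (is_RInt_derive (V := R_CompleteNormedModule) (fun t => snd (F t)));
  intros x Hx; [apply H1, Hx|apply continuous_C_snd, H2, Hx].
Qed.

Lemma curve_derive_const (c : C) x : is_curve_derive (fun _ => c) x 0.
Proof. split; simpl; [apply (is_derive_const (V := R_NormedModule) (fst c))|
  apply (is_derive_const (V := R_NormedModule) (snd c))]. Qed.

Lemma curve_derive_plus F G x l k : is_curve_derive F x l -> is_curve_derive G x k -> is_curve_derive (fun t => F t + G t) x (l + k).
Proof. intros [H1 H2] [H3 H4]; split; simpl; apply (is_derive_plus (V := R_NormedModule)); assumption. Qed.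

Lemma curve_derive_minus F G x l k : is_curve_derive F x l -> is_curve_derive G x k -> is_curve_derive (fun t => F t - G t) x (l - k).
Proof. intros [H1 H2] [H3 H4]; split; simpl; apply (is_derive_minus (V := R_NormedModule)); assumption. Qed.

Lemma is_derive_Rmult (f g : R -> R) (x df dg : R) :
  is_derive f x df -> is_derive g x dg ->
  is_derive (fun t => f t * g t)%R x (df * g x + f x * dg)%R.
Proof.
intros Hf Hg; apply (is_derive_mult (K := R_AbsRing) f g); auto.
exact Rmult_comm.
Qed.

Lemma curve_derive_mult F G x l k : is_curve_derive F x l -> is_curve_derive G x k ->
  is_curve_derive (fun t => F t * G t) x (l * G x + F x * k).
Proof.
intros [H1 H2] [H3 H4]; split; simpl.
- replace (_ + _)%R with ((fst l * fst (G x) + fst (F x) * fst k)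
    - (snd l * snd (G x) + snd (F x) * snd k))%R by ring.
  apply (is_derive_minus (V := R_NormedModule)
    (fun t => fst (F t) * fst (G t))%R (fun t => snd (F t) * snd (G t))%R);
  apply is_derive_Rmult; assumption.
- replace (_ + _)%R with ((fst l * snd (G x) + fst (F x) * snd k)
    + (snd l * fst (G x) + snd (F x) * fst k))%R by ring.
  apply (is_derive_plus (V := R_NormedModule)
    (fun t => fst (F t) * snd (G t))%R (fun t => snd (F t) * fst (G t))%R);
  apply is_derive_Rmult; assumption.
Qed.

Lemma curve_derive_RtoC (f : R -> R) x l : is_derive f x l -> is_curve_derive (fun t => RtoC (f t)) x (RtoC l).
Proof. intros H; split; simpl; [exact H|apply (is_derive_const (V := R_NormedModule) 0%R)]. Qed.

Lemma curve_derive_eq F x l k : is_curve_derive F x l -> l = k -> is_curve_derive F x k.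
Proof. intros H <-; exact H. Qed.

Lemma exp_le a b : (a <= b)%R -> (exp a <= exp b)%R.
Proof. intros [H| ->]; [left; now apply exp_increasing|right; reflexivity]. Qed.

Definition cexp (z : C) : C := (exp (Re z) * cos (Im z), exp (Re z) * sin (Im z))%R.

Lemma cexp_plus a b : cexp (a + b) = cexp a * cexp b.
Proof.
apply Ceq; unfold cexp, Re, Im; simpl; rewrite exp_plus, ?cos_plus, ?sin_plus; ring.
Qed.

Lemma cexp_0 : cexp 0 = 1.
Proof. apply Ceq; unfold cexp; simpl; rewrite exp_0, ?cos_0, ?sin_0; ring. Qed.

Lemma Cmod_cexp z : Cmod (cexp z) = exp (Re z).
Proof.
unfold Cmod, cexp; simpl fst; simpl snd.
replace (_ + _)%R with (Rsqr (exp (Re z))).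
- apply sqrt_Rsqr, Rlt_le, exp_pos.
- rewrite <- (Rmult_1_r (Rsqr _)), <- (sin2_cos2 (Im z)); unfold Rsqr; ring.
Qed.

Lemma cexp_neq_0 z : cexp z <> 0.
Proof. apply Cmod_gt_0; rewrite Cmod_cexp; apply exp_pos. Qed.

Lemma cexp_opp z : cexp (- z) = / cexp z.
Proof.
assert (H : cexp z * cexp (- z) = 1).
{ rewrite <- cexp_plus, <- cexp_0; f_equal; ring. }
replace (/ cexp z) with (/ cexp z * (cexp z * cexp (- z))).
- field; apply cexp_neq_0.
- rewrite H; ring.
Qed.

Lemma curve_derive_cexp F x l : is_curve_derive F x l -> is_curve_derive (fun t => cexp (F t)) x (l * cexp (F x)).
Proof.
intros [H1 H2].
assert (He : is_derive (fun t => exp (fst (F t))) x (fst l * exp (fst (F x)))%R).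
{ apply (is_derive_comp (V := R_NormedModule) exp); [apply is_derive_exp|exact H1]. }
split; unfold cexp, Re, Im; simpl.
- replace (_ - _)%R with (fst l * exp (fst (F x)) * cos (snd (F x))
    + exp (fst (F x)) * (snd l * - sin (snd (F x))))%R by ring.
  apply (is_derive_Rmult (fun t => exp (fst (F t))) (fun t => cos (snd (F t)))); [exact He|].
  exact (is_derive_comp (V := R_NormedModule) cos (fun t => snd (F t)) x _ _
    (is_derive_cos _) H2).
- replace (_ + _)%R with (fst l * exp (fst (F x)) * sin (snd (F x))
    + exp (fst (F x)) * (snd l * cos (snd (F x))))%R by ring.
  apply (is_derive_Rmult (fun t => exp (fst (F t))) (fun t => sin (snd (F t)))); [exact He|].
  exact (is_derive_comp (V := R_NormedModule) sin (fun t => snd (F t)) x _ _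
    (is_derive_sin _) H2).
Qed.

(** Integrating the exponential along a segment from 0 yields its Taylor
    estimates without series. *)
Lemma is_CInt_cexp_line (a : C) (b : R) :
  is_CInt (fun t => a * cexp (RtoC t * a)) 0 b (cexp (RtoC b * a) - 1).
Proof.
assert (D : forall x, is_curve_derive (fun t => cexp (RtoC t * a)) x (a * cexp (RtoC x * a))).
{ intros x; eapply curve_derive_eq.
  - apply curve_derive_cexp, curve_derive_mult; [|apply curve_derive_const].
    apply curve_derive_RtoC, (is_derive_id (K := R_AbsRing)).
  - unfold one; simpl; ring. }
eapply is_CInt_eq.
- apply (is_CInt_derive (fun t => cexp (RtoC t * a))); intros x _; [apply D|].
  apply continuous_Cmult; [apply continuous_const|].
  eapply curve_derive_continuous, D.
- simpl; replace (RtoC 0 * a) with (RtoC 0) by ring; now rewrite cexp_0.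
Qed.

Lemma Cmod_cexp_minus_1 (a : C) : (Cmod (cexp a - 1) <= Cmod a * exp (Cmod a))%R.
Proof.
generalize (is_CInt_cexp_line a 1); intros H.
replace (RtoC 1 * a) with a in H by ring.
refine (Cmod_CInt_le _ (fun _ => (Cmod a * exp (Cmod a))%R) 0 1 _ _ Rle_0_1 _ H _).
- intros t Ht; rewrite Cmod_mult, Cmod_cexp.
  apply Rmult_le_compat_l; [apply Cmod_ge_0|].
  apply exp_le; unfold Re; simpl.
  generalize (fst_le_Cmod a) (Rle_abs (fst a)) (Rabs_pos (fst a)); nra.
- eapply is_RInt_eq; [apply is_RInt_constR|ring].
Qed.

(** Applying the first-order estimate inside the integral gains one more
    factor |a|. *)
Lemma Cmod_cexp_taylor (a : C) :
  (Cmod (cexp a - 1 - a) <= Cmod a ^ 2 * exp (Cmod a))%R.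
Proof.
generalize (is_CInt_cexp_line a 1); intros H.
replace (RtoC 1 * a) with a in H by ring.
generalize (is_CInt_minus _ _ _ _ _ _ H (is_CInt_const a 0 1)); intros H1.
replace (cexp a - 1 - RtoC (1 - 0) * a) with (cexp a - 1 - a) in H1
  by (rewrite RtoC_minus; ring).
refine (Cmod_CInt_le _ (fun _ => (Cmod a ^ 2 * exp (Cmod a))%R) 0 1 _ _ Rle_0_1 _ H1 _).
- intros t Ht.
  replace (a * cexp (RtoC t * a) - a) with (a * (cexp (RtoC t * a) - 1)) by ring.
  rewrite Cmod_mult; simpl; rewrite Rmult_1_r, Rmult_assoc.
  apply Rmult_le_compat_l; [apply Cmod_ge_0|].
  eapply Rle_trans; [apply Cmod_cexp_minus_1|].
  assert (Hm : (Cmod (RtoC t * a) <= Cmod a)%R).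
  { rewrite Cmod_mult, Cmod_RtoC_pos by lra. generalize (Cmod_ge_0 a); nra. }
  apply Rmult_le_compat; auto using Cmod_ge_0, Rlt_le, exp_pos, exp_le.
- eapply is_RInt_eq; [apply is_RInt_constR|ring].
Qed.

(** In this form a power is entire in its exponent and multiplicative. *)
Lemma cpow_cexp t s : cpow t s = cexp (s * RtoC (ln t)).
Proof. unfold cpow, cexp, Re, Im; simpl; apply Ceq; simpl; do 2 f_equal; ring. Qed.

Lemma cpow_add t a b : cpow t (a + b) = cpow t a * cpow t b.
Proof. rewrite !cpow_cexp, <- cexp_plus; f_equal; ring. Qed.

Lemma cpow_opp t a : cpow t (- a) = / cpow t a.
Proof. rewrite !cpow_cexp, <- cexp_opp; f_equal; ring. Qed.

Lemma cpow_neq_0 t a : cpow t a <> 0.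
Proof. rewrite cpow_cexp; apply cexp_neq_0. Qed.

Lemma cpow_1_l s : cpow 1 s = 1.
Proof. rewrite cpow_cexp, ln_1, <- cexp_0; f_equal; ring. Qed.

Lemma cpow_1_r t : (0 < t)%R -> cpow t 1 = RtoC t.
Proof.
intros Ht; rewrite cpow_cexp; apply Ceq; unfold cexp, Re, Im; simpl.
- replace (1 * ln t - 0 * 0)%R with (ln t) by ring.
  replace (1 * 0 + 0 * ln t)%R with 0%R by ring.
  rewrite cos_0, exp_ln by exact Ht; ring.
- replace (1 * 0 + 0 * ln t)%R with 0%R by ring.
  rewrite sin_0; ring.
Qed.

Lemma cpow_mult t u s : (0 < t)%R -> (0 < u)%R -> cpow (t * u) s = cpow t s * cpow u s.
Proof.
intros; rewrite !cpow_cexp, <- cexp_plus, ln_mult by assumption; f_equal.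
rewrite RtoC_plus; ring.
Qed.

Lemma cpow_div t u s : (0 < t)%R -> (0 < u)%R -> cpow (t / u) s = cpow t s / cpow u s.
Proof.
intros Ht Hu.
assert (E : cpow (t / u) s * cpow u s = cpow t s).
{ rewrite <- cpow_mult by (try apply Rdiv_lt_0_compat; assumption); f_equal; field; lra. }
rewrite <- E; field; apply cpow_neq_0.
Qed.

Lemma Cmod_cpow t s : Cmod (cpow t s) = Rpower t (Re s).
Proof.
rewrite cpow_cexp, Cmod_cexp; unfold Rpower; f_equal; unfold Re; simpl; ring.
Qed.

Lemma curve_derive_cpow s x : (0 < x)%R -> is_curve_derive (fun t => cpow t s) x (s * cpow x (s - 1)).
Proof.
intros Hx.
assert (H : is_curve_derive (fun t => cexp (s * RtoC (ln t))) x (s * RtoC (/ x) * cexp (s * RtoC (ln x)))).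
{ eapply curve_derive_eq.
  - apply curve_derive_cexp, curve_derive_mult; [apply curve_derive_const|].
    apply curve_derive_RtoC, (is_derive_ln x Hx).
  - simpl; ring. }
unfold Cminus; rewrite cpow_add, cpow_opp, cpow_1_r, cpow_cexp, <- RtoC_inv by lra.
destruct H as [H1 H2]; split.
- eapply is_derive_ext; [intros t; rewrite cpow_cexp; reflexivity|].
  replace (fst _) with (fst (s * RtoC (/ x) * cexp (s * RtoC (ln x)))); [exact H1|f_equal; ring].
- eapply is_derive_ext; [intros t; rewrite cpow_cexp; reflexivity|].
  replace (snd (s * _)) with (snd (s * RtoC (/ x) * cexp (s * RtoC (ln x)))); [exact H2|f_equal; ring].
Qed.

Lemma continuous_cpow s x : (0 < x)%R -> continuous (U := C_UniformSpace) (fun t => cpow t s) x.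
Proof. intros Hx; eapply curve_derive_continuous, curve_derive_cpow, Hx. Qed.

Lemma is_CInt_cpow (s : C) (a b : R) : (0 < a)%R -> (0 < b)%R -> s <> RtoC 0 ->
  is_CInt (fun t => cpow t (s - 1)) a b ((cpow b s - cpow a s) / s).
Proof.
intros Ha Hb Hs.
assert (P : forall x, (Rmin a b <= x)%R -> (0 < x)%R).
{ intros x Hx; eapply Rlt_le_trans; [|exact Hx]; apply Rmin_glb_lt; assumption. }
eapply is_RInt_ext; [|eapply is_CInt_eq; [apply (is_CInt_cmul (/ s)),
   (is_CInt_derive (fun t => cpow t s) (fun t => s * cpow t (s - 1)))|]].
- intros x _; simpl; field; exact Hs.
- intros x [Hx _]; apply curve_derive_cpow; auto.
- intros x [Hx _]; apply continuous_Cmult; [apply continuous_const|apply continuous_cpow; auto].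
- unfold Cdiv; ring.
Qed.

End ComplexCalculus.

(** * Complex differentiability in Caratheodory form *)

Section Holomorphic.
Local Open Scope C_scope.

(** Complex differentiability through a slope function continuous at the point:
    products, composites and quotients then need no estimate. *)
Definition holomorphic_at (f : C -> C) (z : C) : Prop :=
  exists phi : C -> C, (forall w, f w = f z + phi w * (w - z)) /\
    continuous (T := C_UniformSpace) (U := C_UniformSpace) phi z.

Lemma holo_continuous f z : holomorphic_at f z ->
  continuous (T := C_UniformSpace) (U := C_UniformSpace) f z.
Proof.
intros [phi [E H]].
apply (continuous_ext (T := C_UniformSpace) (U := C_UniformSpace)
  (fun w => f z + phi w * (w - z))); [intros w; symmetry; apply E|].
apply continuous_Cplus; [apply continuous_const|].
apply continuous_Cmult; [exact H|].
apply continuous_Cminus; [apply continuous_id|apply continuous_const].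
Qed.

Lemma holo_const c z : holomorphic_at (fun _ => c) z.
Proof. exists (fun _ => RtoC 0); split; [intros w; ring|apply continuous_const]. Qed.

Lemma holo_id z : holomorphic_at (fun w => w) z.
Proof. exists (fun _ => RtoC 1); split; [intros w; ring|apply continuous_const]. Qed.

Lemma holo_plus f g z : holomorphic_at f z -> holomorphic_at g z -> holomorphic_at (fun w => f w + g w) z.
Proof.
intros [p [E1 H1]] [q [E2 H2]]; exists (fun w => p w + q w); split.
- intros w; rewrite E1, E2; ring.
- apply continuous_Cplus; assumption.
Qed.

Lemma holo_mult f g z : holomorphic_at f z -> holomorphic_at g z -> holomorphic_at (fun w => f w * g w) z.
Proof.
intros Hf Hg; generalize (holo_continuous _ _ Hg); intros Cg.
destruct Hf as [p [E1 H1]], Hg as [q [E2 H2]].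
exists (fun w => p w * g w + f z * q w); split.
- intros w; rewrite E1, (E2 w); ring.
- apply continuous_Cplus; apply continuous_Cmult; auto using continuous_const.
Qed.

Lemma holo_minus f g z : holomorphic_at f z -> holomorphic_at g z -> holomorphic_at (fun w => f w - g w) z.
Proof.
intros [p [E1 H1]] [q [E2 H2]]; exists (fun w => p w - q w); split.
- intros w; rewrite E1, E2; ring.
- apply continuous_Cminus; assumption.
Qed.

Lemma holo_comp f g z : holomorphic_at f (g z) -> holomorphic_at g z -> holomorphic_at (fun w => f (g w)) z.
Proof.
intros Hf Hg; generalize (holo_continuous _ _ Hg); intros Cg.
destruct Hf as [p [E1 H1]], Hg as [q [E2 H2]].
exists (fun w => p (g w) * q w); split.
- intros w; rewrite E1, (E2 w); ring.
- apply continuous_Cmult; [|exact H2].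
  apply (continuous_comp (U := C_UniformSpace) (V := C_UniformSpace) g p); assumption.
Qed.

Lemma locally_neq (z a : C) : z <> a ->
  locally (T := C_UniformSpace) z (fun w => w <> a).
Proof.
intros Hz.
assert (H : (0 < Cmod (a - z))%R) by (apply Cmod_gt_0; intros E; apply Hz; apply Ceq_minus; rewrite <- Copp_0, <- E; ring).
generalize (proj1 (continuous_C_iff (T := C_UniformSpace) (fun w => w) z) (continuous_id z) _ H).
apply filter_imp; intros w Hw ->; lra.
Qed.

(** The slope function has to be rebuilt away from z, where f and g may differ. *)
Lemma holo_ext_loc f g z : locally (T := C_UniformSpace) z (fun w => f w = g w) ->
  holomorphic_at f z -> holomorphic_at g z.
Proof.
intros L [p [E H]].
assert (Ez : f z = g z) by exact (locally_singleton (T := C_UniformSpace) _ _ L).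
exists (fun w => if Ceq_dec w z then p z else (g w - g z) / (w - z)); split.
- intros w; destruct (Ceq_dec w z) as [->|n]; [ring|].
  field; intros K; apply n; now apply Ceq_minus.
- apply (continuous_ext_loc (T := C_UniformSpace) (U := C_UniformSpace) _ p); [|exact H].
  revert L; apply filter_imp; intros w Hw; cbv beta; destruct (Ceq_dec w z) as [->|n]; [reflexivity|].
  change (@eq C (p w) ((g w - g z) / (w - z))).
  rewrite <- Hw, E, <- Ez; field; intros K; apply n; now apply Ceq_minus.
Qed.

Lemma holo_inv (z : C) : z <> RtoC 0 -> holomorphic_at (fun w => / w) z.
Proof.
intros Hz; apply (holo_ext_loc (fun w => if Ceq_dec w 0 then RtoC 0 + 0 else / w)).
{ generalize (locally_neq z 0 Hz); apply filter_imp; intros w Hw; cbv beta.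
  destruct (Ceq_dec w 0); [contradiction|reflexivity]. }
exists (fun w => if Ceq_dec w 0 then / z * / z else - (/ z * / w)); split.
- intros w; destruct (Ceq_dec w 0) as [->|n], (Ceq_dec z 0); try contradiction;
  field; auto.
- apply (continuous_ext_loc (T := C_UniformSpace) (U := C_UniformSpace) _ (fun w => - (/ z * / w))).
  + generalize (locally_neq z 0 Hz); apply filter_imp; intros w Hw; cbv beta.
    destruct (Ceq_dec w 0); [contradiction|reflexivity].
  + apply continuous_Copp, continuous_Cmult; [apply continuous_const|].
    apply continuous_Cinv; [apply continuous_id|exact Hz].
Qed.

Lemma holo_div f g z : holomorphic_at f z -> holomorphic_at g z -> g z <> 0 -> holomorphic_at (fun w => f w / g w) z.
Proof.
intros; apply holo_mult; [assumption|].
apply (holo_comp (fun w => / w)); [apply holo_inv|]; assumption.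
Qed.

Lemma holo_pow f z n : holomorphic_at f z -> holomorphic_at (fun w => Cpow (f w) n) z.
Proof.
intros H; induction n; simpl; [apply holo_const|now apply holo_mult].
Qed.

Lemma holo_of_limit_quot (f : C -> C) (z l : C) :
  (forall eps, (0 < eps)%R -> exists del, (0 < del)%R /\ forall w, (Cmod (w - z) < del)%R ->
     (Cmod (f w - f z - l * (w - z)) <= eps * Cmod (w - z))%R) ->
  holomorphic_at f z.
Proof.
intros H.
exists (fun w => if Ceq_dec w z then l else (f w - f z) / (w - z)); split.
- intros w; destruct (Ceq_dec w z) as [->|n]; [ring|].
  field; intros K; apply n; now apply Ceq_minus.
- apply continuous_C_iff; intros eps Heps.
  destruct (H (eps / 2)%R) as [del [Hd Hw]]; [lra|].
  generalize (proj1 (continuous_C_iff (T := C_UniformSpace) (fun w => w) z) (continuous_id z) _ Hd).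
  apply filter_imp; intros w Hwz.
  destruct (Ceq_dec z z) as [_|]; [|contradiction].
  destruct (Ceq_dec w z) as [->|n].
  + replace (l - l) with (RtoC 0) by ring; rewrite Cmod_0; exact Heps.
  + assert (n' : w - z <> 0) by (intros K; apply n; now apply Ceq_minus).
    assert (P := proj1 (Cmod_gt_0 _) n').
    replace (_ - l) with ((f w - f z - l * (w - z)) / (w - z)) by (field; exact n').
    rewrite Cmod_div by exact n'.
    apply Rle_lt_trans with (eps / 2)%R; [|lra].
    apply Rle_div_l; [exact P|]; apply Hw, Hwz.
Qed.

Lemma holo_cexp z : holomorphic_at cexp z.
Proof.
apply (holo_of_limit_quot _ _ (cexp z)); intros eps He.
assert (P := exp_pos (Re z)). assert (P1 := exp_pos 1).
exists (Rmin 1 (eps / (exp (Re z) * exp 1))); split.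
{ apply Rmin_glb_lt; [lra|]; apply Rdiv_lt_0_compat; [exact He|nra]. }
intros w Hw.
assert (H1 := Rlt_le_trans _ _ _ Hw (Rmin_l _ _)).
assert (H2 := Rlt_le_trans _ _ _ Hw (Rmin_r _ _)).
replace (cexp w) with (cexp z * cexp (w - z)) by (rewrite <- cexp_plus; f_equal; ring).
replace (_ - _) with (cexp z * (cexp (w - z) - 1 - (w - z))) by ring.
rewrite Cmod_mult, Cmod_cexp.
apply Rle_trans with (exp (Re z) * (Cmod (w - z) ^ 2 * exp 1))%R.
- apply Rmult_le_compat_l; [lra|].
  eapply Rle_trans; [apply Cmod_cexp_taylor|].
  apply Rmult_le_compat_l; [apply pow2_ge_0|].
  apply exp_le; lra.
- assert (Q := Cmod_ge_0 (w - z)).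
  apply Rmult_lt_compat_r with (r := (exp (Re z) * exp 1)%R) in H2; [|nra].
  unfold Rdiv in H2; rewrite Rmult_assoc, Rinv_l, Rmult_1_r in H2 by nra.
  simpl; nra.
Qed.

Lemma holo_ex_derive (f : C -> C) (z : C) :
  ex_derive (K := C_AbsRing) (V := C_NormedModule) f z -> holomorphic_at f z.
Proof.
intros [l [_ H]].
apply (holo_of_limit_quot _ _ l); intros eps He.
specialize (H z (fun P HP => HP) (mkposreal _ He)).
destruct H as [del Hd]; exists (pos del); split; [apply cond_pos|].
intros w Hw; specialize (Hd w Hw).
unfold minus, plus, opp, scal, norm in Hd; simpl in Hd; unfold abs, mult in Hd; simpl in Hd.
unfold Cminus; rewrite (Cmult_comm l); exact Hd.
Qed.

End Holomorphic.

(** * Goursat: the boundary integral over a rectangle vanishes *)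

Section Goursat.
Local Open Scope C_scope.

Lemma CInt_unique (f : R -> C) (a b : R) (l : C) : is_CInt f a b l -> CInt f a b = l.
Proof. apply (is_RInt_unique (V := C_R_CompleteNormedModule)). Qed.

Lemma CInt_correct (f : R -> C) (a b : R) : (a <= b)%R ->
  (forall t, (a <= t <= b)%R -> continuous (U := C_UniformSpace) f t) ->
  is_CInt f a b (CInt f a b).
Proof.
intros Hab H; destruct (ex_CInt_continuous f a b) as [l Hl].
- now rewrite Rmin_left, Rmax_right.
- now rewrite (CInt_unique _ _ _ _ Hl).
Qed.

(** Integral of f over the boundary of [a, b] x [c, d], counterclockwise. *)
Definition rect_int (f : C -> C) (a b c d : R) : C :=
  CInt (fun t => f (t, c)) a b + Ci * CInt (fun t => f (b, t)) c d
  - CInt (fun t => f (t, d)) a b - Ci * CInt (fun t => f (a, t)) c d.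

Definition cont_rect (f : C -> C) (a b c d : R) : Prop :=
  forall z : C, (a <= fst z <= b)%R -> (c <= snd z <= d)%R ->
  continuous (T := C_UniformSpace) (U := C_UniformSpace) f z.

Lemma continuous_horizontal (f : C -> C) (t c : R) :
  continuous (T := C_UniformSpace) (U := C_UniformSpace) f (t, c) ->
  continuous (U := C_UniformSpace) (fun u : R => f (u, c)) t.
Proof.
intros H; apply (continuous_comp (V := C_UniformSpace) (W := C_UniformSpace) (fun u : R => (u, c)) f); [|exact H].
apply continuous_C; simpl; [apply continuous_id|apply continuous_const].
Qed.

Lemma continuous_vertical (f : C -> C) (t c : R) :
  continuous (T := C_UniformSpace) (U := C_UniformSpace) f (c, t) ->
  continuous (U := C_UniformSpace) (fun u : R => f (c, u)) t.
Proof.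
intros H; apply (continuous_comp (V := C_UniformSpace) (W := C_UniformSpace) (fun u : R => (c, u)) f); [|exact H].
apply continuous_C; simpl; [apply continuous_const|apply continuous_id].
Qed.

Lemma rect_int_sides f a b c d : (a <= b)%R -> (c <= d)%R -> cont_rect f a b c d ->
  (forall v, (c <= v <= d)%R -> is_CInt (fun t => f (t, v)) a b (CInt (fun t => f (t, v)) a b)) /\
  (forall u, (a <= u <= b)%R -> is_CInt (fun t => f (u, t)) c d (CInt (fun t => f (u, t)) c d)).
Proof.
intros Hab Hcd H; split; intros v Hv; apply CInt_correct; try assumption; intros t Ht;
[apply continuous_horizontal|apply continuous_vertical]; apply H; simpl; assumption.
Qed.

Lemma cont_rect_sub f a b c d a' b' c' d' : cont_rect f a b c d ->
  (a <= a')%R -> (b' <= b)%R -> (c <= c')%R -> (d' <= d)%R -> cont_rect f a' b' c' d'.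
Proof. intros H H1 H2 H3 H4 z Hz1 Hz2; apply H; lra. Qed.

Lemma CInt_Chasles (f : R -> C) a m b : (a <= m <= b)%R ->
  (forall t, (a <= t <= b)%R -> continuous (U := C_UniformSpace) f t) ->
  CInt f a b = CInt f a m + CInt f m b.
Proof.
intros Hm H; apply CInt_unique.
apply (is_RInt_Chasles (V := C_R_NormedModule) f a m b); apply CInt_correct; try lra;
intros t Ht; apply H; lra.
Qed.

Lemma rect_int_split_h f a m b c d : (a <= m <= b)%R -> (c <= d)%R -> cont_rect f a b c d ->
  rect_int f a b c d = rect_int f a m c d + rect_int f m b c d.
Proof.
intros Hm Hcd H; unfold rect_int.
rewrite (CInt_Chasles (fun t => f (t, c)) a m b), (CInt_Chasles (fun t => f (t, d)) a m b); try assumption.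
- ring.
- intros t Ht; apply continuous_horizontal, H; simpl; lra.
- intros t Ht; apply continuous_horizontal, H; simpl; lra.
Qed.

Lemma rect_int_split_v f a b c m d : (a <= b)%R -> (c <= m <= d)%R -> cont_rect f a b c d ->
  rect_int f a b c d = rect_int f a b c m + rect_int f a b m d.
Proof.
intros Hab Hm H; unfold rect_int.
rewrite (CInt_Chasles (fun t => f (a, t)) c m d), (CInt_Chasles (fun t => f (b, t)) c m d); try assumption.
- ring.
- intros t Ht; apply continuous_vertical, H; simpl; lra.
- intros t Ht; apply continuous_vertical, H; simpl; lra.
Qed.

(** Along each side an affine function integrates to a quadratic polynomial in
    the end points. *)
Lemma rect_int_affine A l a b c d : rect_int (fun w => A + l * w) a b c d = 0.
Proof.
assert (Hh : forall v, is_CInt (fun t => A + l * (t, v)) a b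
   (A * RtoC (b - a) + l * ((b * b - a * a) / 2, v * (b - a))%R)).
{ intros v; apply is_CInt_plus.
  - rewrite Cmult_comm; apply is_CInt_const.
  - apply is_CInt_cmul, is_CInt_components; simpl.
    + replace ((b * b - a * a) / 2)%R with (minus (b * b / 2) (a * a / 2))%R
        by (unfold minus, plus, opp; simpl; field).
      apply (is_RInt_derive (V := R_CompleteNormedModule) (fun t => t * t / 2)%R (fun t => t)).
      * intros x _; auto_derive; [exact I|field].
      * intros; apply continuous_id.
    + eapply is_RInt_eq; [apply is_RInt_constR|ring]. }
assert (Hv : forall u, is_CInt (fun t => A + l * (u, t)) c d
   (A * RtoC (d - c) + l * (u * (d - c), (d * d - c * c) / 2)%R)).
{ intros v; apply is_CInt_plus.
  - rewrite Cmult_comm; apply is_CInt_const.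
  - apply is_CInt_cmul, is_CInt_components; simpl.
    + eapply is_RInt_eq; [apply is_RInt_constR|ring].
    + replace ((d * d - c * c) / 2)%R with (minus (d * d / 2) (c * c / 2))%R
        by (unfold minus, plus, opp; simpl; field).
      apply (is_RInt_derive (V := R_CompleteNormedModule) (fun t => t * t / 2)%R (fun t => t)).
      * intros x _; auto_derive; [exact I|field].
      * intros; apply continuous_id. }
unfold rect_int; rewrite !(CInt_unique _ _ _ _ (Hh _)), !(CInt_unique _ _ _ _ (Hv _)).
apply Ceq; simpl; field.
Qed.

Lemma Cmod_CInt_const (f : R -> C) a b l M : (a <= b)%R -> is_CInt f a b l ->
  (forall t, (a <= t <= b)%R -> (Cmod (f t) <= M)%R) -> (Cmod l <= M * (b - a))%R.
Proof.
intros Hab H HM; apply (Cmod_CInt_le f (fun _ => M) a b); try assumption.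
- intros t Ht; apply HM; lra.
- eapply is_RInt_eq; [apply is_RInt_constR|ring].
Qed.

(** Only the distance to an affine function counts, since affine functions
    integrate to 0 over the boundary. *)
Lemma rect_int_near_affine f A l a b c d M : (a <= b)%R -> (c <= d)%R ->
  cont_rect f a b c d ->
  (forall z : C, (a <= fst z <= b)%R -> (c <= snd z <= d)%R ->
     (Cmod (f z - (A + l * z)) <= M)%R) ->
  (Cmod (rect_int f a b c d) <= 2 * M * ((b - a) + (d - c)))%R.
Proof.
intros Hab Hcd H HM.
assert (Haff : cont_rect (fun w => A + l * w) a b c d).
{ intros z _ _; apply continuous_Cplus; [apply continuous_const|].
  apply continuous_Cmult; [apply continuous_const|apply continuous_id]. }
destruct (rect_int_sides _ _ _ _ _ Hab Hcd H) as [Fh Fv].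
destruct (rect_int_sides _ _ _ _ _ Hab Hcd Haff) as [Ah Av].
assert (Bh : forall v, (c <= v <= d)%R -> (Cmod (CInt (fun t => f (t, v)) a b
    - CInt (fun t => (A + l * (t, v))%C) a b) <= M * (b - a))%R).
{ intros v Hv; eapply Cmod_CInt_const; [exact Hab|apply is_CInt_minus; [apply Fh|apply Ah]; exact Hv|].
  intros t Ht; apply HM; simpl; assumption. }
assert (Bv : forall u, (a <= u <= b)%R -> (Cmod (CInt (fun t => f (u, t)) c d
    - CInt (fun t => (A + l * (u, t))%C) c d) <= M * (d - c))%R).
{ intros v Hv; eapply Cmod_CInt_const; [exact Hcd|apply is_CInt_minus; [apply Fv|apply Av]; exact Hv|].
  intros t Ht; apply HM; simpl; assumption. }
rewrite <- (Cplus_0_r (rect_int f a b c d)); rewrite <- Copp_0 at 1; rewrite <- (rect_int_affine A l a b c d).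
unfold rect_int.
match goal with |- (Cmod (?X1 + Ci * ?X2 - ?X3 - Ci * ?X4 + - (?Y1 + Ci * ?Y2 - ?Y3 - Ci * ?Y4)) <= _)%R =>
  replace (X1 + Ci * X2 - X3 - Ci * X4 + - (Y1 + Ci * Y2 - Y3 - Ci * Y4))
  with ((X1 - Y1) + Ci * (X2 - Y2) + (- (X3 - Y3) + - (Ci * (X4 - Y4)))) by ring
end.
eapply Rle_trans; [apply Cmod_triangle|].
eapply Rle_trans; [apply Rplus_le_compat; apply Cmod_triangle|].
rewrite !Cmod_opp, !Cmod_mult, Cmod_Ci, !Rmult_1_l.
assert (B1 := Bh c ltac:(lra)). assert (B2 := Bv b ltac:(lra)).
assert (B3 := Bh d ltac:(lra)). assert (B4 := Bv a ltac:(lra)). lra.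
Qed.

Lemma INR_lt_pow2 n : (INR n < 2 ^ n)%R.
Proof.
induction n as [|n IH]; [simpl; lra|].
rewrite S_INR; simpl. assert (1 <= 2 ^ n)%R by (apply pow_R1_Rle; lra). lra.
Qed.

Lemma exists_pow2_small K del : (0 < del)%R -> exists n, (K / 2 ^ n < del)%R.
Proof.
intros Hd; destruct (INR_unbounded (K / del)) as [n Hn]; exists n.
assert (H := INR_lt_pow2 n). assert (P : (0 < 2 ^ n)%R) by (apply pow_lt; lra).
apply Rlt_div_l; [exact P|].
apply Rlt_div_l in Hn; [|exact Hd]. nra.
Qed.

Lemma nested_intervals (x h : nat -> R) :
  (forall n, (0 <= h n)%R) ->
  (forall n, (x n <= x (S n))%R /\ (x (S n) + h (S n) <= x n + h n)%R) ->
  exists l, forall n, (x n <= l <= x n + h n)%R.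
Proof.
intros Hh H.
assert (Hinc : forall n k, (x n <= x (n + k)%nat)%R).
{ intros n k; induction k; [rewrite Nat.add_0_r; lra|].
  rewrite Nat.add_succ_r; destruct (H (n + k)%nat); lra. }
assert (Hdec : forall n k, (x (n + k)%nat + h (n + k)%nat <= x n + h n)%R).
{ intros n k; induction k; [rewrite Nat.add_0_r; lra|].
  rewrite Nat.add_succ_r; destruct (H (n + k)%nat); lra. }
assert (Hall : forall m n, (x m <= x n + h n)%R).
{ intros m n; destruct (Nat.le_ge_cases m n) as [L|L].
  - replace n with (m + (n - m))%nat by lia; specialize (Hinc m (n - m)%nat);
    specialize (Hh (m + (n - m))%nat); lra.
  - replace m with (n + (m - n))%nat by lia; specialize (Hdec n (m - n)%nat);
    specialize (Hh (n + (m - n))%nat); lra. }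
destruct (completeness (fun y => exists n, y = x n)) as [l [Hu Hl]].
- exists (x 0%nat + h 0%nat)%R; intros y [n ->]; apply Hall.
- exists (x 0%nat), 0%nat; reflexivity.
- exists l; intros n; split; [apply Hu; now exists n|].
  apply Hl; intros y [m ->]; apply Hall.
Qed.

(** Pigeonhole behind the bisection: one of four pieces carries at least a
    quarter of the total. *)
Lemma quarter_large (z1 z2 z3 z4 : C) (K : R) :
  (K <= Cmod (z1 + z2 + (z3 + z4)))%R ->
  (K <= 4 * Cmod z1)%R \/ (K <= 4 * Cmod z2)%R \/ (K <= 4 * Cmod z3)%R \/ (K <= 4 * Cmod z4)%R.
Proof.
intros H.
assert (H1 := Cmod_triangle (z1 + z2) (z3 + z4)).
assert (H2 := Cmod_triangle z1 z2). assert (H3 := Cmod_triangle z3 z4).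
destruct (Rle_dec K (4 * Cmod z1)); [now left|].
destruct (Rle_dec K (4 * Cmod z2)); [now right; left|].
destruct (Rle_dec K (4 * Cmod z3)); [now right; right; left|].
right; right; right; lra.
Qed.

(** Bisection.  If the integral had modulus T > 0, some sequence of nested
    rectangles, each half as large as the one before, would have integrals of
    modulus at least T / 4^n.  They shrink to a point at which f is affine up to
    o(distance), so the integrals are also o(4^-n). *)
Theorem goursat f a b c d : (a <= b)%R -> (c <= d)%R ->
  (forall z : C, (a <= fst z <= b)%R -> (c <= snd z <= d)%R -> holomorphic_at f z) ->
  rect_int f a b c d = 0.
Proof.
intros Hab Hcd Hf.
assert (Hc : cont_rect f a b c d) by (intros z H1 H2; apply holo_continuous, Hf; assumption).
pose (h := fun n : nat => ((b - a) / 2 ^ n)%R).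
pose (k := fun n : nat => ((d - c) / 2 ^ n)%R).
assert (P2 : forall n : nat, (0 < 2 ^ n)%R) by (intros n; apply pow_lt; lra).
assert (Hh : forall n, (0 <= h n)%R) by (intros n; apply Rdiv_le_0_compat; [lra|apply P2]).
assert (Hk : forall n, (0 <= k n)%R) by (intros n; apply Rdiv_le_0_compat; [lra|apply P2]).
assert (Sh : forall n, h n = (2 * h (S n))%R).
{ intros n; unfold h; simpl; specialize (P2 n); field; lra. }
assert (Sk : forall n, k n = (2 * k (S n))%R).
{ intros n; unfold k; simpl; specialize (P2 n); field; lra. }
pose (J := fun n (p : R * R) =>
  Cmod (rect_int f (fst p) (fst p + h n) (snd p) (snd p + k n))).
pose (inside := fun n (p : R * R) =>
  (a <= fst p)%R /\ (fst p + h n <= b)%R /\ (c <= snd p)%R /\ (snd p + k n <= d)%R).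
pose (step := fun n (p q : R * R) =>
  inside (S n) q /\ (J n p <= 4 * J (S n) q)%R /\
  ((fst p <= fst q)%R /\ (fst q + h (S n) <= fst p + h n)%R) /\
  ((snd p <= snd q)%R /\ (snd q + k (S n) <= snd p + k n)%R)).
assert (Hstep : forall n p, inside n p -> exists q, step n p q).
{ intros n [x y] [I1 [I2 [I3 I4]]]; simpl in *.
  assert (Eh := Sh n). assert (Ek := Sk n).
  assert (Gh := Hh (S n)). assert (Gk := Hk (S n)).
  set (h' := h (S n)) in *. set (k' := k (S n)) in *.
  assert (E : rect_int f x (x + h n) y (y + k n) =
    rect_int f x (x + h') y (y + k') + rect_int f x (x + h') (y + k') (y + k' + k')
    + (rect_int f (x + h') (x + h' + h') y (y + k')
       + rect_int f (x + h') (x + h' + h') (y + k') (y + k' + k'))).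
  { replace (y + k' + k')%R with (y + k n)%R by lra.
    replace (x + h' + h')%R with (x + h n)%R by lra.
    rewrite (rect_int_split_h f x (x + h') (x + h n)); [f_equal; apply rect_int_split_v|..];
    try lra; eapply cont_rect_sub; try exact Hc; lra. }
  (* the four corners of the bisected rectangle *)
  destruct (quarter_large _ _ _ _ _ (Req_le _ _ (f_equal Cmod E))) as [Q|[Q|[Q|Q]]];
  [exists (x, y)|exists (x, (y + k')%R)|exists ((x + h')%R, y)|exists ((x + h')%R, (y + k')%R)];
  (split; [unfold inside; simpl; fold h' k'; lra|split; [exact Q|simpl; fold h' k'; lra]]). }
pose (next := fun n p => epsilon (inhabits p) (step n p)).
pose (corner := fix corner n := match n with O => (a, c) | S n => next n (corner n) end).
assert (Hin : forall n, inside n (corner n)).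
{ induction n as [|n IH].
  - unfold inside, h, k; simpl; lra.
  - apply (epsilon_spec (inhabits (corner n)) (step n (corner n))), Hstep, IH. }
assert (Hst : forall n, step n (corner n) (corner (S n))).
{ intros n; apply (epsilon_spec (inhabits (corner n)) (step n (corner n))), Hstep, Hin. }
destruct (nested_intervals (fun n => fst (corner n)) h Hh) as [xs Hxs].
{ intros n; apply (Hst n). }
destruct (nested_intervals (fun n => snd (corner n)) k Hk) as [ys Hys].
{ intros n; apply (Hst n). }
assert (HJ : forall n, (J O (corner O) <= 4 ^ n * J n (corner n))%R).
{ induction n as [|n IH]; [simpl; lra|].
  destruct (Hst n) as [_ [Q _]].
  assert (0 < 4 ^ n)%R by (apply pow_lt; lra). simpl pow; nra. }
destruct (Hf (xs, ys)) as [phi [Ephi Cphi]].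
{ simpl; specialize (Hxs O); simpl in Hxs; unfold h in Hxs; simpl in Hxs; lra. }
{ simpl; specialize (Hys O); simpl in Hys; unfold k in Hys; simpl in Hys; lra. }
set (zs := (xs, ys)) in *.
apply Cmod_eq_0.
assert (HJ0 : J O (corner O) = Cmod (rect_int f a b c d)).
{ unfold J, h, k; simpl; do 2 f_equal; field. }
destruct (Rle_lt_or_eq_dec _ _ (Cmod_ge_0 (rect_int f a b c d))) as [Hpos|E]; [exfalso|now symmetry].
set (S := (b - a + (d - c))%R) in *.
assert (HS : (0 <= S)%R) by (unfold S; lra).
set (T := Cmod (rect_int f a b c d)) in *.
(* at scale n the integral is at most 2 eps S^2 / 4^n; this eps makes it less
   than T / 4^n *)
pose (eps := (T / (4 * (S * S + 1)))%R).
assert (PS : (0 < S * S + 1)%R) by nra.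
assert (Heps : (0 < eps)%R) by (apply Rdiv_lt_0_compat; lra).
destruct (proj1 (continuous_C_iff (T := C_UniformSpace) phi zs) Cphi eps Heps) as [del Hdel].
destruct (exists_pow2_small S del (cond_pos del)) as [n Hn].
assert (HhS : (h n + k n = S / 2 ^ n)%R).
{ unfold h, k, S; specialize (P2 n); field; lra. }
specialize (Hxs n). specialize (Hys n). specialize (HJ n). specialize (Hin n).
destruct (corner n) as [x y]; simpl in Hxs, Hys.
destruct Hin as [I1 [I2 [I3 I4]]]; simpl in I1, I2, I3, I4.
assert (G1 := Hh n). assert (G2 := Hk n).
assert (B : (J n (x, y) <= 2 * (eps * (S / 2 ^ n)) * (S / 2 ^ n))%R).
{ unfold J; simpl fst; simpl snd.
  replace (S / 2 ^ n)%R with ((x + h n - x) + (y + k n - y))%R at 2 by lra.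
  apply (rect_int_near_affine f (f zs - phi zs * zs) (phi zs)); try lra.
  - eapply cont_rect_sub; [exact Hc|lra..].
  - intros z Hz1 Hz2.
    rewrite (Ephi z).
    replace (_ - _) with ((phi z - phi zs) * (z - zs)) by ring.
    rewrite Cmod_mult; apply Rmult_le_compat; try apply Cmod_ge_0.
    + apply Rlt_le, Hdel; split; unfold ball; simpl; unfold AbsRing_ball, abs, minus, plus, opp; simpl;
      apply Rabs_lt_between; simpl; lra.
    + eapply Rle_trans; [apply Cmod_le_sum|]; rewrite <- HhS; simpl.
      apply Rplus_le_compat; apply Rabs_le_between; lra. }
rewrite HJ0 in HJ.
assert (F : (4 ^ n * (2 * (eps * (S / 2 ^ n)) * (S / 2 ^ n)) = 2 * eps * (S * S))%R).
{ replace 4%R with (2 * 2)%R by ring; rewrite Rpow_mult_distr; specialize (P2 n); field; lra. }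
assert (H4 : (0 < 4 ^ n)%R) by (apply pow_lt; lra).
assert (HT : (T <= 2 * eps * (S * S))%R) by nra.
assert (E4 : (eps * (4 * (S * S + 1)) = T)%R) by (unfold eps; field; lra).
nra.
Qed.

End Goursat.

(** * Mean values on circles and the identity theorem on a half-plane *)

Section IdentityTheorem.
Local Open Scope C_scope.

(** The circle of radius e^u, in logarithmic polar coordinates. *)
Definition on_circle (p : C) (u t : R) : C := p + cexp (u, t).

Lemma Cmod_on_circle p u t : Cmod (on_circle p u t - p) = exp u.
Proof.
unfold on_circle; replace (p + _ - p) with (cexp (u, t)) by ring.
now rewrite Cmod_cexp.
Qed.

(** Goursat for w |-> f (p + e^w) on [u1, u2] x [0, 2 pi]: the two horizontal
    sides cancel by periodicity of the exponential. *)
Lemma circle_mean_const (f : C -> C) (p : C) (u1 u2 : R) : (u1 <= u2)%R ->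
  (forall z, (Cmod (z - p) <= exp u2)%R -> holomorphic_at f z) ->
  CInt (fun t => f (on_circle p u1 t)) 0 (2 * PI)
  = CInt (fun t => f (on_circle p u2 t)) 0 (2 * PI).
Proof.
intros Hu Hf.
assert (HPI := PI_RGT_0).
assert (G : rect_int (fun w => f (p + cexp w)) u1 u2 0 (2 * PI) = 0).
{ apply goursat; [exact Hu|lra|].
  intros z Hz _; apply (holo_comp f).
  - apply Hf; replace (p + cexp z - p) with (cexp z) by ring.
    rewrite Cmod_cexp; apply exp_le; apply Hz.
  - apply holo_plus; [apply holo_const|apply holo_cexp]. }
unfold rect_int in G; fold (on_circle p u2) in G.
rewrite (RInt_ext (V := C_R_CompleteNormedModule) (fun t => f (p + cexp (t, 2 * PI)%R))
  (fun t => f (p + cexp (t, 0%R)))) in G.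
2:{ intros t _; do 2 f_equal; unfold cexp; simpl.
    now rewrite cos_2PI, sin_2PI, cos_0, sin_0. }
unfold on_circle.
match type of G with ?A + Ci * ?B - ?A' - Ci * ?D = _ =>
  replace (A + Ci * B - A' - Ci * D) with (Ci * (B - D)) in G by ring;
  assert (E : B - D = 0)
   by (replace (B - D) with (- Ci * (Ci * (B - D))) by
         (replace (- Ci * (Ci * (B - D))) with (- (Ci * Ci) * (B - D)) by ring;
          replace (Ci * Ci) with (- (1)) by (apply Ceq; simpl; ring); ring);
       rewrite G; ring)
end.
symmetry; apply Ceq_minus, E.
Qed.

(** The mean over a circle does not depend on the radius and tends to f(p) when
    the radius tends to 0. *)
Lemma Cmod_center_le (f : C -> C) (p : C) (u M : R) :
  (forall z, (Cmod (z - p) <= exp u)%R -> holomorphic_at f z) ->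
  (forall t, (0 <= t <= 2 * PI)%R -> (Cmod (f (on_circle p u t)) <= M)%R) ->
  (Cmod (f p) <= M)%R.
Proof.
intros Hf HM.
assert (HPI := PI_RGT_0).
apply le_epsilon; intros eps Heps.
assert (Hp : continuous (T := C_UniformSpace) (U := C_UniformSpace) f p).
{ apply holo_continuous, Hf; replace (p - p) with (RtoC 0) by ring.
  rewrite Cmod_0; apply Rlt_le, exp_pos. }
destruct (proj1 (continuous_C_iff (T := C_UniformSpace) f p) Hp eps Heps) as [del Hdel].
pose (u1 := Rmin u (ln (del / 2))).
assert (Pd := cond_pos del).
(* a circle so small that f is eps-close to f(p) on it *)
assert (Hsmall : (exp u1 < del)%R).
{ apply Rle_lt_trans with (del / 2)%R; [|lra].
  rewrite <- (exp_ln (del / 2)) by lra; apply exp_le, Rmin_r. }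
assert (Hcirc : forall v, (v <= u)%R ->
  is_CInt (fun t => f (on_circle p v t)) 0 (2 * PI)
    (CInt (fun t => f (on_circle p v t)) 0 (2 * PI))).
{ intros v Hv; apply CInt_correct; [lra|]; intros t _.
  apply (continuous_comp (V := C_UniformSpace) (W := C_UniformSpace) (on_circle p v) f).
  - unfold on_circle; apply continuous_Cplus; [apply continuous_const|].
    apply (continuous_vertical cexp), holo_continuous, holo_cexp.
  - apply holo_continuous, Hf; rewrite Cmod_on_circle; now apply exp_le. }
assert (H1 := Hcirc u1 (Rmin_l _ _)).
assert (B : (Cmod (CInt (fun t => f (on_circle p u1 t)) 0 (2 * PI)
   - RtoC (2 * PI - 0) * f p) <= eps * (2 * PI - 0))%R).
{ eapply Cmod_CInt_const; [lra|apply is_CInt_minus; [exact H1|apply is_CInt_const]|].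
  intros t _; apply Rlt_le, Hdel.
  assert (K := Cmod_on_circle p u1 t).
  split; unfold ball; simpl; unfold AbsRing_ball, abs, minus, plus, opp; simpl.
  - eapply Rle_lt_trans; [apply (fst_le_Cmod (on_circle p u1 t - p))|]; lra.
  - eapply Rle_lt_trans; [apply (snd_le_Cmod (on_circle p u1 t - p))|]; lra. }
rewrite (circle_mean_const f p u1 u (Rmin_l _ _) Hf) in B.
assert (B2 : (Cmod (CInt (fun t => f (on_circle p u t)) 0 (2 * PI)) <= M * (2 * PI - 0))%R).
{ eapply Cmod_CInt_const; [lra|apply Hcirc, Rle_refl|]; exact HM. }
set (V := CInt (fun t => f (on_circle p u t)) 0 (2 * PI)) in *.
assert (E : RtoC (2 * PI - 0) * f p = V - (V - RtoC (2 * PI - 0) * f p)) by ring.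
apply (f_equal Cmod) in E.
rewrite Cmod_mult, Cmod_RtoC_pos in E by lra.
assert (T := Cmod_triangle_minus V (V - RtoC (2 * PI - 0) * f p)).
apply Rmult_le_reg_l with (2 * PI - 0)%R; lra.
Qed.

(** The quotient f(z)/(z-q)^n stays differentiable, f being 0 near q.  Its value
    at p has denominator |p-q|^n while on the circle the denominator is at least
    (2|p-q|)^n, so |f(p)| <= B 2^-n for every n. *)
Lemma vanish_propagates (f : C -> C) (p q : C) (r : R) : (0 < r)%R ->
  (forall z, (Cmod (z - p) <= r)%R -> holomorphic_at f z) ->
  (Cmod (q - p) <= r / 4)%R ->
  locally (T := C_UniformSpace) q (fun z => f z = 0) ->
  f p = 0.
Proof.
intros Hr Hf Hq Hloc.
destruct (Ceq_dec p q) as [->|Hpq].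
{ exact (locally_singleton (T := C_UniformSpace) _ _ Hloc). }
assert (HPI := PI_RGT_0).
set (u := ln r). assert (Eu : exp u = r) by (apply exp_ln, Hr).
destruct (continuity_ab_maj (fun t => Cmod (f (on_circle p u t))) 0 (2 * PI)) as [t0 [Ht0 _]]; [lra| |].
{ intros t _; apply continuity_pt_filterlim.
  apply (continuous_Cmod (fun t => f (on_circle p u t))).
  apply (continuous_comp (V := C_UniformSpace) (W := C_UniformSpace) (on_circle p u) f).
  - unfold on_circle; apply continuous_Cplus; [apply continuous_const|].
    apply (continuous_vertical cexp), holo_continuous, holo_cexp.
  - apply holo_continuous, Hf; rewrite Cmod_on_circle, Eu; apply Rle_refl. }
set (B := Cmod (f (on_circle p u t0))) in *.
assert (HB : (0 <= B)%R) by apply Cmod_ge_0.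
assert (Dpq : (0 < Cmod (p - q))%R).
{ apply Cmod_gt_0; intros E; apply Hpq, Ceq_minus, E. }
assert (Hn : forall n, (Cmod (f p) <= B * (1 / 2) ^ n)%R).
{ intros n.
  assert (Hz : forall z, (Cmod (z - p) <= exp u)%R -> holomorphic_at (fun z => f z / (z - q) ^ n) z).
  { intros z Hz; rewrite Eu in Hz; destruct (Ceq_dec z q) as [->|Hzq].
    - apply (holo_ext_loc (fun _ => RtoC 0)); [|apply holo_const].
      revert Hloc; apply filter_imp; intros w ->; unfold Cdiv; now rewrite Cmult_0_l.
    - apply holo_div; [now apply Hf| |].
      + apply holo_pow, holo_minus; [apply holo_id|apply holo_const].
      + apply Cpow_nz; intros E; apply Hzq, Ceq_minus, E. }
  assert (K : (Cmod (f p / (p - q) ^ n) <= B / (Cmod (p - q) * 2) ^ n)%R).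
  { apply (Cmod_center_le (fun z => f z / (z - q) ^ n) p u); [exact Hz|].
    intros t Ht.
    assert (D : (Cmod (p - q) * 2 <= Cmod (on_circle p u t - q))%R).
    { assert (C1 := Cmod_on_circle p u t); rewrite Eu in C1.
      assert (C2 := Cmod_triangle_minus (on_circle p u t - q) (p - q)).
      replace (on_circle p u t - q - (p - q)) with (on_circle p u t - p) in C2 by ring.
      rewrite Cmod_minus_sym in Hq; lra. }
    rewrite Cmod_div, Cmod_pow.
    - unfold Rdiv; apply Rmult_le_compat; [apply Cmod_ge_0| |now apply Ht0|].
      + apply Rlt_le, Rinv_0_lt_compat, pow_lt; lra.
      + apply Rinv_le_contravar; [apply pow_lt; lra|].
        apply pow_incr; lra.
    - apply Cpow_nz, Cmod_gt_0; lra. }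
  rewrite Cmod_div, Cmod_pow in K by (apply Cpow_nz, Cmod_gt_0; exact Dpq).
  assert (Pn : (0 < Cmod (p - q) ^ n)%R) by (apply pow_lt, Dpq).
  apply (proj1 (Rle_div_l _ _ _ Pn)) in K.
  eapply Rle_trans; [exact K|]; right.
  assert (0 < 2 ^ n)%R by (apply pow_lt; lra).
  rewrite Rpow_mult_distr; unfold Rdiv; rewrite Rmult_1_l, pow_inv; field; lra. }
apply Cmod_eq_0, Rle_antisym; [|apply Cmod_ge_0].
apply Rnot_lt_le; intros Hpos.
destruct (exists_pow2_small B (Cmod (f p)) Hpos) as [n Hs].
specialize (Hn n).
replace (B * (1 / 2) ^ n)%R with (B / 2 ^ n)%R in Hn; [lra|].
unfold Rdiv; now rewrite Rmult_1_l, pow_inv.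
Qed.

Lemma locally_open_box (z : C) (a b : R) (e : R) : (a < fst z)%R -> (b < e * snd z)%R ->
  locally (T := C_UniformSpace) z (fun w => (a < fst w)%R /\ (b < e * snd w)%R).
Proof.
intros Ha Hb.
assert (H1 : locally (T := C_UniformSpace) z (fun w => (a < fst w)%R)).
{ apply (continuous_C_fst (T := C_UniformSpace) (fun w => w) z (continuous_id z)).
  apply open_gt, Ha. }
assert (H2 : locally (T := C_UniformSpace) z (fun w => (b < e * snd w)%R)).
{ assert (Cs : continuous (T := C_UniformSpace) (fun w : C => e * snd w)%R z).
  { apply (continuous_mult (K := R_AbsRing)); [apply continuous_const|].
    apply (continuous_C_snd (T := C_UniformSpace) (fun w => w) z (continuous_id z)). }
  apply Cs, open_gt, Hb. }
exact (filter_and _ _ H1 H2).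
Qed.

(** Only points with imaginary part of sign e and away from the axes are met, so
    all discs of radius d/2 stay in the domain and each step gains d/8. *)
Lemma vanish_quadrant (f : C -> C) (e : R) : (e = 1 \/ e = -1)%R ->
  (forall z : C, (0 < fst z)%R -> (0 < e * snd z)%R -> holomorphic_at f z) ->
  (forall z : C, (1 < fst z)%R -> f z = 0) ->
  forall z : C, (0 < fst z)%R -> (0 < e * snd z)%R -> f z = 0.
Proof.
intros He Hf H1 z Hz1 Hz2.
set (d := (Rmin (fst z) (e * snd z) / 2)%R).
assert (Pm : (0 < Rmin (fst z) (e * snd z))%R) by (apply Rmin_glb_lt; assumption).
assert (M1 := Rmin_l (fst z) (e * snd z)). assert (M2 := Rmin_r (fst z) (e * snd z)).
assert (Hd : (0 < d)%R) by (unfold d; lra).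
assert (Hind : forall n (w : C), (d < fst w)%R -> (d < e * snd w)%R ->
   (1 - INR n * (d / 8) < fst w)%R -> f w = 0).
{ induction n as [|n IH]; intros w W1 W2 W3.
  - apply H1; simpl in W3; lra.
  - rewrite S_INR in W3.
    apply (vanish_propagates f w (w + RtoC (d / 8)) (d / 2)); [lra| | |].
    + intros v Hv.
      assert (V1 := fst_le_Cmod (v - w)). assert (V2 := snd_le_Cmod (v - w)).
      simpl in V1, V2.
      assert (V1' : (Rabs (fst v + - fst w) <= d / 2)%R) by lra.
      assert (V2' : (Rabs (snd v + - snd w) <= d / 2)%R) by lra.
      apply Rabs_le_between in V1', V2'.
      apply Hf; destruct He; subst e; lra.
    + replace (w + RtoC (d / 8) - w) with (RtoC (d / 8)) by ring.
      rewrite Cmod_RtoC_pos; lra.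
    + eapply filter_imp; [|apply (locally_open_box (w + RtoC (d / 8))
         (Rmax d (1 - INR n * (d / 8))) d e)].
      * intros v [V1 V2]; apply IH; try assumption;
        (eapply Rle_lt_trans; [|exact V1]); [apply Rmax_l|apply Rmax_r].
      * simpl; apply Rmax_lub_lt; lra.
      * simpl; rewrite Rplus_0_r; lra. }
destruct (INR_unbounded (8 / d)) as [n Hn].
apply (Hind n); unfold d in *; try lra.
set (d' := (Rmin (fst z) (e * snd z) / 2)%R) in *.
apply Rlt_div_l in Hn; [|exact Hd].
nra.
Qed.

(** Removing the real axis splits the half-plane in two quadrants, both meeting
    Re z > 1, and leaves aside the excluded point. *)
Theorem identity_half_plane (f : C -> C) :
  (forall z : C, (0 < fst z)%R -> z <> RtoC 1 -> holomorphic_at f z) ->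
  (forall z : C, (1 < fst z)%R -> f z = 0) ->
  forall z : C, (0 < fst z)%R -> z <> RtoC 1 -> f z = 0.
Proof.
intros Hf H1.
assert (Hoff : forall z : C, (0 < fst z)%R -> snd z <> 0%R -> f z = 0).
{ intros z Hz Hs.
  assert (N : forall e (w : C), (0 < e * snd w)%R -> w <> RtoC 1).
  { intros e w Hw ->; simpl in Hw; lra. }
  destruct (Rlt_or_le 0 (snd z)).
  - apply (vanish_quadrant f 1); try assumption; auto; [|lra].
    intros w W1 W2; apply Hf; [exact W1|eapply N, W2].
  - apply (vanish_quadrant f (-1)); try assumption; auto; [|lra].
    intros w W1 W2; apply Hf; [exact W1|eapply N, W2]. }
intros z Hz Hz1.
destruct (Req_dec (snd z) 0) as [E|E]; [|now apply Hoff].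
apply Cmod_eq_0, Rle_antisym; [|apply Cmod_ge_0].
apply le_epsilon; intros eps Heps; rewrite Rplus_0_l.
destruct (proj1 (continuous_C_iff (T := C_UniformSpace) f z)
  (holo_continuous _ _ (Hf z Hz Hz1)) eps Heps) as [del Hdel].
assert (Pd := cond_pos del).
assert (K : (Cmod (f (fst z, (del / 2)%R) - f z) < eps)%R).
{ apply Hdel; split; unfold ball; simpl; unfold AbsRing_ball, abs, minus, plus, opp; simpl;
  apply Rabs_lt_between; lra. }
rewrite (Hoff (fst z, (del / 2)%R)) in K by (simpl; lra).
replace (0 - f z) with (- f z) in K by ring; rewrite Cmod_opp in K; lra.
Qed.

End IdentityTheorem.

(** * Integrals of sums whose length depends on the variable *)

Section StepSums.
Local Open Scope C_scope.

(** The number of terms of [sum_upto]. *)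
Definition nat_floor (x : R) : nat := Z.to_nat (Zfloor x).

Lemma nat_floor_bounds x : (0 <= x)%R -> (INR (nat_floor x) <= x < INR (nat_floor x) + 1)%R.
Proof.
intros Hx; unfold nat_floor.
assert (H := Zfloor_bound x).
assert (0 <= Zfloor x)%Z by (apply Zfloor_lub; exact Hx).
rewrite INR_IZR_INZ, Z2Nat.id by assumption; lra.
Qed.

Lemma le_nat_floor n x : (0 <= x)%R -> (n <= nat_floor x)%nat <-> (INR n <= x)%R.
Proof.
intros Hx; destruct (nat_floor_bounds x Hx) as [H1 H2]; split; intros H.
- apply le_INR in H; lra.
- apply Nat.lt_succ_r, INR_lt; rewrite S_INR; lra.
Qed.

Lemma nat_floor_unique n x : (INR n <= x < INR n + 1)%R -> nat_floor x = n.
Proof.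
intros H; assert (Hx : (0 <= x)%R) by (generalize (pos_INR n); lra).
destruct (nat_floor_bounds x Hx) as [H1 H2].
apply Nat.le_antisymm; apply Nat.lt_succ_r, INR_lt; rewrite S_INR; lra.
Qed.

Lemma nat_floor_INR n : nat_floor (INR n) = n.
Proof. apply nat_floor_unique; lra. Qed.

Lemma nat_floor_ge_1 x : (1 <= x)%R -> (1 <= nat_floor x)%nat.
Proof. intros; apply le_nat_floor; simpl; lra. Qed.

Lemma nat_floor_mono x y : (0 <= x <= y)%R -> (nat_floor x <= nat_floor y)%nat.
Proof. intros H; apply le_nat_floor; [lra|]. destruct (nat_floor_bounds x); lra. Qed.

Definition rsum (f : nat -> R) (n : nat) : R := sum_n_m f 1 n.
Definition csum (f : nat -> C) (n : nat) : C := sum_n_m (G := C_AbelianMonoid) f 1 n.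

Lemma csum_0 f : csum f 0 = 0.
Proof. apply (sum_n_m_zero (G := C_AbelianMonoid)); lia. Qed.

Lemma csum_S f n : csum f (S n) = csum f n + f (S n).
Proof. apply (sum_n_Sm (G := C_AbelianMonoid)); lia. Qed.

Lemma rsum_0 f : rsum f 0 = 0%R.
Proof. apply (sum_n_m_zero (G := R_AbelianMonoid)); lia. Qed.

Lemma rsum_S f n : rsum f (S n) = (rsum f n + f (S n))%R.
Proof. apply (sum_n_Sm (G := R_AbelianMonoid)); lia. Qed.

Lemma csum_RtoC f n : RtoC (rsum f n) = csum (fun k => RtoC (f k)) n.
Proof.
induction n as [|n IH]; [now rewrite rsum_0, csum_0|].
now rewrite rsum_S, csum_S, RtoC_plus, IH.
Qed.

Lemma csum_ext f g n : (forall k, (1 <= k <= n)%nat -> f k = g k) -> csum f n = csum g n.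
Proof.
intros H; induction n as [|n IH]; [now rewrite !csum_0|].
rewrite !csum_S, IH, H; [reflexivity|lia|intros; apply H; lia].
Qed.

Lemma csum_plus f g n : csum (fun k => f k + g k) n = csum f n + csum g n.
Proof. induction n as [|n IH]; [rewrite !csum_0; ring|rewrite !csum_S, IH; ring]. Qed.

Lemma csum_minus f g n : csum (fun k => f k - g k) n = csum f n - csum g n.
Proof. induction n as [|n IH]; [rewrite !csum_0; ring|rewrite !csum_S, IH; ring]. Qed.

Lemma csum_cmul c f n : csum (fun k => c * f k) n = c * csum f n.
Proof. induction n as [|n IH]; [rewrite !csum_0; ring|rewrite !csum_S, IH; ring]. Qed.

Lemma csum_zero n : csum (fun _ => RtoC 0) n = 0.
Proof. induction n as [|n IH]; [now rewrite csum_0|rewrite csum_S, IH; ring]. Qed.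

Lemma csum_swap (f : nat -> nat -> C) n p :
  csum (fun i => csum (f i) p) n = csum (fun j => csum (fun i => f i j) n) p.
Proof.
induction n as [|n IH].
- rewrite csum_0; symmetry; rewrite <- (csum_zero p); apply csum_ext; intros; apply csum_0.
- rewrite csum_S, IH, <- csum_plus; apply csum_ext; intros k _; now rewrite csum_S.
Qed.

(** Fixing the range of summation lets sums of variable length be integrated
    term by term. *)
Lemma csum_indicator f n p : (n <= p)%nat ->
  csum f n = csum (fun k => if le_dec k n then f k else 0) p.
Proof.
intros H; induction H as [|p H IH].
- apply csum_ext; intros k Hk; destruct (le_dec k n); [reflexivity|lia].
- rewrite csum_S, <- IH; destruct (le_dec (S p) n); [lia|]; ring.
Qed.

Lemma sum_upto_csum f x : sum_upto (G := C_AbelianMonoid) f x = csum f (nat_floor x).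
Proof. reflexivity. Qed.

Lemma sum_upto_rsum f x : sum_upto f x = rsum f (nat_floor x).
Proof. reflexivity. Qed.

Lemma is_CInt_csum (phi : nat -> R -> C) (L : nat -> C) a b n :
  (forall k, (1 <= k <= n)%nat -> is_CInt (phi k) a b (L k)) ->
  is_CInt (fun t => csum (fun k => phi k t) n) a b (csum L n).
Proof.
intros H; induction n as [|n IH].
- rewrite csum_0; eapply is_RInt_ext; [intros x _; symmetry; apply csum_0|].
  eapply is_CInt_eq; [apply is_CInt_const|ring].
- rewrite csum_S; eapply is_RInt_ext; [intros x _; symmetry; apply csum_S|].
  apply is_CInt_plus; [apply IH; intros; apply H; lia|apply H; lia].
Qed.

Lemma is_CInt_zero (f : R -> C) a b : (forall t, (Rmin a b < t < Rmax a b)%R -> f t = 0) ->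
  is_CInt f a b (RtoC 0).
Proof.
intros H; eapply is_RInt_ext; [intros t Ht; symmetry; apply H, Ht|].
eapply is_CInt_eq; [apply is_CInt_const|ring].
Qed.

(** The k-th term is switched on at t = k. *)
Lemma is_CInt_sum_le_t (phi : nat -> R -> C) (L : nat -> C) a y : (0 <= a <= y)%R ->
  (forall k, (1 <= k)%nat -> (INR k <= y)%R -> is_CInt (phi k) (Rmax a (INR k)) y (L k)) ->
  is_CInt (fun t => csum (fun k => phi k t) (nat_floor t)) a y (csum L (nat_floor y)).
Proof.
intros Hay H.
apply (is_RInt_ext (V := C_R_NormedModule)
  (fun t => csum (fun k => if Rle_dec (INR k) t then phi k t else 0) (nat_floor y))).
{ intros t Ht; rewrite Rmin_left, Rmax_right in Ht by lra.
  rewrite (csum_indicator _ (nat_floor t) (nat_floor y)) by (apply nat_floor_mono; lra).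
  apply csum_ext; intros k _.
  assert (Eq := le_nat_floor k t ltac:(lra)).
  destruct (Rle_dec (INR k) t), (le_dec k (nat_floor t)); try reflexivity; tauto. }
apply is_CInt_csum; intros k [Hk1 Hk2].
apply le_nat_floor in Hk2; [|lra].
assert (M1 := Rmax_l a (INR k)). assert (M2 := Rmax_r a (INR k)).
assert (M3 : (Rmax a (INR k) <= y)%R) by (apply Rmax_lub; lra).
replace (L k) with (0 + L k) by ring.
apply (is_RInt_Chasles (V := C_R_NormedModule)) with (Rmax a (INR k)).
- apply is_CInt_zero; intros t Ht; rewrite Rmin_left, Rmax_right in Ht by lra.
  destruct (Rle_dec (INR k) t); [|reflexivity].
  exfalso; revert Ht; unfold Rmax; destruct (Rle_dec a (INR k)); lra.
- eapply is_RInt_ext; [|apply H; assumption].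
  intros t Ht; rewrite Rmin_left, (Rmax_right _ y) in Ht by lra.
  destruct (Rle_dec (INR k) t); [reflexivity|lra].
Qed.

(** The k-th term is switched off at t = x/k. *)
Lemma is_CInt_sum_le_x_over_t (phi : nat -> R -> C) (L : nat -> C) x : (1 <= x)%R ->
  (forall k, (1 <= k)%nat -> (INR k <= x)%R -> is_CInt (phi k) 1 (x / INR k) (L k)) ->
  is_CInt (fun t => csum (fun k => phi k t) (nat_floor (x / t))) 1 x (csum L (nat_floor x)).
Proof.
intros Hx H.
apply (is_RInt_ext (V := C_R_NormedModule)
  (fun t => csum (fun k => if Rle_dec (INR k * t) x then phi k t else 0) (nat_floor x))).
{ intros t Ht; rewrite Rmin_left, Rmax_right in Ht by lra.
  assert (P : (0 <= x / t)%R) by (apply Rdiv_le_0_compat; lra).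
  rewrite (csum_indicator _ (nat_floor (x / t)) (nat_floor x)).
  2:{ apply nat_floor_mono; split; [exact P|]; apply Rle_div_l; nra. }
  apply csum_ext; intros k _.
  assert (Eq : (INR k * t <= x)%R <-> (k <= nat_floor (x / t))%nat).
  { rewrite (le_nat_floor k (x / t) P); apply Rle_div_r; lra. }
  destruct (Rle_dec (INR k * t) x), (le_dec k (nat_floor (x / t))); try reflexivity; tauto. }
apply is_CInt_csum; intros k [Hk1 Hk2].
apply le_nat_floor in Hk2; [|lra].
assert (Pk : (1 <= INR k)%R) by (apply (le_INR 1); exact Hk1).
assert (M1 : (1 <= x / INR k)%R) by (apply Rle_div_r; lra).
assert (M2 : (x / INR k <= x)%R) by (apply Rle_div_l; nra).
replace (L k) with (L k + 0) by ring.
apply (is_RInt_Chasles (V := C_R_NormedModule)) with (x / INR k)%R.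
- eapply is_RInt_ext; [|apply H; assumption].
  intros t Ht; rewrite Rmin_left, Rmax_right in Ht by lra.
  destruct (Rle_dec (INR k * t) x) as [|N]; [reflexivity|exfalso; apply N].
  destruct Ht as [_ Ht]; apply Rlt_div_r in Ht; lra.
- apply is_CInt_zero; intros t Ht; rewrite Rmin_left, Rmax_right in Ht by lra.
  destruct (Rle_dec (INR k * t) x) as [N|]; [|reflexivity].
  destruct Ht as [Ht _]; apply Rlt_div_l in Ht; lra.
Qed.

(** The weight a_k contributes f' on [max(y, k), z]. *)
Lemma abel_summation (a : nat -> C) (f f' : R -> C) y z : (0 < y <= z)%R ->
  (forall u v, (0 < u)%R -> (0 < v)%R -> is_CInt f' u v (f v - f u)) ->
  is_CInt (fun t => csum a (nat_floor t) * f' t) y z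
    (csum a (nat_floor z) * f z - csum a (nat_floor y) * f y
     - (csum (fun k => a k * f (INR k)) (nat_floor z) - csum (fun k => a k * f (INR k)) (nat_floor y))).
Proof.
intros Hyz Hf.
apply (is_RInt_ext (V := C_R_NormedModule) (fun t => csum (fun k => a k * f' t) (nat_floor t))).
{ intros t _; rewrite (Cmult_comm (csum _ _)), <- csum_cmul; apply csum_ext; intros; apply Cmult_comm. }
eapply is_CInt_eq.
- apply (is_CInt_sum_le_t _ (fun k => a k * (f z - f (Rmax y (INR k))))); [lra|].
  intros k Hk1 Hk2; apply is_CInt_cmul, Hf; [|lra].
  eapply Rlt_le_trans; [|apply Rmax_l]; lra.
- assert (Hle : (nat_floor y <= nat_floor z)%nat) by (apply nat_floor_mono; lra).
  rewrite (Cmult_comm (csum a (nat_floor z))), <- csum_cmul.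
  rewrite (Cmult_comm (csum a (nat_floor y))), <- csum_cmul.
  rewrite (csum_indicator (fun k => f y * a k) _ _ Hle).
  rewrite (csum_indicator (fun k => a k * f (INR k)) _ _ Hle) at 1.
  rewrite <- !csum_minus; apply csum_ext; intros k [Hk1 Hk2]; cbv beta.
  destruct (le_dec k (nat_floor y)) as [D|D].
  + apply le_nat_floor in D; [|lra]; rewrite Rmax_left by lra; ring.
  + assert (D' : (y < INR k)%R).
    { apply Rnot_le_lt; intros K; apply D, le_nat_floor; lra. }
    rewrite Rmax_right by lra; ring.
Qed.

Lemma is_CInt_comp_inv (f : R -> C) x c : (0 < x)%R -> (0 < c <= x)%R ->
  (forall u, (0 < u)%R -> continuous (U := C_UniformSpace) f u) ->
  is_CInt (fun t => f (x / t)%R / RtoC (t ^ 2)) 1 (x / c) (RtoC (/ x) * CInt f c x).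
Proof.
intros Hx Hc Hf.
assert (Hpos : (1 <= x / c)%R) by (apply Rle_div_r; lra).
assert (D := is_RInt_comp (V := C_R_CompleteNormedModule) f (fun t => x / t)%R (fun t => - x / t ^ 2)%R 1 (x / c)).
cbv beta in D.
replace (x / (x / c))%R with c in D by (field; lra).
replace (x / 1)%R with x in D by field.
rewrite Rmin_left, Rmax_right in D by exact Hpos.
assert (D' : is_CInt (fun t => scal (- x / t ^ 2)%R (f (x / t)%R : C_R_CompleteNormedModule)) 1 (x / c) (CInt f x c)).
{ apply D.
  - intros t Ht; apply Hf, Rdiv_lt_0_compat; lra.
  - intros t Ht; split.
    + auto_derive; [lra|field; lra].
    + apply (continuous_ext_loc _ (fun t => - x * / (t * t))%R).
      * apply filter_forall; intros u; unfold Rdiv; simpl; now rewrite Rmult_1_r.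
      * apply (continuous_mult (K := R_AbsRing)); [apply continuous_const|].
        apply continuity_pt_filterlim, continuity_pt_inv; [|nra].
        apply continuity_pt_mult; apply derivable_continuous_pt, derivable_pt_id. }
assert (Ef : CInt f x c = - CInt f c x).
{ symmetry; apply (opp_RInt_swap (V := C_R_CompleteNormedModule)).
  eexists; apply CInt_correct; [lra|]; intros u Hu; apply Hf; lra. }
rewrite Ef in D'.
eapply is_RInt_ext; [|eapply is_CInt_eq; [apply (is_CInt_cmul (RtoC (- / x)) _ _ _ _ D')|]].
- intros t Ht; rewrite Rmin_left, Rmax_right in Ht by exact Hpos; cbv beta.
  rewrite scal_R_Cmult, Cmult_assoc, <- RtoC_mult.
  unfold Cdiv; rewrite (Cmult_comm (f _)), <- RtoC_inv by (apply pow_nonzero; lra).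
  do 2 f_equal; field; lra.
- rewrite RtoC_opp; ring.
Qed.

(** Any function given on [n, n+1) by a function of n is a telescoping sum of
    the kind integrated above. *)
Lemma piecewise_csum (G : nat -> R -> C) u : (forall t, G O t = RtoC 0) ->
  G (nat_floor u) u = csum (fun k => G k u - G (pred k) u) (nat_floor u).
Proof.
intros H0; induction (nat_floor u) as [|n IH]; [rewrite csum_0; apply H0|].
rewrite csum_S, <- IH; simpl; ring.
Qed.

(** The change of variables u = x/t, which the fundamental theorem only gives for
    continuous integrands, holds termwise. *)
Lemma piecewise_substitution (G : nat -> R -> C) x : (1 <= x)%R ->
  (forall t, G O t = RtoC 0) ->
  (forall n u, (0 < u)%R -> continuous (U := C_UniformSpace) (G n) u) ->
  exists l : C, is_CInt (fun u => G (nat_floor u) u) 1 x l /\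
    is_CInt (fun t => G (nat_floor (x / t)) (x / t)%R / RtoC (t ^ 2)) 1 x (RtoC (/ x) * l).
Proof.
intros Hx H0 HG.
pose (phi := fun k u => G k u - G (pred k) u).
assert (Hphi : forall k u, (0 < u)%R -> continuous (U := C_UniformSpace) (phi k) u).
{ intros k u Hu; apply continuous_Cminus; apply HG, Hu. }
exists (csum (fun k => CInt (phi k) (INR k) x) (nat_floor x)); split.
- eapply is_RInt_ext; [intros u _; symmetry; apply (piecewise_csum G u H0)|].
  apply (is_CInt_sum_le_t phi); [lra|].
  intros k Hk1 Hk2; assert (Pk : (1 <= INR k)%R) by (apply (le_INR 1); exact Hk1).
  rewrite Rmax_right by exact Pk; apply CInt_correct; [exact Hk2|].
  intros u Hu; apply Hphi; lra.
- rewrite <- csum_cmul.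
  apply (is_RInt_ext (V := C_R_NormedModule)
    (fun t => csum (fun k => phi k (x / t)%R / RtoC (t ^ 2)) (nat_floor (x / t)))).
  + intros t _; rewrite (piecewise_csum G (x / t) H0); unfold Cdiv.
    rewrite (Cmult_comm (csum _ _)), <- csum_cmul; apply csum_ext; intros; apply Cmult_comm.
  + apply (is_CInt_sum_le_x_over_t (fun k t => phi k (x / t)%R / RtoC (t ^ 2))); [exact Hx|].
    intros k Hk1 Hk2; assert (Pk : (1 <= INR k)%R) by (apply (le_INR 1); exact Hk1).
    apply is_CInt_comp_inv; [lra|lra|apply Hphi].
Qed.

End StepSums.

(** * Arithmetic of the Moebius function *)

Module MoebiusArith.
Import ssreflect ssrfun ssrbool eqtype ssrnat seq div prime.

Lemma moebius_1 : moebius 1 = 1%R.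
Proof. by []. Qed.

Lemma dvdn_divide (a b : nat) : (a %| b)%N <-> Nat.divide a b.
Proof.
split; first by case/dvdnP=> k ->; exists k.
by case=> k ->; rewrite dvdn_mull.
Qed.

Lemma prime_gt_1 (p : nat) : prime p -> lt 1 p.
Proof. by move=> /prime_gt1 /ltP. Qed.

Lemma exists_prime_divisor (n : nat) :
  lt 1 n -> exists p : nat, prime p /\ Nat.divide p n.
Proof.
move=> /ltP n1; exists (pdiv n); rewrite pdiv_prime //; split=> //.
by apply/dvdn_divide; rewrite pdiv_dvd.
Qed.

Lemma prime_mul_divide (p d j : nat) : prime p -> ~ Nat.divide p d ->
  Nat.divide p j -> Nat.divide d j -> Nat.divide (p * d) j.
Proof.
move=> pp npd /dvdn_divide pj /dvdn_divide dj; apply/dvdn_divide.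
rewrite Gauss_dvd ?pj ?dj // prime_coprime //.
by apply/negP => H; apply: npd; apply/dvdn_divide.
Qed.

Lemma all_logn_eqb (n : nat) (ps : seq nat) :
  all (fun p => Nat.eqb (logn p n) 1) ps = all (fun p => logn p n == 1%N) ps.
Proof.
apply: eq_all => p /=.
by case: (Nat.eqb_spec (logn p n) 1) => [-> //|H]; apply/esym/eqP.
Qed.

Lemma moebius_square_factor (p n : nat) :
  prime p -> lt 0 n -> moebius (p * (p * n)) = 0%R.
Proof.
move=> pp /ltP n0; rewrite /moebius all_logn_eqb.
have p0 := prime_gt0 pp.
suff -> : all (fun q => logn q (p * (p * n)) == 1%N) (primes (p * (p * n))) = false
  by rewrite andbF.
apply/negbTE/allPn; exists p.
  by rewrite mem_primes pp !muln_gt0 p0 n0 dvdn_mulr.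
by rewrite !lognM ?muln_gt0 ?p0 ?n0 // logn_prime // eqxx.
Qed.

Lemma moebius_prime_mul (p d : nat) : prime p -> lt 0 d -> ~ Nat.divide p d ->
  moebius (p * d) = (- moebius d)%R.
Proof.
move=> pp /ltP d0 pd; have {pd}npd : ~~ (p %| d)%N.
  by apply/negP => /dvdn_divide.
rewrite /moebius !all_logn_eqb.
have p0 := prime_gt0 pp.
have np : p \notin primes d by rewrite mem_primes pp d0.
have pe : perm_eq (primes (p * d)) (p :: primes d).
  apply: uniq_perm; rewrite /= ?primes_uniq ?np // => q.
  by rewrite primesM // primes_prime // !inE.
rewrite muln_gt0 p0 d0 (perm_all _ pe) (perm_size pe) /=.
rewrite lognM // logn_prime // eqxx.
have -> : logn p d = 0%N by apply/eqP; rewrite lognE pp d0 (negbTE npd).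
rewrite addn0 eqxx /=.
have -> : all (fun q => logn q (p * d) == 1%N) (primes d)
    = all (fun q => logn q d == 1%N) (primes d).
  apply: eq_in_all => q qd; rewrite lognM // logn_prime //.
  suff /negbTE -> : q != p by [].
  by apply: contraNneq np => <-.
case: ifP => _ /=; ring.
Qed.
End MoebiusArith.

(** * Moebius inversion for finite sums *)

Section MoebiusInversion.
Local Open Scope C_scope.

Lemma csum_tail f n p : (n <= p)%nat -> (forall k, (n < k <= p)%nat -> f k = RtoC 0) ->
  csum f p = csum f n.
Proof.
intros H; induction H as [|p H IH]; intros Hf; [reflexivity|].
rewrite csum_S, IH, Hf; [ring|lia|intros; apply Hf; lia].
Qed.

(** Divisibility as a decidable filter inside sums; for d = 0 it is the relation
    j = 0, as for [Nat.divide]. *)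
Definition if_dvd (d j : nat) (z : C) : C := if Nat.eq_dec (j mod d) 0 then z else 0.

Lemma if_dvd_yes d j z : Nat.divide d j -> if_dvd d j z = z.
Proof.
intros H; unfold if_dvd; destruct (Nat.eq_dec (j mod d) 0) as [|N]; [reflexivity|].
exfalso; apply N, Nat.Lcm0.mod_divide, H.
Qed.

Lemma if_dvd_no d j z : ~ Nat.divide d j -> if_dvd d j z = 0.
Proof.
intros H; unfold if_dvd; destruct (Nat.eq_dec (j mod d) 0) as [N|]; [|reflexivity].
exfalso; apply H, Nat.Lcm0.mod_divide, N.
Qed.

Lemma divide_dec d j : {Nat.divide d j} + {~ Nat.divide d j}.
Proof.
destruct (Nat.eq_dec (j mod d) 0) as [N|N]; [left|right]; rewrite <- Nat.Lcm0.mod_divide; exact N.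
Qed.

(** Summing over the multiples of n up to N, indexed by the quotient or by the
    multiple itself. *)
Lemma csum_multiples n N F : (1 <= n)%nat ->
  csum (fun k => F (n * k)%nat) (N / n) = csum (fun j => if_dvd n j (F j)) N.
Proof.
intros Hn; induction N as [|N IH].
- rewrite Nat.Div0.div_0_l, !csum_0; reflexivity.
- rewrite csum_S, <- IH.
  assert (H1 := Nat.div_mod_eq N n). assert (H2 := Nat.mod_upper_bound N n ltac:(lia)).
  destruct (divide_dec n (S N)) as [[q Hq]|D].
  + rewrite if_dvd_yes by (exists q; exact Hq).
    replace (S N / n)%nat with q by (rewrite Hq, Nat.div_mul; lia).
    assert (Eq : q = S (N / n)) by nia.
    rewrite Eq, csum_S; f_equal; f_equal; rewrite Hq, Eq; apply Nat.mul_comm.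
  + rewrite if_dvd_no by exact D; rewrite Cplus_0_r; f_equal.
    symmetry; apply (Nat.div_unique _ _ _ (S (N mod n))); [|lia].
    enough (S (N mod n) <> n) by lia.
    intros E; apply D; exists (S (N / n)); nia.
Qed.

(** For a prime p dividing j, the divisors d prime to p and their multiples pd
    cancel in pairs, and multiples of p^2 contribute 0. *)
Lemma moebius_divisor_sum j : (1 <= j)%nat ->
  csum (fun d => if_dvd d j (RtoC (moebius d))) j = if Nat.eq_dec j 1 then 1 else 0.
Proof.
intros Hj; destruct (Nat.eq_dec j 1) as [->|Hj1].
{ rewrite csum_S, csum_0, if_dvd_yes by apply Nat.divide_refl.
  rewrite MoebiusArith.moebius_1; ring. }
destruct (MoebiusArith.exists_prime_divisor j) as [p [Pp Pj]]; [lia|].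
assert (P1 := MoebiusArith.prime_gt_1 p Pp).
set (g := fun d => if_dvd d j (RtoC (moebius d))).
set (g0 := fun d => if divide_dec p d then RtoC 0 else g d).
assert (E : forall d, g d = g0 d + if_dvd p d (g d)).
{ intros d; unfold g0; destruct (divide_dec p d) as [D|D];
  [rewrite if_dvd_yes by exact D|rewrite if_dvd_no by exact D]; ring. }
rewrite (csum_ext g _ j (fun d _ => E d)), csum_plus, <- csum_multiples by lia.
(* a divisor k of j prime to p is at most j/p, since pk divides j *)
assert (E1 : csum g0 j = csum g0 (j / p)).
{ apply csum_tail; [apply Nat.Div0.div_le_upper_bound; nia|].
  intros k Hk; unfold g0, g; destruct (divide_dec p k) as [|D]; [reflexivity|].
  apply if_dvd_no; intros Dk.
  assert (L := Nat.divide_pos_le (p * k) j ltac:(lia) (MoebiusArith.prime_mul_divide p k j Pp D Pj Dk)).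
  assert (k <= j / p)%nat by (apply Nat.div_le_lower_bound; lia). lia. }
assert (E2 : csum (fun k => g (p * k)%nat) (j / p) = csum (fun k => - (1) * g0 k) (j / p)).
{ apply csum_ext; intros k Hk; unfold g0, g; destruct (divide_dec p k) as [[q ->]|D].
  - replace (p * (q * p))%nat with (p * (p * q))%nat by lia.
    rewrite MoebiusArith.moebius_square_factor by (try exact Pp; nia).
    unfold if_dvd; destruct (Nat.eq_dec _ _); ring.
  - rewrite MoebiusArith.moebius_prime_mul, RtoC_opp by (try assumption; lia).
    destruct (divide_dec k j) as [Dk|Dk].
    + rewrite if_dvd_yes by (apply MoebiusArith.prime_mul_divide; assumption).
      rewrite if_dvd_yes by exact Dk; ring.
    + rewrite (if_dvd_no k) by exact Dk.
      rewrite if_dvd_no; [ring|]; intros [c Hc]; apply Dk; exists (c * p)%nat; lia. }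
rewrite E1, E2, csum_cmul; ring.
Qed.

(** Collecting the terms with nk = j leaves F(j) times the sum of mu over the
    divisors of j. *)
Lemma moebius_inversion_sum (F : nat -> C) N : (1 <= N)%nat ->
  csum (fun n => RtoC (moebius n) * csum (fun k => F (n * k)%nat) (N / n)) N = F 1%nat.
Proof.
intros HN.
transitivity (csum (fun j => F j * csum (fun n => if_dvd n j (RtoC (moebius n))) N) N).
- transitivity (csum (fun n => csum (fun j => F j * if_dvd n j (RtoC (moebius n))) N) N).
  + apply csum_ext; intros n Hn; rewrite csum_multiples by lia.
    rewrite <- csum_cmul; apply csum_ext; intros j _.
    unfold if_dvd; destruct (Nat.eq_dec _ _); ring.
  + rewrite csum_swap; apply csum_ext; intros j _; apply csum_cmul.
- rewrite (csum_tail _ 1 N HN).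
  + rewrite csum_S, csum_0, (csum_tail _ 1 N HN), moebius_divisor_sum by
     (lia || (intros k Hk; apply if_dvd_no; intros D; apply Nat.divide_pos_le in D; lia)).
    simpl; ring.
  + intros k Hk; rewrite (csum_tail _ k N), moebius_divisor_sum by
     (lia || (intros i Hi; apply if_dvd_no; intros D; apply Nat.divide_pos_le in D; lia)).
    destruct (Nat.eq_dec k 1); [lia|ring].
Qed.

Lemma nat_floor_div x n : (0 <= x)%R -> (1 <= n)%nat -> nat_floor (x / INR n) = (nat_floor x / n)%nat.
Proof.
intros Hx Hn.
assert (Pn : (1 <= INR n)%R) by (apply (le_INR 1); exact Hn).
apply nat_floor_unique.
destruct (nat_floor_bounds x Hx) as [H1 H2].
assert (E := Nat.div_mod_eq (nat_floor x) n). assert (L := Nat.mod_upper_bound (nat_floor x) n ltac:(lia)).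
set (q := (nat_floor x / n)%nat) in *. set (r := (nat_floor x mod n)%nat) in *.
assert (G : (INR (nat_floor x) + 1 <= INR n * (INR q + 1))%R).
{ rewrite <- !S_INR, <- mult_INR; apply le_INR; nia. }
assert (G' : (INR n * INR q <= INR (nat_floor x))%R).
{ rewrite <- mult_INR; apply le_INR; lia. }
split; [apply Rle_div_r; lra|apply Rlt_div_l; lra].
Qed.

Lemma moebius_inversion_upto (F : nat -> C) x : (1 <= x)%R ->
  csum (fun n => RtoC (moebius n) * csum (fun k => F (n * k)%nat) (nat_floor (x / INR n))) (nat_floor x) = F 1%nat.
Proof.
intros Hx; rewrite <- (moebius_inversion_sum F (nat_floor x)) by (apply nat_floor_ge_1, Hx).
apply csum_ext; intros n Hn; rewrite nat_floor_div by (lra || lia); reflexivity.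
Qed.

End MoebiusInversion.

(** * Limits of complex sequences and the truncated zeta function *)

Section TruncatedZeta.
Local Open Scope C_scope.

Definition C_converges (u : nat -> C) (l : C) : Prop :=
  forall eps, (0 < eps)%R -> exists N, forall n, (N <= n)%nat -> (Cmod (u n - l) < eps)%R.

Lemma C_converges_unique u l1 l2 : C_converges u l1 -> C_converges u l2 -> l1 = l2.
Proof.
intros H1 H2; apply Ceq_minus, Cmod_eq_0, Rle_antisym; [|apply Cmod_ge_0].
apply le_epsilon; intros eps He.
destruct (H1 (eps / 2)%R) as [N1 K1]; [lra|]. destruct (H2 (eps / 2)%R) as [N2 K2]; [lra|].
specialize (K1 (N1 + N2)%nat ltac:(lia)). specialize (K2 (N1 + N2)%nat ltac:(lia)).
assert (T := Cmod_triangle_minus (u (N1 + N2)%nat - l2) (u (N1 + N2)%nat - l1)).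
replace (u (N1 + N2)%nat - l2 - (u (N1 + N2)%nat - l1)) with (l1 - l2) in T by ring. lra.
Qed.

Lemma C_converges_bound u l a B : C_converges u l ->
  (forall eps, (0 < eps)%R -> exists N, forall n, (N <= n)%nat -> (Cmod (u n - a) <= B + eps)%R) ->
  (Cmod (l - a) <= B)%R.
Proof.
intros H1 H2; apply le_epsilon; intros eps He.
destruct (H1 (eps / 2)%R) as [N1 K1]; [lra|]. destruct (H2 (eps / 2)%R) as [N2 K2]; [lra|].
specialize (K1 (N1 + N2)%nat ltac:(lia)). specialize (K2 (N1 + N2)%nat ltac:(lia)).
assert (T := Cmod_triangle_minus (u (N1 + N2)%nat - a) (u (N1 + N2)%nat - l)).
replace (u (N1 + N2)%nat - a - (u (N1 + N2)%nat - l)) with (l - a) in T by ring. lra.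
Qed.

Lemma C_converges_cauchy u :
  (forall eps, (0 < eps)%R -> exists N, forall n m, (N <= n)%nat -> (N <= m)%nat ->
     (Cmod (u n - u m) < eps)%R) -> exists l, C_converges u l.
Proof.
intros H.
assert (H1 : ex_finite_lim_seq (fun n => fst (u n))).
{ apply ex_lim_seq_cauchy_corr; intros eps.
  destruct (H eps (cond_pos eps)) as [N HN]; exists N; intros n p Hn Hp.
  eapply Rle_lt_trans; [apply (fst_le_Cmod (u n - u p))|]; now apply HN. }
assert (H2 : ex_finite_lim_seq (fun n => snd (u n))).
{ apply ex_lim_seq_cauchy_corr; intros eps.
  destruct (H eps (cond_pos eps)) as [N HN]; exists N; intros n p Hn Hp.
  eapply Rle_lt_trans; [apply (snd_le_Cmod (u n - u p))|]; now apply HN. }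
destruct H1 as [l1 L1], H2 as [l2 L2]; exists (l1, l2); intros eps He.
assert (He2 : (0 < eps / 2)%R) by lra.
apply is_lim_seq_spec in L1; apply is_lim_seq_spec in L2.
destruct (L1 (mkposreal _ He2)) as [N1 K1], (L2 (mkposreal _ He2)) as [N2 K2].
exists (N1 + N2)%nat; intros n Hn.
specialize (K1 n ltac:(lia)). specialize (K2 n ltac:(lia)).
eapply Rle_lt_trans; [apply Cmod_le_sum|]; simpl in *.
unfold Rminus in *; lra.
Qed.

(** The uniform quadratic bound makes the derivatives of u_n a Cauchy sequence:
    they differ by at most 2 K |h| plus the differences of the values divided by
    |h|, with h at our disposal. *)
Lemma holo_limit (u : nat -> C -> C) (F : C -> C) (z : C) (r K : R) : (0 < r)%R -> (0 < K)%R ->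
  (forall w, (Cmod (w - z) < r)%R -> C_converges (fun n => u n w) (F w)) ->
  (forall n, exists l, forall w, (Cmod (w - z) < r)%R ->
     (Cmod (u n w - u n z - l * (w - z)) <= K * Cmod (w - z) ^ 2)%R) ->
  holomorphic_at F z.
Proof.
intros Hr HK Hcv Hq.
pose (l := fun n => epsilon (inhabits (RtoC 0)) (fun l => forall w, (Cmod (w - z) < r)%R ->
     (Cmod (u n w - u n z - l * (w - z)) <= K * Cmod (w - z) ^ 2)%R)).
assert (Hl : forall n w, (Cmod (w - z) < r)%R ->
     (Cmod (u n w - u n z - l n * (w - z)) <= K * Cmod (w - z) ^ 2)%R).
{ intros n; exact (epsilon_spec _ _ (Hq n)). }
assert (Hz : C_converges (fun n => u n z) (F z)).
{ apply Hcv; replace (z - z) with (RtoC 0) by ring; now rewrite Cmod_0. }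
assert (Hlc : exists L, C_converges l L).
{ apply C_converges_cauchy; intros eps He.
  (* probing the derivatives with a real increment d *)
  set (d := Rmin (r / 2) (eps / (8 * K))).
  assert (d1 : (d <= r / 2)%R) by apply Rmin_l.
  assert (d2 : (d <= eps / (8 * K))%R) by apply Rmin_r.
  assert (dp : (0 < d)%R) by (apply Rmin_glb_lt; [lra|apply Rdiv_lt_0_compat; lra]).
  apply Rle_div_r in d2; [|lra].
  set (w := z + RtoC d).
  assert (Ew : w - z = RtoC d) by (unfold w; ring).
  assert (Cw : Cmod (w - z) = d) by (rewrite Ew; apply Cmod_RtoC_pos; lra).
  assert (Pe : (0 < d * eps / 8)%R) by nra.
  destruct (Hcv w ltac:(rewrite Cw; lra) _ Pe) as [N1 K1].
  destruct (Hz _ Pe) as [N2 K2].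
  exists (N1 + N2)%nat; intros n m Hn Hm.
  assert (log_power_integral := K1 n ltac:(lia)). assert (A2 := K1 m ltac:(lia)).
  assert (A3 := K2 n ltac:(lia)). assert (A4 := K2 m ltac:(lia)).
  assert (A5 := Hl n w ltac:(rewrite Cw; lra)). assert (A6 := Hl m w ltac:(rewrite Cw; lra)).
  rewrite Cw in A5, A6; rewrite Ew in A5, A6.
  set (a1 := u n w - F w) in *. set (a2 := u m w - F w) in *.
  set (a3 := u n z - F z) in *. set (a4 := u m z - F z) in *.
  set (a5 := u n w - u n z - l n * RtoC d) in *. set (a6 := u m w - u m z - l m * RtoC d) in *.
  assert (E : (l n - l m) * RtoC d = ((a1 - a2) - (a3 - a4)) - (a5 - a6)).
  { unfold a1, a2, a3, a4, a5, a6; ring. }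
  apply (f_equal Cmod) in E; rewrite Cmod_mult, (Cmod_RtoC_pos d) in E by lra.
  assert (T1 := Cmod_triangle_minus ((a1 - a2) - (a3 - a4)) (a5 - a6)).
  assert (T2 := Cmod_triangle_minus (a1 - a2) (a3 - a4)).
  assert (T3 := Cmod_triangle_minus a1 a2). assert (T4 := Cmod_triangle_minus a3 a4).
  assert (T5 := Cmod_triangle_minus a5 a6).
  assert (B : (Cmod (l n - l m) * d < eps * d)%R).
  { simpl in A5, A6. nra. }
  apply Rmult_lt_reg_r in B; assumption. }
destruct Hlc as [L HL].
assert (HF : forall w, (Cmod (w - z) < r)%R ->
   (Cmod (F w - F z - L * (w - z)) <= K * Cmod (w - z) ^ 2)%R).
{ intros w Hw.
  replace (F w - F z - L * (w - z)) with (F w - (F z + L * (w - z))) by ring.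
  apply (C_converges_bound (fun n => u n w)); [apply Hcv, Hw|]; intros eps He.
  assert (Q := Cmod_ge_0 (w - z)).
  assert (Pe : (0 < eps / (2 * (Cmod (w - z) + 1)))%R) by (apply Rdiv_lt_0_compat; lra).
  destruct (Hz (eps / 2)%R ltac:(lra)) as [N1 K1]. destruct (HL _ Pe) as [N2 K2].
  exists (N1 + N2)%nat; intros n Hn.
  specialize (K1 n ltac:(lia)). specialize (K2 n ltac:(lia)). specialize (Hl n w Hw).
  replace (u n w - (F z + L * (w - z))) with
    ((u n w - u n z - l n * (w - z)) + ((u n z - F z) + (l n - L) * (w - z))) by ring.
  assert (T1 := Cmod_triangle (u n w - u n z - l n * (w - z)) ((u n z - F z) + (l n - L) * (w - z))).
  assert (T2 := Cmod_triangle (u n z - F z) ((l n - L) * (w - z))).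
  rewrite Cmod_mult in T2.
  apply Rlt_div_r in K2; [|lra].
  assert (Q2 := Cmod_ge_0 (l n - L)).
  nra. }
apply (holo_of_limit_quot _ _ L); intros eps He.
exists (Rmin r (eps / K)); split; [apply Rmin_glb_lt; [exact Hr|apply Rdiv_lt_0_compat; lra]|].
intros w Hw.
assert (H1 := Rlt_le_trans _ _ _ Hw (Rmin_l _ _)).
assert (H2 := Rlt_le_trans _ _ _ Hw (Rmin_r _ _)).
apply Rlt_div_r in H2; [|exact HK].
eapply Rle_trans; [apply HF, H1|]. assert (Q := Cmod_ge_0 (w - z)). simpl; nra.
Qed.

Lemma is_RInt_Rpower a b e : (0 < a <= b)%R -> (0 < e)%R ->
  is_RInt (fun u => Rpower u (- e - 1)) a b ((Rpower a (- e) - Rpower b (- e)) / e)%R.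
Proof.
intros Hab He.
assert (D : forall u, (0 < u)%R -> is_derive (fun u => - (Rpower u (- e)) / e)%R u (Rpower u (- e - 1))).
{ intros u Hu; unfold Rpower; auto_derive; [exact Hu|].
  replace ((- e - 1) * ln u)%R with (- e * ln u + - ln u)%R by ring.
  rewrite exp_plus, exp_Ropp, exp_ln by exact Hu; field; lra. }
eapply is_RInt_eq.
- apply (is_RInt_derive (V := R_CompleteNormedModule) (fun u => - (Rpower u (- e)) / e)%R);
  intros u Hu; rewrite Rmin_left in Hu by lra.
  + apply D; lra.
  + apply (ex_derive_continuous (K := R_AbsRing) (V := R_NormedModule)).
    unfold Rpower; auto_derive; lra.
- unfold minus, plus, opp; simpl; field; lra.
Qed.

Lemma Rpower_small e eps : (0 < e)%R -> (0 < eps)%R ->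
  exists A, (1 <= A)%R /\ forall y, (A <= y)%R -> (Rpower y (- e) < eps)%R.
Proof.
intros He Heps; exists (Rmax 1 (exp ((1 - ln eps) / e))); split; [apply Rmax_l|].
intros y Hy.
assert (H1 := Rle_trans _ _ _ (Rmax_l _ _) Hy). assert (H2 := Rle_trans _ _ _ (Rmax_r _ _) Hy).
unfold Rpower; rewrite <- (exp_ln eps) by exact Heps; apply exp_increasing.
assert (H3 : ((1 - ln eps) / e <= ln y)%R).
{ rewrite <- (ln_exp ((1 - ln eps) / e)); apply ln_le; [apply exp_pos|exact H2]. }
apply Rle_div_l in H3; [|exact He]. lra.
Qed.

Lemma Rpower_pos x y : (0 < Rpower x y)%R.
Proof. apply exp_pos. Qed.

(** Partial sum of the Dirichlet series, corrected by the integral of its tail;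
    it converges for Re s > 0. *)
Definition zeta_partial (s : C) (t : R) : C :=
  csum (fun k => cpow (INR k) (- s)) (nat_floor t) + cpow t (1 - s) / (s - 1).

Definition frac (u : R) : R := (u - INR (nat_floor u))%R.

Lemma frac_bounds u : (0 <= u)%R -> (0 <= frac u < 1)%R.
Proof. intros Hu; unfold frac; destruct (nat_floor_bounds u Hu); lra. Qed.

Lemma csum_one n : csum (fun _ => RtoC 1) n = RtoC (INR n).
Proof.
induction n as [|n IH]; [now rewrite csum_0|].
rewrite csum_S, IH, S_INR, RtoC_plus; reflexivity.
Qed.

(** Abel summation for u^-s with weights 1.  Subtracting the constant {t} from
    {u}, instead of leaving {u} alone, is what removes the boundary term at t and
    leads to the constant |s|/sigma. *)
Lemma zeta_partial_increment s t y : (1 <= t <= y)%R -> s <> RtoC 0 -> s <> RtoC 1 ->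
  is_CInt (fun u => RtoC (frac u - frac t) * (- s * cpow u (- s - 1))) t y
    (zeta_partial s y - zeta_partial s t + RtoC (frac y - frac t) * cpow y (- s)).
Proof.
intros Hty Hs0 Hs1.
assert (Ns : - s <> 0).
{ intros E; apply Hs0; replace s with (- - s) by ring; rewrite E; ring. }
assert (Ns1 : 1 - s <> 0).
{ intros E; apply Hs1; symmetry; apply Ceq_minus, E. }
assert (Ns2 : s - 1 <> 0) by (intros E; apply Hs1, Ceq_minus, E).
assert (Hf : forall u v, (0 < u)%R -> (0 < v)%R ->
   is_CInt (fun x => - s * cpow x (- s - 1)) u v (cpow v (- s) - cpow u (- s))).
{ intros u v Hu Hv; eapply is_CInt_eq; [apply is_CInt_cmul, is_CInt_cpow; assumption|].
  field; exact Hs0. }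
assert (log_power_integral := abel_summation (fun _ => RtoC 1) _ _ t y ltac:(lra) Hf).
assert (A2 := is_CInt_cmul (- s) _ _ _ _ (is_CInt_cpow (1 - s) t y ltac:(lra) ltac:(lra) Ns1)).
assert (A3 := is_CInt_cmul (RtoC (- frac t)) _ _ _ _ (Hf t y ltac:(lra) ltac:(lra))).
assert (A4 := is_CInt_plus _ _ _ _ _ _ (is_CInt_minus _ _ _ _ _ _ A2 log_power_integral) A3).
eapply is_RInt_ext; [|eapply is_CInt_eq; [exact A4|]].
- intros u Hu; rewrite Rmin_left, Rmax_right in Hu by lra; cbv beta.
  rewrite csum_one; replace (1 - s - 1) with (1 + (- s - 1)) by ring.
  rewrite cpow_add, cpow_1_r by lra.
  replace (frac u - frac t)%R with (u - INR (nat_floor u) + - frac t)%R by (unfold frac; ring).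
  rewrite RtoC_plus, RtoC_minus; Cchange; ring.
- rewrite !csum_one; unfold zeta_partial.
  replace (frac y - frac t)%R with (y - INR (nat_floor y) - (t - INR (nat_floor t)))%R by reflexivity.
  replace (- frac t)%R with (INR (nat_floor t) - t)%R by (unfold frac; ring).
  replace (1 - s) with (1 + - s) by ring.
  rewrite !cpow_add, !cpow_1_r by lra.
  rewrite !RtoC_minus.
  rewrite (csum_ext (fun k => 1 * cpow (INR k) (- s)) (fun k => cpow (INR k) (- s)) (nat_floor y)) by (intros; ring).
  rewrite (csum_ext (fun k => 1 * cpow (INR k) (- s)) (fun k => cpow (INR k) (- s)) (nat_floor t)) by (intros; ring).
  field; split; [exact Ns2|].
  intros E; apply Ns1; rewrite <- E; ring.
Qed.

Lemma Cmod_zeta_partial_increment s t y : (1 <= t <= y)%R -> (0 < Re s)%R -> s <> RtoC 1 ->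
  (Cmod (zeta_partial s y - zeta_partial s t)
   <= Cmod s / Re s * Rpower t (- Re s) + Rpower y (- Re s))%R.
Proof.
intros Hty Hs Hs1.
assert (Hs0 : s <> RtoC 0) by (intros ->; simpl in Hs; lra).
assert (I1 := zeta_partial_increment s t y Hty Hs0 Hs1).
assert (I2 := is_RInt_scal (V := R_NormedModule) _ _ _ (Cmod s) _ (is_RInt_Rpower t y (Re s) ltac:(lra) Hs)).
assert (Fr : forall u, (t <= u)%R -> (Rabs (frac u - frac t) <= 1)%R).
{ intros u Hu; apply Rabs_le_between.
  assert (F1 := frac_bounds u ltac:(lra)). assert (F2 := frac_bounds t ltac:(lra)). lra. }
assert (Hle : forall u, (t < u < y)%R -> (Cmod (RtoC (frac u - frac t) * (- s * cpow u (- s - 1)))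
   <= Cmod s * Rpower u (- Re s - 1))%R).
{ intros u Hu; rewrite !Cmod_mult, Cmod_opp, Cmod_R, Cmod_cpow.
  replace (Re (- s - 1)) with (- Re s - 1)%R by (unfold Re; simpl; ring).
  apply Rle_trans with (1 * (Cmod s * Rpower u (- Re s - 1)))%R; [|lra].
  apply Rmult_le_compat_r.
  - apply Rmult_le_pos; [apply Cmod_ge_0|apply Rlt_le, Rpower_pos].
  - apply Fr; lra. }
assert (B := Cmod_CInt_le _ _ t y _ _ ltac:(lra) Hle I1 I2).
unfold scal in B; simpl in B; unfold mult in B; simpl in B.
set (X := zeta_partial s y - zeta_partial s t) in *.
set (Y := RtoC (frac y - frac t) * cpow y (- s)) in *.
assert (T := Cmod_triangle_minus (X + Y) Y).
replace (X + Y - Y) with X in T by ring.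
assert (BY : (Cmod Y <= Rpower y (- Re s))%R).
{ unfold Y; rewrite Cmod_mult, Cmod_R, Cmod_cpow.
  replace (Re (- s)) with (- Re s)%R by reflexivity.
  rewrite <- (Rmult_1_l (Rpower _ _)) at 2; apply Rmult_le_compat_r;
   [apply Rlt_le, Rpower_pos|apply Fr; lra]. }
assert (BX : (Cmod s * ((Rpower t (- Re s) - Rpower y (- Re s)) / Re s)
   <= Cmod s / Re s * Rpower t (- Re s))%R).
{ unfold Rdiv; rewrite (Rmult_comm (_ - _)), <- Rmult_assoc.
  apply Rmult_le_compat_l.
  - apply Rmult_le_pos; [apply Cmod_ge_0|apply Rlt_le, Rinv_0_lt_compat, Hs].
  - assert (P := Rpower_pos y (- Re s)); lra. }
lra.
Qed.

End TruncatedZeta.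

(** * The zeta function on the right half-plane *)

Section ZetaHalfPlane.
Local Open Scope C_scope.

Lemma ex_CInt_frac_mult (g : R -> C) y : (1 <= y)%R ->
  (forall u, (0 < u)%R -> continuous (U := C_UniformSpace) g u) ->
  exists l, is_CInt (fun u => RtoC (frac u) * g u) 1 y l.
Proof.
intros Hy Hg.
assert (H1 := CInt_correct (fun u => RtoC u * g u) 1 y Hy
  ltac:(intros u Hu; apply continuous_Cmult; [apply continuous_RtoC, continuous_id|apply Hg; lra])).
assert (H2 := is_CInt_sum_le_t (fun _ u => g u) (fun k => CInt g (Rmax 1 (INR k)) y) 1 y ltac:(lra)
  ltac:(intros k Hk1 Hk2; apply CInt_correct;
    [apply Rmax_lub; assumption|intros u Hu; apply Hg; generalize (Rmax_l 1 (INR k)); lra])).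
eexists; eapply is_RInt_ext; [|exact (is_CInt_minus _ _ _ _ _ _ H1 H2)].
intros u _; cbv beta.
rewrite (csum_ext (fun _ => g u) (fun _ => g u * 1) (nat_floor u)) by (intros; ring).
rewrite csum_cmul, csum_one; unfold frac; rewrite RtoC_minus; Cchange; ring.
Qed.

(** From e ln u <= exp (e ln u), squared. *)
Lemma ln_sq_le_Rpower u e : (1 <= u)%R -> (0 < e)%R -> (ln u ^ 2 <= / e ^ 2 * Rpower u (2 * e))%R.
Proof.
intros Hu He.
assert (L0 : (0 <= ln u)%R) by (rewrite <- ln_1; apply ln_le; lra).
assert (H : (e * ln u <= exp (e * ln u))%R) by (generalize (exp_ineq1_le (e * ln u)); lra).
replace (Rpower u (2 * e)) with (exp (e * ln u) ^ 2)%R.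
- assert (P : (0 <= e * ln u)%R) by nra.
  assert (K : ((e * ln u) ^ 2 <= exp (e * ln u) ^ 2)%R) by (apply pow_incr; lra).
  apply Rmult_le_reg_l with (e ^ 2)%R; [nra|].
  rewrite <- Rmult_assoc, Rinv_r, Rmult_1_l by nra.
  rewrite <- Rpow_mult_distr; exact K.
- unfold Rpower; simpl; rewrite Rmult_1_r, <- exp_plus; f_equal; ring.
Qed.

Definition frac_int (s : C) (y : R) : C := CInt (fun u => RtoC (frac u) * cpow u (- s - 1)) 1 y.

Lemma frac_int_correct s y : (1 <= y)%R ->
  is_CInt (fun u => RtoC (frac u) * cpow u (- s - 1)) 1 y (frac_int s y).
Proof.
intros Hy; destruct (ex_CInt_frac_mult (fun u => cpow u (- s - 1)) y Hy) as [l Hl].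
- intros u Hu; apply continuous_cpow, Hu.
- unfold frac_int; now rewrite (CInt_unique _ _ _ _ Hl).
Qed.

Lemma frac_1 : frac 1 = 0%R.
Proof. unfold frac; rewrite (nat_floor_unique 1 1); simpl; lra. Qed.

Lemma frac_INR n : frac (INR n) = 0%R.
Proof. unfold frac; rewrite nat_floor_INR; ring. Qed.

Lemma zeta_partial_frac_int s n : (1 <= n)%nat -> s <> RtoC 0 -> s <> RtoC 1 ->
  zeta_partial s (INR n) = 1 + 1 / (s - 1) - s * frac_int s (INR n).
Proof.
intros Hn Hs0 Hs1.
assert (Ns2 : s - 1 <> 0) by (intros E; apply Hs1, Ceq_minus, E).
assert (Pn : (1 <= INR n)%R) by (apply (le_INR 1); exact Hn).
assert (I1 := zeta_partial_increment s 1 (INR n) ltac:(lra) Hs0 Hs1).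
assert (I2 := is_CInt_cmul (- s) _ _ _ _ (frac_int_correct s (INR n) Pn)).
rewrite frac_1, frac_INR in I1.
assert (E : zeta_partial s (INR n) - zeta_partial s 1 + RtoC (0 - 0) * cpow (INR n) (- s)
   = - s * frac_int s (INR n)).
{ eapply is_CInt_unique; [exact I1|].
  eapply is_RInt_ext; [|exact I2]; intros u _; cbv beta.
  rewrite Rminus_0_r; Cchange; ring. }
assert (E1 : zeta_partial s 1 = 1 + 1 / (s - 1)).
{ unfold zeta_partial; rewrite (nat_floor_unique 1 1) by (simpl; lra).
  rewrite csum_S, csum_0; change (INR 1) with 1%R; rewrite !cpow_1_l; field; exact Ns2. }
rewrite Rminus_0_r in E; rewrite E1 in E.
replace (zeta_partial s (INR n)) with
  (zeta_partial s (INR n) - (1 + 1 / (s - 1)) + RtoC 0 * cpow (INR n) (- s) + (1 + 1 / (s - 1))) by ring.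
rewrite E; ring.
Qed.

(** The derivative in s is taken under the integral sign.  The remainder is at
    most |h|^2 ln^2 u u^(|h| - sigma - 1), and |h| < sigma/2 together with
    ln^2 u <= (64/sigma^2) u^(sigma/4) leaves the integrable power
    u^(-sigma/4 - 1). *)
Lemma frac_int_quadratic (s : C) y : (1 <= y)%R -> (0 < Re s)%R ->
  exists l, forall w, (Cmod (w - s) < Re s / 2)%R ->
  (Cmod (frac_int w y - frac_int s y - l * (w - s)) <= 256 / Re s ^ 3 * Cmod (w - s) ^ 2)%R.
Proof.
intros Hy Hs; set (sg := Re s) in *.
destruct (ex_CInt_frac_mult (fun u => - RtoC (ln u) * cpow u (- s - 1)) y Hy) as [l Hl].
{ intros u Hu; apply continuous_Cmult; [|apply continuous_cpow, Hu].
  apply continuous_Copp, continuous_RtoC.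
  apply (ex_derive_continuous (K := R_AbsRing) (V := R_NormedModule)).
  eexists; apply is_derive_ln, Hu. }
exists l; intros w Hw; set (h := w - s) in *.
assert (I1 := is_CInt_minus _ _ _ _ _ _
  (is_CInt_minus _ _ _ _ _ _ (frac_int_correct w y Hy) (frac_int_correct s y Hy))
  (is_CInt_cmul h _ _ _ _ Hl)).
assert (Ps4 : (0 < sg / 4)%R) by lra.
assert (I2 := is_RInt_scal (V := R_NormedModule) _ _ _ (Cmod h ^ 2 * (64 / sg ^ 2))%R _
  (is_RInt_Rpower 1 y (sg / 4) ltac:(lra) Ps4)).
assert (Hle : forall u, (1 < u < y)%R ->
  (Cmod (RtoC (frac u) * cpow u (- w - 1) - RtoC (frac u) * cpow u (- s - 1)
     - h * (RtoC (frac u) * (- RtoC (ln u) * cpow u (- s - 1))))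
   <= Cmod h ^ 2 * (64 / sg ^ 2) * Rpower u (- (sg / 4) - 1))%R).
{ intros u Hu.
  assert (L0 : (0 <= ln u)%R) by (rewrite <- ln_1; apply ln_le; lra).
  replace (- w - 1) with (- s - 1 + - h) by (unfold h; ring).
  rewrite cpow_add.
  replace (_ - _ - _) with (RtoC (frac u) * (cpow u (- s - 1) * (cpow u (- h) - 1 - - h * RtoC (ln u)))) by ring.
  rewrite !Cmod_mult, (Cmod_cpow u (- s - 1)).
  replace (Re (- s - 1)) with (- sg - 1)%R by (unfold sg, Re; simpl; ring).
  assert (B1 : (Cmod (cpow u (- h) - 1 - - h * RtoC (ln u)) <=
     Cmod h ^ 2 * (64 / sg ^ 2) * Rpower u (3 * sg / 4))%R).
  { rewrite cpow_cexp; eapply Rle_trans; [apply Cmod_cexp_taylor|].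
    rewrite Cmod_mult, Cmod_opp, Cmod_RtoC_pos, Rpow_mult_distr by exact L0.
    rewrite !Rmult_assoc; apply Rmult_le_compat_l; [apply pow2_ge_0|].
    assert (E1 := ln_sq_le_Rpower u (sg / 8) ltac:(lra) ltac:(lra)).
    assert (E2 : (exp (Cmod h * ln u) <= Rpower u (sg / 2))%R).
    { apply exp_le; apply Rmult_le_compat_r; [exact L0|lra]. }
    apply Rle_trans with (/ (sg / 8) ^ 2 * Rpower u (2 * (sg / 8)) * Rpower u (sg / 2))%R.
    - apply Rmult_le_compat; [apply pow2_ge_0|apply Rlt_le, exp_pos|exact E1|exact E2].
    - right; rewrite Rmult_assoc, <- Rpower_plus; f_equal; [field; lra|f_equal; field]. }
  apply Rle_trans with (1 * (Rpower u (- sg - 1) * (Cmod h ^ 2 * (64 / sg ^ 2) * Rpower u (3 * sg / 4))))%R.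
  - assert (F := frac_bounds u ltac:(lra)).
    apply Rmult_le_compat; [apply Cmod_ge_0|apply Rmult_le_pos; [apply Rlt_le, Rpower_pos|apply Cmod_ge_0]| |].
    + rewrite Cmod_RtoC_pos; lra.
    + apply Rmult_le_compat_l; [apply Rlt_le, Rpower_pos|exact B1].
  - right; replace (- (sg / 4) - 1)%R with ((- sg - 1) + 3 * sg / 4)%R by field.
    rewrite Rpower_plus; ring. }
rewrite (Cmult_comm l); eapply Rle_trans; [exact (Cmod_CInt_le _ _ 1 y _ _ Hy Hle I1 I2)|].
unfold scal; simpl; unfold mult; simpl.
assert (R1 : Rpower 1 (- (sg / 4)) = 1%R) by (unfold Rpower; rewrite ln_1, Rmult_0_r; apply exp_0).
rewrite R1.
assert (P := Rpower_pos y (- (sg / 4))).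
replace (256 / (sg * (sg * (sg * 1))) * (Cmod h * (Cmod h * 1)))%R
 with (Cmod h * (Cmod h * 1) * (64 / (sg * (sg * 1))) * (1 / (sg / 4)))%R by (field; lra).
apply Rmult_le_compat_l.
- apply Rmult_le_pos; [generalize (Cmod_ge_0 h); nra|apply Rdiv_le_0_compat; nra].
- unfold Rdiv at 1 3; apply Rmult_le_compat_r; [apply Rlt_le, Rinv_0_lt_compat, Ps4|lra].
Qed.

Lemma zeta_partial_cauchy s : (0 < Re s)%R -> s <> RtoC 1 ->
  exists l, C_converges (fun n => zeta_partial s (INR n)) l.
Proof.
intros Hs Hs1; apply C_converges_cauchy; intros eps He.
assert (P : (0 <= Cmod s / Re s)%R) by (apply Rdiv_le_0_compat; [apply Cmod_ge_0|exact Hs]).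
destruct (Rpower_small (Re s) (eps / (2 * (Cmod s / Re s + 1))) Hs) as [A [HA1 HA]].
{ apply Rdiv_lt_0_compat; lra. }
destruct (INR_unbounded A) as [N HN]; exists N.
assert (W : forall n m, (N <= n)%nat -> (n <= m)%nat ->
  (Cmod (zeta_partial s (INR m) - zeta_partial s (INR n)) < eps)%R).
{ intros n m Hn Hm; apply le_INR in Hn; apply le_INR in Hm.
  eapply Rle_lt_trans; [apply Cmod_zeta_partial_increment; try assumption; lra|].
  assert (B1 := HA (INR n) ltac:(lra)). assert (B2 := HA (INR m) ltac:(lra)).
  assert (Q1 := Rpower_pos (INR n) (- Re s)).
  apply Rlt_div_r in B1; [|lra]. apply Rlt_div_r in B2; [|lra].
  assert (Q2 := Rpower_pos (INR m) (- Re s)). nra. }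
intros n m Hn Hm; destruct (Nat.le_ge_cases n m).
- rewrite Cmod_minus_sym; now apply W.
- now apply W.
Qed.

(** Choice makes the limit a total function of s; the value is the limit for
    Re s > 0 and s <> 1. *)
Definition zeta_ext (s : C) : C := epsilon (inhabits (RtoC 0)) (C_converges (fun n => zeta_partial s (INR n))).

Lemma zeta_ext_correct s : (0 < Re s)%R -> s <> RtoC 1 ->
  C_converges (fun n => zeta_partial s (INR n)) (zeta_ext s).
Proof.
intros Hs Hs1; exact (epsilon_spec (inhabits (RtoC 0)) _ (zeta_partial_cauchy s Hs Hs1)).
Qed.

(** Up to elementary factors the limit is the integral of {u} u^(-s-1), to which
    the uniform quadratic bound applies. *)
Lemma holo_zeta_ext s : (0 < Re s)%R -> s <> RtoC 1 -> holomorphic_at zeta_ext s.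
Proof.
intros Hs Hs1.
assert (Ps1 : (0 < Cmod (s - 1))%R) by (apply Cmod_gt_0; intros E; apply Hs1, Ceq_minus, E).
set (r := Rmin (Re s / 2) (Cmod (s - 1))).
assert (Hr : (0 < r)%R) by (apply Rmin_glb_lt; lra).
assert (r1 : (r <= Re s / 2)%R) by apply Rmin_l.
assert (r2 : (r <= Cmod (s - 1))%R) by apply Rmin_r.
assert (Hnear : forall w, (Cmod (w - s) < r)%R -> (0 < Re w)%R /\ w <> RtoC 0 /\ w <> RtoC 1).
{ intros w Hw; assert (F := fst_le_Cmod (w - s)); unfold Re in *; simpl in F.
  assert (F' : (Rabs (fst w + - fst s) <= fst s / 2)%R) by lra.
  apply Rabs_le_between in F'; split; [lra|split].
  - intros ->; simpl in F'; lra.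
  - intros ->; rewrite Cmod_minus_sym in Hw; lra. }
pose (G := fun w => (1 + 1 / (w - 1) - zeta_ext w) / w).
assert (HG : holomorphic_at G s).
{ apply (holo_limit (fun n w => frac_int w (INR (S n))) G s r (256 / Re s ^ 3) Hr).
  - apply Rdiv_lt_0_compat; [lra|apply pow_lt, Hs].
  - intros w Hw; destruct (Hnear w Hw) as [W1 [W2 W3]].
    assert (Pw : (0 < Cmod w)%R) by (apply Cmod_gt_0, W2).
    assert (Z := zeta_ext_correct w W1 W3).
    intros eps He; destruct (Z (eps * Cmod w)%R ltac:(nra)) as [N HN]; exists N; intros n Hn.
    specialize (HN (S n) ltac:(lia)).
    rewrite zeta_partial_frac_int in HN by (assumption || lia).
    unfold G; replace (frac_int w (INR (S n)) - _) with
      (- ((1 + 1 / (w - 1) - w * frac_int w (INR (S n)) - zeta_ext w) / w)).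
    + rewrite Cmod_opp, Cmod_div by exact W2.
      apply Rlt_div_l; assumption.
    + field; split; [|exact W2]; intros E; apply W3, Ceq_minus, E.
  - intros n; destruct (frac_int_quadratic s (INR (S n))) as [l Hl]; [|exact Hs|].
    + rewrite S_INR; generalize (pos_INR n); lra.
    + exists l; intros w Hw; apply Hl; lra. }
apply (holo_ext_loc (fun w => 1 + 1 / (w - 1) - w * G w)).
- generalize (proj1 (continuous_C_iff (T := C_UniformSpace) (fun w => w) s) (continuous_id s) _ Hr).
  apply filter_imp; intros w Hw; destruct (Hnear w Hw) as [W1 [W2 W3]].
  unfold G; field; split; [|exact W2]; intros E; apply W3, Ceq_minus, E.
- apply holo_minus; [apply holo_plus; [apply holo_const|]|apply holo_mult; [apply holo_id|exact HG]].
  apply holo_div; [apply holo_const|apply holo_minus; [apply holo_id|apply holo_const]|].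
  intros E; apply Hs1, Ceq_minus, E.
Qed.

(** For Re s > 1 the correcting term N^(1-s)/(s-1) tends to 0. *)
Lemma zeta_series_partial zeta s : is_riemann_zeta zeta -> (1 < Re s)%R ->
  C_converges (fun n => zeta_partial s (INR n)) (zeta s).
Proof.
intros [Hz _] Hs; specialize (Hz s Hs).
assert (Hs1 : s <> RtoC 1) by (intros ->; simpl in Hs; lra).
assert (Ps1 : (0 < Cmod (s - 1))%R) by (apply Cmod_gt_0; intros E; apply Hs1, Ceq_minus, E).
intros eps He.
assert (L : locally (T := C_UniformSpace) (zeta s) (fun y => (Cmod (y - zeta s) < eps / 2)%R)).
{ apply (proj1 (continuous_C_iff (T := C_UniformSpace) (fun w => w) _) (continuous_id _)); lra. }
destruct (Hz _ L) as [N1 H1].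
destruct (Rpower_small (Re s - 1) (eps / 2 * Cmod (s - 1)) ltac:(lra) ltac:(nra)) as [A [HA1 HA]].
destruct (INR_unbounded A) as [N2 HN2].
exists (S (N1 + N2)); intros n Hn.
destruct n as [|n]; [lia|].
specialize (H1 n ltac:(lia)).
replace (sum_n _ n) with (csum (fun k => cpow (INR k) (- s)) (S n)) in H1.
2:{ symmetry; exact (sum_n_m_S (G := C_AbelianMonoid) (fun k => cpow (INR k) (- s)) 0 n). }
unfold zeta_partial; rewrite nat_floor_INR.
replace (_ + _ - _) with ((csum (fun k => cpow (INR k) (- s)) (S n) - zeta s) + cpow (INR (S n)) (1 - s) / (s - 1)) by ring.
eapply Rle_lt_trans; [apply Cmod_triangle|].
rewrite Cmod_div, Cmod_cpow by (apply Cmod_gt_0, Ps1).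
replace (Re (1 - s)) with (- (Re s - 1))%R by (unfold Re; simpl; ring).
assert (Hn2 : (A <= INR (S n))%R).
{ apply Rle_trans with (INR N2); [lra|apply le_INR; lia]. }
specialize (HA _ Hn2). apply Rlt_div_l in HA; [|exact Ps1]. lra.
Qed.

Theorem zeta_eq_zeta_ext zeta s : is_riemann_zeta zeta -> (0 < Re s)%R -> s <> RtoC 1 ->
  zeta s = zeta_ext s.
Proof.
intros Hz Hs Hs1; apply Ceq_minus.
apply (identity_half_plane (fun w => zeta w - zeta_ext w)); try assumption.
- intros z Hz0 Hz1; apply holo_minus; [|now apply holo_zeta_ext].
  apply holo_ex_derive, Hz, Hz1.
- intros z Hz0.
  assert (Hz1 : z <> RtoC 1) by (intros ->; simpl in Hz0; lra).
  cbv beta; apply (proj1 (Ceq_minus _ _)).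
  apply (C_converges_unique (fun n => zeta_partial z (INR n))).
  + apply zeta_series_partial; assumption.
  + apply zeta_ext_correct; [unfold Re; lra|exact Hz1].
Qed.

(** The boundary term at y disappears when y tends to infinity. *)
Theorem zeta_approximation zeta s t : is_riemann_zeta zeta -> (0 < Re s)%R -> s <> RtoC 1 ->
  (1 <= t)%R -> (Cmod (zeta s - zeta_partial s t) <= Cmod s / Re s * Rpower t (- Re s))%R.
Proof.
intros Hz Hs Hs1 Ht; rewrite (zeta_eq_zeta_ext zeta s Hz Hs Hs1).
apply (C_converges_bound _ _ _ _ (zeta_ext_correct s Hs Hs1)); intros eps He.
destruct (Rpower_small (Re s) eps Hs He) as [A [HA1 HA]].
destruct (INR_unbounded (Rmax A t)) as [N HN]; exists N; intros n Hn.
apply le_INR in Hn.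
assert (M1 := Rmax_l A t). assert (M2 := Rmax_r A t).
eapply Rle_trans; [apply Cmod_zeta_partial_increment; try assumption; lra|].
specialize (HA (INR n) ltac:(lra)); lra.
Qed.

End ZetaHalfPlane.

(** * The defect of the harmonic numbers and its integral *)

Section HarmonicDefect.
Local Open Scope C_scope.

Section RealEstimates.
Local Open Scope R_scope.

Lemma nonneg_from_derive (f df : R -> R) (y : R) : 0 <= y -> f 0 = 0 ->
  (forall u, 0 <= u -> is_derive f u (df u)) -> (forall u, 0 <= u -> 0 <= df u) -> 0 <= f y.
Proof.
intros Hy H0 Hd Hp.
destruct (MVT_gen f 0 y df) as [c [Hc E]].
- intros u Hu; rewrite Rmin_left in Hu by exact Hy; apply Hd; lra.
- intros u Hu; rewrite Rmin_left in Hu by exact Hy.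
  apply continuity_pt_filterlim, (ex_derive_continuous (K := R_AbsRing) (V := R_NormedModule)).
  exists (df u); apply Hd; lra.
- rewrite Rmin_left in Hc by exact Hy; rewrite H0 in E.
  assert (0 <= df c) by (apply Hp; lra). nra.
Qed.

(** The trapezoidal rule overestimates the integral of the convex function
    1/(1+y). *)
Lemma ln_upper y : 0 <= y -> ln (1 + y) <= (y + y / (1 + y)) / 2.
Proof.
intros Hy.
enough (0 <= (y + y / (1 + y)) / 2 - ln (1 + y)) by lra.
apply (nonneg_from_derive (fun y => (y + y / (1 + y)) / 2 - ln (1 + y))
  (fun u => (1 - / (1 + u)) ^ 2 / 2) y Hy).
- replace (1 + 0) with 1 by ring; rewrite ln_1; field.
- intros u Hu; auto_derive; [lra|field; lra].
- intros u Hu; generalize (pow2_ge_0 (1 - / (1 + u))); lra.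
Qed.

(** The next Euler-Maclaurin term.  The difference of the two sides has
    derivative y^4 / (6 (1+y)^3). *)
Lemma ln_lower y : 0 <= y ->
  (y + y / (1 + y)) / 2 - (y ^ 2 - (y / (1 + y)) ^ 2) / 12 <= ln (1 + y).
Proof.
intros Hy.
enough (0 <= ln (1 + y) - ((y + y / (1 + y)) / 2 - (y ^ 2 - (y / (1 + y)) ^ 2) / 12)) by lra.
apply (nonneg_from_derive (fun y => ln (1 + y) - ((y + y / (1 + y)) / 2 - (y ^ 2 - (y / (1 + y)) ^ 2) / 12))
  (fun u => u ^ 4 / (6 * (1 + u) ^ 3)) y Hy).
- replace (1 + 0) with 1 by ring; rewrite ln_1; field.
- intros u Hu; auto_derive; [lra|field; lra].
- intros u Hu; apply Rdiv_le_0_compat; [|assert (0 < (1 + u) ^ 3) by (apply pow_lt; lra); lra].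
  replace (u ^ 4) with ((u ^ 2) ^ 2) by ring; apply pow2_ge_0.
Qed.

Definition harmonic (n : nat) : R := rsum (fun k => / INR k) n.

Definition harmonic_minus_log (n : nat) : R := harmonic n - ln (INR n).

(** The two estimates of the logarithm at y = 1/n, where y/(1+y) = 1/(n+1): both
    bounds telescope. *)
Lemma harmonic_minus_log_step n : (1 <= n)%nat ->
  (/ INR n - / INR (S n)) / 2 - (/ INR n ^ 2 - / INR (S n) ^ 2) / 12 <= harmonic_minus_log n - harmonic_minus_log (S n)
   <= (/ INR n - / INR (S n)) / 2.
Proof.
intros Hn; assert (P : 1 <= INR n) by (apply (le_INR 1); exact Hn).
assert (Py : 0 <= / INR n) by (apply Rlt_le, Rinv_0_lt_compat; lra).
assert (E : harmonic_minus_log n - harmonic_minus_log (S n) = ln (1 + / INR n) - / INR (S n)).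
{ unfold harmonic_minus_log, harmonic; rewrite rsum_S.
  replace (1 + / INR n) with (INR (S n) / INR n) by (rewrite S_INR; field; lra).
  unfold Rdiv; rewrite ln_mult, ln_Rinv; [ring|lra|rewrite S_INR; lra|apply Rinv_0_lt_compat; lra]. }
assert (Ey : / INR n / (1 + / INR n) = / INR (S n)) by (rewrite S_INR; field; lra).
assert (U := ln_upper _ Py). assert (L := ln_lower _ Py). rewrite Ey in U, L.
rewrite !pow_inv in L. rewrite E. lra.
Qed.

(** By [harmonic_minus_log_step], subtracting 1/(2n) makes H(n) - log n increase to gamma, and
    adding back 1/(12 n^2) makes it decrease. *)
Lemma euler_gamma_bounds n : (1 <= n)%nat ->
  harmonic_minus_log n - / (2 * INR n) <= euler_gamma <= harmonic_minus_log n - / (2 * INR n) + / (12 * INR n ^ 2).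
Proof.
(* shifted by one: neither sequence makes sense at n = 0 *)
pose (a := fun n => harmonic_minus_log (S n) - / INR (S n) / 2).
pose (b := fun n => harmonic_minus_log (S n) - / INR (S n) / 2 + / INR (S n) ^ 2 / 12).
assert (Pn : forall n, 1 <= INR (S n)) by (intros k; apply (le_INR 1); lia).
assert (Ha : forall n, a n <= a (S n)).
{ intros k; unfold a; assert (G := harmonic_minus_log_step (S k) ltac:(lia)); lra. }
assert (Hb : forall n, b (S n) <= b n).
{ intros k; unfold b; assert (G := harmonic_minus_log_step (S k) ltac:(lia)); lra. }
assert (Hab : forall n, a n <= b n).
{ intros k; unfold a, b; specialize (Pn k).
  assert (0 < / INR (S k) ^ 2) by (apply Rinv_0_lt_compat, pow_lt; lra). lra. }
assert (Hb0 : forall n, b n <= b O).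
{ induction n0 as [|k IH]; [lra|specialize (Hb k); lra]. }
destruct (ex_finite_lim_seq_incr a (b O) Ha) as [l Hl].
{ intros k; eapply Rle_trans; [apply Hab|apply Hb0]. }
assert (Hinv : is_lim_seq (fun n => / INR (S n)) 0).
{ apply (is_lim_seq_incr_1 (fun n => / INR n)).
  replace (Finite 0) with (Rbar_inv p_infty) by reflexivity.
  apply is_lim_seq_inv; [apply is_lim_seq_INR|discriminate]. }
assert (Hg : is_lim_seq harmonic_minus_log l).
{ apply is_lim_seq_incr_1.
  apply (is_lim_seq_ext (fun n => a n + / INR (S n) * / 2)).
  - intros k; unfold a; field; specialize (Pn k); lra.
  - replace (Finite l) with (Finite (l + 0 * / 2)) by (f_equal; ring).
    apply is_lim_seq_plus'; [exact Hl|].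
    apply is_lim_seq_mult'; [exact Hinv|apply is_lim_seq_const]. }
assert (Hbl : is_lim_seq b l).
{ apply (is_lim_seq_ext (fun n => a n + / INR (S n) * / INR (S n) * / 12)).
  - intros k; unfold a, b; field; specialize (Pn k); lra.
  - replace (Finite l) with (Finite (l + 0 * 0 * / 12)) by (f_equal; ring).
    apply is_lim_seq_plus'; [exact Hl|].
    apply is_lim_seq_mult'; [|apply is_lim_seq_const].
    apply is_lim_seq_mult'; exact Hinv. }
assert (E : euler_gamma = l).
{ unfold euler_gamma; apply is_lim_seq_unique in Hg.
  change (real (Lim_seq harmonic_minus_log) = l); rewrite Hg; reflexivity. }
intros Hn; destruct n as [|n]; [lia|].
rewrite E.
assert (log_power_integral := is_lim_seq_incr_compare a l Hl Ha n).
assert (A2 := is_lim_seq_decr_compare b l Hbl Hb n).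
unfold a in log_power_integral; unfold b in A2; specialize (Pn n).
rewrite !Rinv_mult; lra.
Qed.

Definition log_defect (t : R) : R := ln t - sum_upto (fun j => / INR j) t + euler_gamma.

(** On [n, n+1) the defect increases from a value at least -1/(2n).  Just before
    n+1 it is at most 1/(2(n+1)) + 1/(12(n+1)^2), that is, at most
    (1/2 + 1/24)/(n+1) as n+1 >= 2. *)
Lemma log_defect_bound t : 1 <= t -> Rabs (log_defect t) <= 0.55 / t.
Proof.
intros Ht; unfold log_defect; rewrite sum_upto_rsum; fold (harmonic (nat_floor t)).
assert (Hn := nat_floor_ge_1 t Ht). destruct (nat_floor_bounds t) as [B1 B2]; [lra|].
set (n := nat_floor t) in *.
assert (P : 1 <= INR n) by (apply (le_INR 1); exact Hn).
assert (G1 := euler_gamma_bounds n Hn). assert (G2 := euler_gamma_bounds (S n) ltac:(lia)).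
assert (Hs : harmonic (S n) = harmonic n + / INR (S n)) by (unfold harmonic; apply rsum_S).
unfold harmonic_minus_log in G1, G2; rewrite Hs in G2; rewrite S_INR in G2.
set (k := INR n) in *.
assert (L1 : ln k + 1 - k / t <= ln t).
{ assert (X : ln t = ln k + - ln (k / t)).
  { unfold Rdiv; rewrite ln_mult, ln_Rinv; try lra. apply Rinv_0_lt_compat; lra. }
  assert (Y : ln (k / t) <= k / t - 1).
  { assert (0 < k / t) by (apply Rdiv_lt_0_compat; lra).
    assert (Z := exp_ineq1_le (ln (k / t))); rewrite exp_ln in Z by assumption; lra. }
  lra. }
assert (L2 : ln t <= ln (k + 1)) by (apply ln_le; lra).
assert (K1 : / (2 * k) = / k / 2) by (field; lra).
apply Rabs_le_between; split.
-
  assert (M : - (0.55 / t) <= 1 - k / t - / (2 * k)).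
  { apply Rmult_le_reg_r with (2 * k * t); [nra|].
    replace (- (0.55 / t) * (2 * k * t)) with (- (2 * 0.55 * k)) by (field; lra).
    replace ((1 - k / t - / (2 * k)) * (2 * k * t)) with (2 * k * t - 2 * k * k - t) by (field; lra).
    nra. }
  lra.
- assert (M : / (k + 1) - / (2 * (k + 1)) + / (12 * (k + 1) ^ 2) <= 0.55 / (k + 1)).
  { apply Rmult_le_reg_r with ((k + 1) ^ 2); [nra|].
    replace ((/ (k + 1) - / (2 * (k + 1)) + / (12 * (k + 1) ^ 2)) * (k + 1) ^ 2)
     with ((k + 1) / 2 + / 12) by (field; lra).
    replace (0.55 / (k + 1) * (k + 1) ^ 2) with (0.55 * (k + 1)) by (field; lra). lra. }
  assert (M2 : 0.55 / (k + 1) <= 0.55 / t).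
  { unfold Rdiv; apply Rmult_le_compat_l; [lra|apply Rinv_le_contravar; lra]. }
  lra.
Qed.
End RealEstimates.

(** A primitive of the defect times t^-s off the integers, continuous everywhere:
    at an integer the jumps of the two terms cancel. *)
Definition defect_primitive (s : C) (t : R) : C :=
  (cpow t (1 - s) * RtoC (log_defect t) + zeta_partial s t) / (1 - s).

(** The smooth part log t + gamma has an explicit primitive; the harmonic part is
    Abel summation with weights 1/k, which produces the partial sums of zeta. *)
Lemma is_CInt_defect s x y : (1 <= x <= y)%R -> s <> RtoC 1 ->
  is_CInt (fun t => RtoC (log_defect t) * cpow t (- s)) x y
    (defect_primitive s y - defect_primitive s x).
Proof.
intros Hxy Hs1.
assert (Ns1 : 1 - s <> 0).
{ intros E; apply Hs1; symmetry; apply Ceq_minus, E. }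
pose (f := fun t => cpow t (1 - s) / (1 - s)).
assert (Hder : forall t, (0 < t)%R -> is_curve_derive f t (cpow t (- s))).
{ intros t Ht; eapply curve_derive_eq; [apply curve_derive_mult; [apply (curve_derive_cpow (1 - s) t Ht)|apply curve_derive_const]|].
  replace (1 - s - 1) with (- s) by ring; field; exact Ns1. }
assert (Hpos : forall u v t, (0 < u)%R -> (0 < v)%R -> (Rmin u v <= t <= Rmax u v)%R -> (0 < t)%R).
{ intros u v t Hu Hv [Ht _]; eapply Rlt_le_trans; [|exact Ht]; apply Rmin_glb_lt; assumption. }
assert (Hf : forall u v, (0 < u)%R -> (0 < v)%R -> is_CInt (fun t => cpow t (- s)) u v (f v - f u)).
{ intros u v Hu Hv; apply is_CInt_derive; intros t Ht; apply (Hpos u v t Hu Hv) in Ht;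
  [apply Hder|apply continuous_cpow]; exact Ht. }
assert (log_power_integral := abel_summation (fun k => RtoC (/ INR k)) f _ x y ltac:(lra) Hf).
pose (K := fun t => f t * RtoC (ln t + euler_gamma) - / (1 - s) * f t).
assert (HK : forall t, (0 < t)%R -> is_curve_derive K t (RtoC (ln t + euler_gamma) * cpow t (- s))).
{ intros t Ht; eapply curve_derive_eq.
  - apply curve_derive_minus; [apply curve_derive_mult; [apply Hder, Ht|apply (curve_derive_RtoC (fun t => ln t + euler_gamma)%R t (/ t)%R)]|].
    + auto_derive; [exact Ht|field; lra].
    + apply curve_derive_mult; [apply curve_derive_const|apply Hder, Ht].
  - unfold f; replace (1 - s) with (- s + 1) at 1 by ring.
    rewrite cpow_add, cpow_1_r, RtoC_inv by lra.
    assert (RtoC t <> 0) by (intros E; apply RtoC_inj in E; lra).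
    field; split; assumption. }
assert (A2 : is_CInt (fun t => RtoC (ln t + euler_gamma) * cpow t (- s)) x y (K y - K x)).
{ apply is_CInt_derive; intros t Ht; apply (Hpos x y t) in Ht; try lra; [apply HK, Ht|].
  apply continuous_Cmult; [|apply continuous_cpow, Ht].
  apply continuous_RtoC, (ex_derive_continuous (K := R_AbsRing) (V := R_NormedModule)).
  auto_derive; exact Ht. }
eapply is_RInt_ext; [|eapply is_CInt_eq; [exact (is_CInt_minus _ _ _ _ _ _ A2 log_power_integral)|]].
- intros t _; cbv beta; rewrite <- csum_RtoC; unfold log_defect; rewrite sum_upto_rsum.
  replace (ln t - rsum (fun j => / INR j) (nat_floor t) + euler_gamma)%R
   with (ln t + euler_gamma - rsum (fun j => / INR j) (nat_floor t))%R by ring.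
  rewrite (RtoC_minus _ (rsum _ _)); Cchange; ring.
- assert (ES : forall t, csum (fun k => RtoC (/ INR k) * f (INR k)) (nat_floor t)
     = / (1 - s) * csum (fun k => cpow (INR k) (- s)) (nat_floor t)).
  { intros t; rewrite <- csum_cmul; apply csum_ext; intros k [Hk _]; unfold f.
    assert (Pk : (1 <= INR k)%R) by (apply (le_INR 1); exact Hk).
    replace (1 - s) with (- s + 1) at 1 by ring.
    rewrite cpow_add, cpow_1_r, RtoC_inv by lra.
    assert (RtoC (INR k) <> 0) by (intros E; apply RtoC_inj in E; lra).
    field; split; assumption. }
  rewrite !ES, <- !csum_RtoC; unfold defect_primitive, K, f, log_defect, zeta_partial.
  rewrite !sum_upto_rsum.
  rewrite !RtoC_plus, !RtoC_minus.
  assert (Ns2 : s - 1 <> 0) by (intros E; apply Hs1, Ceq_minus, E).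
  field; split; assumption.
Qed.

(** The defect is O(1/t), so its contribution t^(1-s) E(t) vanishes at infinity. *)
Lemma defect_primitive_limit zeta s : is_riemann_zeta zeta -> (0 < Re s)%R -> s <> RtoC 1 ->
  forall eps, (0 < eps)%R -> exists A, (1 <= A)%R /\ forall y, (A <= y)%R ->
    (Cmod (defect_primitive s y - zeta s / (1 - s)) < eps)%R.
Proof.
intros Hz Hs Hs1 eps He.
assert (Ns1 : 1 - s <> 0).
{ intros E; apply Hs1; symmetry; apply Ceq_minus, E. }
assert (P1 := proj1 (Cmod_gt_0 _) Ns1).
set (B := (Cmod s / Re s + 1)%R).
assert (HB : (0 < B)%R).
{ unfold B; assert (0 <= Cmod s / Re s)%R by (apply Rdiv_le_0_compat; [apply Cmod_ge_0|exact Hs]); lra. }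
destruct (Rpower_small (Re s) (eps * Cmod (1 - s) / B) Hs) as [A [HA1 HA]].
{ apply Rdiv_lt_0_compat; [nra|exact HB]. }
exists A; split; [exact HA1|]; intros y Hy.
specialize (HA y Hy); apply Rlt_div_r in HA; [|exact HB].
unfold defect_primitive.
replace (_ - _) with ((cpow y (1 - s) * RtoC (log_defect y) - (zeta s - zeta_partial s y)) / (1 - s))
  by (field; exact Ns1).
rewrite Cmod_div by exact Ns1.
apply Rlt_div_l; [exact P1|].
eapply Rle_lt_trans; [apply Cmod_triangle_minus|].
assert (Z := zeta_approximation zeta s y Hz Hs Hs1 ltac:(lra)).
rewrite Cmod_mult, Cmod_cpow, Cmod_R.
assert (D := log_defect_bound y ltac:(lra)).
assert (E : (Rpower y (Re (1 - s)) * Rabs (log_defect y) <= Rpower y (- Re s))%R).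
{ apply Rle_trans with (Rpower y (Re (1 - s)) * (0.55 / y))%R.
  - apply Rmult_le_compat_l; [apply Rlt_le, Rpower_pos|exact D].
  - replace (Re (1 - s)) with (- Re s + 1)%R by (unfold Re; simpl; ring).
    rewrite Rpower_plus, Rpower_1 by lra.
    replace (Rpower y (- Re s) * y * (0.55 / y))%R with (0.55 * Rpower y (- Re s))%R by (field; lra).
    assert (Q := Rpower_pos y (- Re s)); lra. }
unfold B in HA; lra.
Qed.

Lemma is_RInt_gen_defect zeta s x : is_riemann_zeta zeta -> (0 < Re s)%R -> s <> RtoC 1 -> (1 <= x)%R ->
  is_RInt_gen (V := C_R_NormedModule) (fun t => RtoC (log_defect t) * cpow t (- s))
    (at_point x) (Rbar_locally p_infty) (zeta s / (1 - s) - defect_primitive s x).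
Proof.
intros Hz Hs Hs1 Hx P [eps HP].
destruct (defect_primitive_limit zeta s Hz Hs Hs1 eps (cond_pos eps)) as [A [HA1 HA]].
apply (Filter_prod _ _ _ (fun a => a = x) (fun y => (Rmax A x < y)%R)); [reflexivity|now exists (Rmax A x)|].
intros a y -> Hy; simpl.
assert (M1 := Rmax_l A x). assert (M2 := Rmax_r A x).
exists (defect_primitive s y - defect_primitive s x); split.
- apply is_CInt_defect; [lra|exact Hs1].
- apply HP; specialize (HA y ltac:(lra)).
  split; unfold ball; simpl; unfold AbsRing_ball, abs, minus, plus, opp; simpl;
  (eapply Rle_lt_trans; [|exact HA]).
  + eapply Rle_trans; [|apply (fst_le_Cmod (defect_primitive s y - zeta s / (1 - s)))].
    right; f_equal; simpl; ring.
  + eapply Rle_trans; [|apply (snd_le_Cmod (defect_primitive s y - zeta s / (1 - s)))].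
    right; f_equal; simpl; ring.
Qed.

(** The bound 0.55/t on the defect, integrated against t^-sigma. *)
Lemma Cmod_defect_integral zeta s x : is_riemann_zeta zeta -> (0 < Re s)%R -> s <> RtoC 1 -> (1 <= x)%R ->
  (Cmod (zeta s / (1 - s) - defect_primitive s x) <= 0.55 / Re s * Rpower x (- Re s))%R.
Proof.
intros Hz Hs Hs1 Hx; apply le_epsilon; intros eps He.
destruct (defect_primitive_limit zeta s Hz Hs Hs1 eps He) as [A [HA1 HA]].
set (y := Rmax A x). assert (M1 := Rmax_l A x). assert (M2 := Rmax_r A x). fold y in M1, M2.
specialize (HA y M1).
assert (I1 := is_CInt_defect s x y ltac:(lra) Hs1).
assert (I2 := is_RInt_scal (V := R_NormedModule) _ _ _ 0.55%R _ (is_RInt_Rpower x y (Re s) ltac:(lra) Hs)).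
assert (Hle : forall t, (x < t < y)%R -> (Cmod (RtoC (log_defect t) * cpow t (- s)) <= 0.55 * Rpower t (- Re s - 1))%R).
{ intros t Ht; rewrite Cmod_mult, Cmod_R, Cmod_cpow.
  replace (Re (- s)) with (- Re s - 1 + 1)%R by (unfold Re; simpl; ring).
  rewrite Rpower_plus, Rpower_1 by lra.
  replace (0.55 * Rpower t (- Re s - 1))%R with (0.55 / t * (Rpower t (- Re s - 1) * t))%R by (field; lra).
  apply Rmult_le_compat_r; [|apply log_defect_bound; lra].
  apply Rmult_le_pos; [apply Rlt_le, Rpower_pos|lra]. }
assert (B := Cmod_CInt_le _ _ x y _ _ M2 Hle I1 I2).
unfold scal in B; simpl in B; unfold mult in B; simpl in B.
assert (T := Cmod_triangle_minus (defect_primitive s y - defect_primitive s x)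
   (defect_primitive s y - zeta s / (1 - s))).
replace (defect_primitive s y - defect_primitive s x - (defect_primitive s y - zeta s / (1 - s)))
 with (zeta s / (1 - s) - defect_primitive s x) in T by ring.
assert (BX : (0.55 * ((Rpower x (- Re s) - Rpower y (- Re s)) / Re s) <= 0.55 / Re s * Rpower x (- Re s))%R).
{ unfold Rdiv; rewrite (Rmult_comm (_ - _)), <- Rmult_assoc.
  apply Rmult_le_compat_l.
  - apply Rmult_le_pos; [lra|apply Rlt_le, Rinv_0_lt_compat, Hs].
  - assert (P := Rpower_pos y (- Re s)); lra. }
lra.
Qed.

End HarmonicDefect.

(** * Integrals of Moebius means against Q *)

Section KernelIntegrals.
Local Open Scope C_scope.

(** The last term of Q is the correction in [zeta_partial], because
    t = t^s t^(1-s). *)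
Lemma Q_factor zeta s t : (1 <= t)%R -> s <> RtoC 1 ->
  Q zeta s t = (s - 1) * cpow t s * (zeta s - zeta_partial s t).
Proof.
intros Ht Hs1.
assert (Ns2 : s - 1 <> 0) by (intros E; apply Hs1, Ceq_minus, E).
unfold Q, zeta_partial; rewrite sum_upto_csum.
assert (E : csum (fun k => cpow (t / INR k) s) (nat_floor t)
  = cpow t s * csum (fun k => cpow (INR k) (- s)) (nat_floor t)).
{ rewrite <- csum_cmul; apply csum_ext; intros k [Hk _].
  assert (Pk : (1 <= INR k)%R) by (apply (le_INR 1); exact Hk).
  rewrite cpow_div, cpow_opp by lra; reflexivity. }
rewrite E.
assert (E2 : RtoC t = cpow t s * cpow t (1 - s)).
{ rewrite <- cpow_add, <- cpow_1_r by lra; f_equal; ring. }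
rewrite E2; field; exact Ns2.
Qed.

Lemma Cmod_Q_le zeta s t : is_riemann_zeta zeta -> s <> RtoC 1 -> (0 < Re s)%R -> (1 <= t)%R ->
  (Cmod (Q zeta s t) <= Cmod s / Rabs (Re s) * Cmod (s - 1))%R.
Proof.
intros Hz Hs1 Hs Ht; rewrite Q_factor, !Cmod_mult, Cmod_cpow, (Rabs_pos_eq (Re s)) by (assumption || lra).
assert (Z := zeta_approximation zeta s t Hz Hs Hs1 Ht).
assert (E : (Rpower t (Re s) * Rpower t (- Re s) = 1)%R).
{ rewrite <- Rpower_plus, Rplus_opp_r; apply Rpower_O; lra. }
assert (P1 := Rpower_pos t (Re s)).
apply Rmult_le_compat_l with (r := Rpower t (Re s)) in Z; [|lra].
replace (Rpower t (Re s) * (Cmod s / Re s * Rpower t (- Re s)))%R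
  with (Cmod s / Re s * (Rpower t (Re s) * Rpower t (- Re s)))%R in Z by ring.
rewrite E, Rmult_1_r in Z.
rewrite (Rmult_comm _ (Cmod (s - 1))), Rmult_assoc.
apply Rmult_le_compat_l; [apply Cmod_ge_0|exact Z].
Qed.

Section Kernel.
Variables (zeta : C -> C) (s : C) (kappa : R -> R) (A B : R -> C).
Hypothesis Hs1 : s <> RtoC 1.
(** Homogeneity: the integral over [c, y] is c^(s-1) times a function of y/c, as
    the substitution t = c u shows.  This is what makes Moebius inversion apply. *)
Hypothesis HA : forall c y, (0 < c <= y)%R ->
  is_CInt (fun t => RtoC (kappa (y / t)) * cpow t (s - 2)) c y (cpow c (s - 1) * A (y / c)%R).
Hypothesis HB : forall y, (1 <= y)%R ->
  is_CInt (fun t => RtoC (kappa (y / t)) / RtoC t) 1 y (B y).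

Definition kernel_value (y : R) : C :=
  (s - 1) * zeta s * A y - (s - 1) * csum (fun k => A (y / INR k)%R / RtoC (INR k)) (nat_floor y) - B y.

(** The factor (t/k)^s of the k-th term of Q turns the homogeneity of the kernel
    integral into its value at y/k, divided by k. *)
Lemma is_CInt_kernel y : (1 <= y)%R ->
  is_CInt (fun t => RtoC (kappa (y / t)) * (Q zeta s t / RtoC (t ^ 2))) 1 y (kernel_value y).
Proof.
intros Hy.
assert (I1 := is_CInt_cmul ((s - 1) * zeta s) _ _ _ _ (HA 1 y ltac:(lra))).
assert (I2 := is_CInt_sum_le_t
  (fun k t => / cpow (INR k) s * (RtoC (kappa (y / t)) * cpow t (s - 2)))
  (fun k => A (y / INR k)%R / RtoC (INR k)) 1 y ltac:(lra)).
lapply I2; clear I2; [intros I2|intros k Hk1 Hk2].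
2:{ assert (Pk : (1 <= INR k)%R) by (apply (le_INR 1); exact Hk1).
  rewrite Rmax_right by exact Pk.
  eapply is_CInt_eq; [apply is_CInt_cmul, HA; lra|].
  unfold Cminus at 1; rewrite cpow_add, cpow_opp, cpow_1_r by lra.
  assert (RtoC (INR k) <> 0) by (intros E; apply RtoC_inj in E; lra).
  field; split; [assumption|apply cpow_neq_0]. }
assert (I3 := is_CInt_minus _ _ _ _ _ _ (is_CInt_minus _ _ _ _ _ _ I1
  (is_CInt_cmul (s - 1) _ _ _ _ I2)) (HB y Hy)).
eapply is_RInt_ext; [|eapply is_CInt_eq; [exact I3|]].
- intros t Ht; rewrite Rmin_left, Rmax_right in Ht by exact Hy; cbv beta.
  unfold Q; rewrite sum_upto_csum.
  assert (Nt : RtoC t <> 0) by (intros E; apply RtoC_inj in E; lra).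
  assert (E2 : cpow t (s - 2) = cpow t s / (RtoC t * RtoC t)).
  { replace (s - 2) with (s + - (1 + 1)) by ring.
    rewrite cpow_add, cpow_opp, cpow_add, cpow_1_r by lra; reflexivity. }
  assert (E1 : csum (fun k => cpow (t / INR k) s) (nat_floor t)
     = cpow t s * csum (fun k => / cpow (INR k) s) (nat_floor t)).
  { rewrite <- csum_cmul; apply csum_ext; intros k [Hk _].
    assert (Pk : (1 <= INR k)%R) by (apply (le_INR 1); exact Hk).
    rewrite cpow_div by lra; reflexivity. }
  rewrite E1, E2, RtoC_pow.
  rewrite (csum_ext _ (fun k => (RtoC (kappa (y / t)) * (cpow t s / (RtoC t * RtoC t))) * / cpow (INR k) s)) by (intros; ring).
  rewrite csum_cmul; Cchange; simpl; field; exact Nt.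
- rewrite cpow_1_l; unfold kernel_value; replace (y / 1)%R with y by field; ring.
Qed.

(** Moebius inversion for j |-> A(x/j)/j removes the double sum. *)
Lemma is_CInt_moebius_kernel x : (1 <= x)%R ->
  is_CInt (fun t => csum (fun n => RtoC (moebius n / INR n * kappa (x / t / INR n))) (nat_floor (x / t))
     * (Q zeta s t / RtoC (t ^ 2))) 1 x
   ((s - 1) * zeta s * csum (fun n => RtoC (moebius n / INR n) * A (x / INR n)%R) (nat_floor x)
    - (s - 1) * A x - csum (fun n => RtoC (moebius n / INR n) * B (x / INR n)%R) (nat_floor x)).
Proof.
intros Hx.
assert (I := is_CInt_sum_le_x_over_t
  (fun n t => RtoC (moebius n / INR n) * (RtoC (kappa (x / INR n / t)) * (Q zeta s t / RtoC (t ^ 2))))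
  (fun n => RtoC (moebius n / INR n) * kernel_value (x / INR n)) x Hx).
eapply is_RInt_ext; [|eapply is_CInt_eq; [apply I|]].
- intros t Ht; rewrite Rmin_left, Rmax_right in Ht by exact Hx; cbv beta.
  rewrite (Cmult_comm (csum _ _)), <- csum_cmul; apply csum_ext; intros n [Hn _].
  assert (Pk : (1 <= INR n)%R) by (apply (le_INR 1); exact Hn).
  replace (x / t / INR n)%R with (x / INR n / t)%R by (field; lra).
  rewrite RtoC_mult; ring.
- intros n Hn1 Hn2; apply is_CInt_cmul, is_CInt_kernel.
  assert (Pk : (1 <= INR n)%R) by (apply (le_INR 1); exact Hn1).
  apply Rle_div_r; lra.
- pose (F := fun j => A (x / INR j)%R / RtoC (INR j)).
  assert (EF := moebius_inversion_upto F x Hx).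
  unfold F at 2 in EF; change (INR 1) with 1%R in EF.
  replace (x / 1)%R with x in EF by field.
  replace (A x) with (A x / 1) by field.
  rewrite <- EF, <- !csum_cmul, <- !csum_minus; apply csum_ext; intros n [Hn _].
  assert (Pk : (1 <= INR n)%R) by (apply (le_INR 1); exact Hn).
  assert (Nn : RtoC (INR n) <> 0) by (intros E; apply RtoC_inj in E; lra).
  assert (EG : csum (fun k => F (n * k)%nat) (nat_floor (x / INR n))
    = / RtoC (INR n) * csum (fun k => A (x / INR n / INR k)%R / RtoC (INR k)) (nat_floor (x / INR n))).
  { rewrite <- csum_cmul; apply csum_ext; intros k [Hk _]; unfold F.
    assert (Pk' : (1 <= INR k)%R) by (apply (le_INR 1); exact Hk).
    assert (Nk : RtoC (INR k) <> 0) by (intros E; apply RtoC_inj in E; lra).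
    rewrite mult_INR, RtoC_mult.
    replace (x / (INR n * INR k))%R with (x / INR n / INR k)%R by (field; lra).
    field; split; assumption. }
  rewrite EG; unfold kernel_value; rewrite RtoC_div by lra; field; exact Nn.
Qed.
End Kernel.

(** The integral of t^(s-2) over [1, y]. *)
Definition power_integral (s : C) (y : R) : C := (cpow y (s - 1) - 1) / (s - 1).

(** The integral of log(y/t) t^(s-2) over [1, y]. *)
Definition log_power_integral (s : C) (y : R) : C := (cpow y (s - 1) - 1) / ((s - 1) * (s - 1)) - RtoC (ln y) / (s - 1).

Lemma is_CInt_power_integral s c y : s <> RtoC 1 -> (0 < c <= y)%R ->
  is_CInt (fun t => RtoC 1 * cpow t (s - 2)) c y (cpow c (s - 1) * power_integral s (y / c)).
Proof.
intros Hs1 Hc.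
assert (Ns2 : s - 1 <> 0) by (intros E; apply Hs1, Ceq_minus, E).
eapply is_RInt_ext; [|eapply is_CInt_eq; [apply (is_CInt_cpow (s - 1) c y); (assumption || lra)|]].
- intros t _; cbv beta; replace (s - 1 - 1) with (s - 2) by ring; Cchange; ring.
- unfold power_integral; rewrite cpow_div by lra; field; split; [apply cpow_neq_0|exact Ns2].
Qed.

Lemma is_CInt_inv y : (1 <= y)%R -> is_CInt (fun t => RtoC 1 / RtoC t) 1 y (RtoC (ln y)).
Proof.
intros Hy; eapply is_RInt_ext; [|apply (is_CInt_RtoC (fun t => / t)%R 1 y)].
- intros t Ht; rewrite Rmin_left in Ht by exact Hy; cbv beta; rewrite RtoC_inv by lra; Cchange; unfold Cdiv; ring.
- eapply is_RInt_eq; [apply (is_RInt_derive (V := R_CompleteNormedModule) ln)|].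
  + intros t Ht; rewrite Rmin_left in Ht by exact Hy; apply is_derive_ln; lra.
  + intros t Ht; rewrite Rmin_left in Ht by exact Hy.
    apply continuity_pt_filterlim, continuity_pt_inv; [|lra].
    apply derivable_continuous_pt, derivable_pt_id.
  + unfold minus, plus, opp; simpl; rewrite ln_1; ring.
Qed.

Lemma is_CInt_log_power_integral s c y : s <> RtoC 1 -> (0 < c <= y)%R ->
  is_CInt (fun t => RtoC (ln (y / t)) * cpow t (s - 2)) c y (cpow c (s - 1) * log_power_integral s (y / c)).
Proof.
intros Hs1 Hc.
assert (Ns2 : s - 1 <> 0) by (intros E; apply Hs1, Ceq_minus, E).
pose (F := fun t => (/ (s - 1) * cpow t (s - 1)) * (RtoC (ln (y / t)) + / (s - 1))).
assert (HF : forall t, (0 < t)%R -> is_curve_derive F t (RtoC (ln (y / t)) * cpow t (s - 2))).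
{ intros t Ht.
  assert (Nt : RtoC t <> 0) by (intros E; apply RtoC_inj in E; lra).
  eapply curve_derive_eq.
  - apply curve_derive_mult; [apply curve_derive_mult; [apply curve_derive_const|apply curve_derive_cpow, Ht]|].
    apply curve_derive_plus; [|apply curve_derive_const].
    apply (curve_derive_RtoC (fun t => ln (y / t)) t (- / t)%R).
    auto_derive; [split; [lra|split; [apply Rdiv_lt_0_compat; lra|exact I]]|field; lra].
  - cbv beta; replace (s - 1 - 1) with (s - 2) by ring.
    assert (Ep : cpow t (s - 1) = cpow t (s - 2) * RtoC t).
    { rewrite <- (cpow_1_r t) by exact Ht; rewrite <- cpow_add; f_equal; ring. }
    rewrite Ep, RtoC_opp, RtoC_inv by lra; field; split; assumption. }
eapply is_CInt_eq; [apply (is_CInt_derive F)|].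
- intros t Ht; rewrite Rmin_left in Ht by lra; apply HF; lra.
- intros t Ht; rewrite Rmin_left in Ht by lra.
  apply continuous_Cmult; [|apply continuous_cpow; lra].
  apply continuous_RtoC, (ex_derive_continuous (K := R_AbsRing) (V := R_NormedModule)).
  auto_derive; split; [lra|split; [apply Rdiv_lt_0_compat; lra|exact I]].
- unfold F, log_power_integral; rewrite cpow_div by lra.
  replace (y / y)%R with 1%R by (field; lra); rewrite ln_1.
  field; repeat split; try exact Ns2; apply cpow_neq_0.
Qed.

Lemma is_CInt_log_over y : (1 <= y)%R ->
  is_CInt (fun t => RtoC (ln (y / t)) / RtoC t) 1 y (RtoC (ln y ^ 2 / 2)).
Proof.
intros Hy; eapply is_RInt_ext; [|apply (is_CInt_RtoC (fun t => ln (y / t) / t)%R 1 y)].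
- intros t Ht; rewrite Rmin_left in Ht by exact Hy; cbv beta; rewrite RtoC_div by lra; reflexivity.
- eapply is_RInt_eq; [apply (is_RInt_derive (V := R_CompleteNormedModule) (fun t => - (ln (y / t) ^ 2) / 2)%R)|].
  + intros t Ht; rewrite Rmin_left in Ht by exact Hy.
    auto_derive; [split; [lra|split; [apply Rdiv_lt_0_compat; lra|exact I]]|].
    simpl; unfold Rdiv; field; lra.
  + intros t Ht; rewrite Rmin_left in Ht by exact Hy.
    apply (ex_derive_continuous (K := R_AbsRing) (V := R_NormedModule)).
    auto_derive; repeat split; try lra. apply Rdiv_lt_0_compat; lra.
  + unfold minus, plus, opp; simpl. replace (y / y)%R with 1%R by (field; lra).
    replace (y / 1)%R with y by field; rewrite ln_1; field.
Qed.

Lemma Cdiv_Cmult (a b : C) : a / b = / b * a.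
Proof. apply Cmult_comm. Qed.

Lemma moebius_sum_power_integral s x : (1 <= x)%R -> s <> RtoC 1 ->
  csum (fun n => RtoC (moebius n / INR n) * power_integral s (x / INR n)) (nat_floor x)
  = (cpow x (s - 1) * moebius_dirichlet_sum s x - RtoC (m x)) / (s - 1).
Proof.
intros Hx Hs1.
assert (Ns2 : s - 1 <> 0) by (intros E; apply Hs1, Ceq_minus, E).
unfold m, moebius_dirichlet_sum; rewrite sum_upto_rsum, sum_upto_csum, csum_RtoC.
rewrite (Cdiv_Cmult (_ - _)), <- csum_cmul, <- csum_minus, <- csum_cmul.
apply csum_ext; intros n [Hn _].
assert (Pn : (1 <= INR n)%R) by (apply (le_INR 1); exact Hn).
assert (Nn : RtoC (INR n) <> 0) by (intros E; apply RtoC_inj in E; lra).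
unfold power_integral; rewrite cpow_div, RtoC_div by lra.
replace (cpow (INR n) s) with (cpow (INR n) (s - 1) * RtoC (INR n)).
- field; repeat split; try assumption; apply cpow_neq_0.
- rewrite <- (cpow_1_r (INR n)) by lra; rewrite <- cpow_add; f_equal; ring.
Qed.

Lemma moebius_sum_ln x : RtoC (m1 x) = csum (fun n => RtoC (moebius n / INR n) * RtoC (ln (x / INR n))) (nat_floor x).
Proof.
unfold m1; rewrite sum_upto_rsum, csum_RtoC; apply csum_ext; intros; apply RtoC_mult.
Qed.

Lemma moebius_sum_log_power_integral s x : (1 <= x)%R -> s <> RtoC 1 ->
  csum (fun n => RtoC (moebius n / INR n) * log_power_integral s (x / INR n)) (nat_floor x)
  = (cpow x (s - 1) * moebius_dirichlet_sum s x - RtoC (m x)) / ((s - 1) * (s - 1)) - RtoC (m1 x) / (s - 1).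
Proof.
intros Hx Hs1.
assert (Ns2 : s - 1 <> 0) by (intros E; apply Hs1, Ceq_minus, E).
rewrite (csum_ext _ (fun n => / (s - 1) * (RtoC (moebius n / INR n) * power_integral s (x / INR n)
   - RtoC (moebius n / INR n) * RtoC (ln (x / INR n))))).
- rewrite csum_cmul, csum_minus, moebius_sum_power_integral, <- moebius_sum_ln by assumption; field; exact Ns2.
- intros n _; unfold power_integral, log_power_integral; field; exact Ns2.
Qed.

Lemma moebius_sum_ln2 x : RtoC (1 / 2 * m2 x) = csum (fun n => RtoC (moebius n / INR n) * RtoC (ln (x / INR n) ^ 2 / 2)) (nat_floor x).
Proof.
unfold m2; rewrite sum_upto_rsum, RtoC_mult, csum_RtoC, <- csum_cmul.
apply csum_ext; intros n _; rewrite <- !RtoC_mult; f_equal; generalize (moebius n / INR n)%R; intros a; field.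
Qed.

Lemma integral_m_Q zeta s x : s <> RtoC 1 -> (1 <= x)%R ->
  is_CInt (fun t => RtoC (m (x / t)) * Q zeta s t / RtoC (t ^ 2)) 1 x
    (zeta s * (cpow x (s - 1) * moebius_dirichlet_sum s x - RtoC (m x)) - (cpow x (s - 1) - 1) - RtoC (m1 x)).
Proof.
intros Hs1 Hx.
assert (Ns2 : s - 1 <> 0) by (intros E; apply Hs1, Ceq_minus, E).
assert (I := is_CInt_moebius_kernel zeta s (fun _ => 1%R) (power_integral s) (fun y => RtoC (ln y))
  (fun c y => is_CInt_power_integral s c y Hs1) is_CInt_inv x Hx).
eapply is_RInt_ext; [|eapply is_CInt_eq; [exact I|]].
- intros t _; cbv beta; unfold m; rewrite sum_upto_rsum, csum_RtoC.
  rewrite (csum_ext (fun n => RtoC (moebius n / INR n * 1)) (fun n => RtoC (moebius n / INR n)))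
    by (intros; now rewrite Rmult_1_r).
  Cchange; unfold Cdiv; ring.
- rewrite moebius_sum_power_integral, <- moebius_sum_ln by assumption; unfold power_integral; field; exact Ns2.
Qed.

(** The part with m1 is the logarithmic kernel; the constant 1 is the integral of
    Q alone, the case of the kernel 1 without Moebius sum. *)
Lemma integral_m1_Q zeta s x : s <> RtoC 1 -> (1 <= x)%R ->
  is_CInt (fun t => (RtoC (m1 (x / t)) - 1) * Q zeta s t / RtoC (t ^ 2)) 1 x
    (zeta s * (cpow x (s - 1) * moebius_dirichlet_sum s x - RtoC (m x)) / (s - 1)
     - zeta s * (RtoC (m1 x) - 1)
     - (cpow x (s - 1) - 1) / (s - 1) + RtoC (ln x) - RtoC (1 / 2 * m2 x)
     - cpow x (s - 1) * (zeta s - csum (fun k => cpow (INR k) (- s)) (nat_floor x))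
     - RtoC (harmonic (nat_floor x)) + RtoC (ln x)).
Proof.
intros Hs1 Hx.
assert (Ns2 : s - 1 <> 0) by (intros E; apply Hs1, Ceq_minus, E).
assert (I := is_CInt_moebius_kernel zeta s ln (log_power_integral s) (fun y => RtoC (ln y ^ 2 / 2))
  (fun c y => is_CInt_log_power_integral s c y Hs1) is_CInt_log_over x Hx).
assert (I0 := is_CInt_kernel zeta s (fun _ => 1%R) (power_integral s) (fun y => RtoC (ln y))
  (fun c y => is_CInt_power_integral s c y Hs1) is_CInt_inv x Hx).
eapply is_RInt_ext; [|eapply is_CInt_eq; [exact (is_CInt_minus _ _ _ _ _ _ I I0)|]].
- intros t _; cbv beta; unfold m1; rewrite sum_upto_rsum, csum_RtoC.
  Cchange; unfold Cdiv; ring.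
- rewrite moebius_sum_log_power_integral, <- moebius_sum_ln2 by assumption; unfold kernel_value.
  assert (ES : csum (fun k => power_integral s (x / INR k) / RtoC (INR k)) (nat_floor x)
    = (cpow x (s - 1) * csum (fun k => cpow (INR k) (- s)) (nat_floor x) - RtoC (harmonic (nat_floor x))) / (s - 1)).
  { unfold harmonic; rewrite csum_RtoC.
    rewrite (Cdiv_Cmult (_ - _) (s - 1)), <- csum_cmul, <- csum_minus, <- csum_cmul.
    apply csum_ext; intros n [Hn _].
    assert (Pn : (1 <= INR n)%R) by (apply (le_INR 1); exact Hn).
    assert (Nn : RtoC (INR n) <> 0) by (intros E; apply RtoC_inj in E; lra).
    unfold power_integral; rewrite cpow_div, RtoC_inv by lra.
    replace (- s) with (- (s - 1) + - (1)) by ring; rewrite cpow_add, !cpow_opp, cpow_1_r by lra.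
    field; repeat split; try assumption; apply cpow_neq_0. }
  rewrite ES; unfold power_integral, log_power_integral; field; exact Ns2.
Qed.

Lemma piecewise_substitution_R (g : nat -> R -> R) x : (1 <= x)%R ->
  (forall n u, (0 < u)%R -> continuous (g n) u) ->
  exists l, is_RInt (fun u => g (nat_floor u) u) 1 x l /\
    is_RInt (fun t => g (nat_floor (x / t)) (x / t) / t ^ 2)%R 1 x (/ x * l)%R.
Proof.
intros Hx Hg.
(* on the range of integration the floor is positive, so the value at n = 0
   is free; 0 is what makes the telescoping start *)
destruct (piecewise_substitution (fun n u => match n with O => RtoC 0 | S _ => RtoC (g n u) end) x Hx)
  as [l [H1 H2]].
- reflexivity.
- intros n u Hu; destruct n; [apply continuous_const|]; apply continuous_RtoC, Hg, Hu.
- assert (N1 : forall y (z : R), (1 <= y)%R -> match nat_floor y with O => RtoC 0 | S _ => RtoC (g (nat_floor y) z) end = RtoC (g (nat_floor y) z)).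
  { intros y z Hy; assert (H := nat_floor_ge_1 y Hy); destruct (nat_floor y); [lia|reflexivity]. }
  exists (fst l); split.
  + eapply is_RInt_ext; [|exact (is_CInt_fst _ _ _ _ H1)]; intros u Hu.
    rewrite Rmin_left in Hu by exact Hx; cbv beta; rewrite N1 by lra; reflexivity.
  + eapply is_RInt_ext; [|eapply is_RInt_eq; [exact (is_CInt_fst _ _ _ _ H2)|]].
    * intros t Ht; rewrite Rmin_left, Rmax_right in Ht by exact Hx; cbv beta.
      rewrite N1 by (apply Rle_div_r; lra).
      rewrite <- RtoC_div by (apply pow_nonzero; lra); reflexivity.
    * simpl; ring.
Qed.

(** A bound on q leaves the integral of |g(x/t)|/t^2, which the substitution
    u = x/t turns into the mean of |g|. *)
Lemma Cmod_weighted_integral (g : nat -> R -> R) (q : R -> C) (K x : R) (I : C) :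
  (1 <= x)%R -> (0 <= K)%R ->
  (forall n u, (0 < u)%R -> continuous (g n) u) ->
  (forall t, (1 <= t)%R -> (Cmod (q t) <= K)%R) ->
  is_CInt (fun t => RtoC (g (nat_floor (x / t)) (x / t)%R) * q t / RtoC (t ^ 2)) 1 x I ->
  ex_RInt (fun u => Rabs (g (nat_floor u) u)) 1 x /\
  (Cmod I <= K * (1 / x * RInt (fun u => Rabs (g (nat_floor u) u)) 1 x))%R.
Proof.
intros Hx HK Hg Hq HI.
destruct (piecewise_substitution_R (fun n u => Rabs (g n u)) x Hx) as [l [H1 H2]].
{ intros n u Hu; apply (continuous_comp (g n) Rabs); [apply Hg, Hu|apply continuous_Rabs]. }
split; [exists l; exact H1|].
rewrite (is_RInt_unique _ _ _ _ H1).
assert (H3 := is_RInt_scal (V := R_NormedModule) _ _ _ K _ H2).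
refine (Rle_trans _ _ _ (Cmod_CInt_le _ _ 1 x _ _ Hx _ HI H3) _).
- intros t Ht; unfold scal; simpl; unfold mult; simpl.
  assert (Pt : (0 < t * (t * 1))%R) by nra.
  rewrite Cmod_div, Cmod_mult, !Cmod_R by (intros E; apply RtoC_inj in E; simpl in E; lra).
  rewrite (Rabs_pos_eq (t * (t * 1))) by lra.
  set (a := Rabs (g (nat_floor (x / t)) (x / t)%R)).
  replace (K * (a / (t * (t * 1))))%R with (K * a / (t * (t * 1)))%R by (unfold Rdiv; ring).
  unfold Rdiv; apply Rmult_le_compat_r; [apply Rlt_le, Rinv_0_lt_compat, Pt|].
  rewrite Rmult_comm; apply Rmult_le_compat_r; [apply Rabs_pos|apply Hq; lra].
- right; unfold scal; simpl; unfold mult; simpl; field; lra.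
Qed.

End KernelIntegrals.

(** * Exact formulas for the Dirichlet sum of the Moebius function *)

Section Identities.
Local Open Scope C_scope.

Lemma cpow_one_minus x s : cpow x (1 - s) = / cpow x (s - 1).
Proof. rewrite <- cpow_opp; f_equal; ring. Qed.

Theorem moebius_sum_identity_m zeta s x : s <> RtoC 1 -> (1 <= x)%R ->
  let I := CInt (fun t => RtoC (m (x / t)) * Q zeta s t / RtoC (t ^ 2)) 1 x in
  is_CInt (fun t => RtoC (m (x / t)) * Q zeta s t / RtoC (t ^ 2)) 1 x I /\
  zeta s * (moebius_dirichlet_sum s x - RtoC (m x) / cpow x (s - 1)) - 1
  = (RtoC (m1 x) - 1) / cpow x (s - 1) + 1 / cpow x (s - 1) * I.
Proof.
intros Hs1 Hx I.
assert (H := integral_m_Q zeta s x Hs1 Hx).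
assert (EI := CInt_unique _ _ _ _ H); fold I in EI; rewrite EI.
split; [exact H|field; apply cpow_neq_0].
Qed.

Theorem moebius_sum_identity_m1 zeta s x : is_riemann_zeta zeta -> s <> RtoC 1 -> (0 < Re s)%R -> (1 <= x)%R ->
  let I := CInt (fun t => (RtoC (m1 (x / t)) - 1) * Q zeta s t / RtoC (t ^ 2)) 1 x in
  is_CInt (fun t => (RtoC (m1 (x / t)) - 1) * Q zeta s t / RtoC (t ^ 2)) 1 x I /\
  zeta s * (moebius_dirichlet_sum s x - RtoC (m x) / cpow x (s - 1)
            - (s - 1) * ((RtoC (m1 x) - 1) / cpow x (s - 1))) - 1
  = (s - 1) / cpow x (s - 1) * RtoC (1 / 2 * m2 x - ln x + euler_gamma)%R
    + (s - 1) / cpow x (s - 1) * I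
    - (s - 1) * (s - 1) * (zeta s / (1 - s) - defect_primitive s x).
Proof.
intros Hz Hs1 Hs Hx I.
assert (H := integral_m1_Q zeta s x Hs1 Hx).
assert (EI := CInt_unique _ _ _ _ H); fold I in EI; rewrite EI.
split; [exact H|].
assert (Ns2 : s - 1 <> 0) by (intros E; apply Hs1, Ceq_minus, E).
assert (Ns1 : 1 - s <> 0) by (intros E; apply Hs1; symmetry; apply Ceq_minus, E).
unfold defect_primitive, zeta_partial, log_defect; rewrite cpow_one_minus, sum_upto_rsum.
unfold harmonic; rewrite !RtoC_plus, !RtoC_minus.
field; repeat split; try assumption; apply cpow_neq_0.
Qed.

End Identities.

(** * Bounds for the Dirichlet sum of the Moebius function *)

Section Inequalities.
Local Open Scope C_scope.

Lemma continuous_log_sum (a : nat -> R) n u : (0 < u)%R ->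
  continuous (fun u => rsum (fun k => a k * ln (u / INR k))%R n) u.
Proof.
intros Hu; induction n as [|n IH].
- apply (continuous_ext (fun _ => 0%R)); [intros v; symmetry; apply rsum_0|apply continuous_const].
- apply (continuous_ext (fun v => rsum (fun k => a k * ln (v / INR k))%R n + a (S n) * ln (v / INR (S n)))%R).
  { intros v; symmetry; apply rsum_S. }
  assert (P : (0 < INR (S n))%R) by (apply lt_0_INR; lia).
  apply (continuous_plus (V := R_NormedModule)); [exact IH|].
  apply (ex_derive_continuous (K := R_AbsRing) (V := R_NormedModule)).
  auto_derive; apply Rdiv_lt_0_compat; assumption.
Qed.

Section Bounds.
Variables (zeta : C -> C) (s : C) (x : R).
Hypotheses (Hz : is_riemann_zeta zeta) (Hs1 : s <> RtoC 1) (Hs : (0 < Re s)%R) (Hx : (1 <= x)%R).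
Hypothesis Hnz : zeta s <> RtoC 0.

Let K := (Cmod s / Rabs (Re s) * Cmod (s - 1))%R.

Lemma K_nonneg : (0 <= K)%R.
Proof.
apply Rmult_le_pos; [|apply Cmod_ge_0].
apply Rdiv_le_0_compat; [apply Cmod_ge_0|rewrite Rabs_pos_eq; lra].
Qed.

Lemma integral_m_bound :
  ex_RInt (fun t => Rabs (m t)) 1 x /\
  (Cmod (CInt (fun t => (RtoC (m (x / t)) * Q zeta s t / RtoC (t ^ 2))%C) 1 x)
   <= K * (1 / x * RInt (fun t => Rabs (m t)) 1 x))%R.
Proof.
refine (Cmod_weighted_integral (fun n _ => rsum (fun k => moebius k / INR k)%R n) (Q zeta s) K x _ Hx K_nonneg _ _ _).
- intros n u _; apply continuous_const.
- intros t Ht; apply Cmod_Q_le; assumption.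
- apply (moebius_sum_identity_m zeta s x Hs1 Hx).
Qed.

Lemma integral_m1_bound :
  ex_RInt (fun t => Rabs (m1 t - 1)) 1 x /\
  (Cmod (CInt (fun t => ((RtoC (m1 (x / t)) - 1) * Q zeta s t / RtoC (t ^ 2))%C) 1 x)
   <= K * (1 / x * RInt (fun t => Rabs (m1 t - 1)) 1 x))%R.
Proof.
refine (Cmod_weighted_integral (fun n u => rsum (fun k => moebius k / INR k * ln (u / INR k))%R n - 1)%R
  (Q zeta s) K x _ Hx K_nonneg _ _ _).
- intros n u Hu; apply (continuous_minus (V := R_NormedModule)); [|apply continuous_const].
  apply (continuous_log_sum (fun k => moebius k / INR k)%R n u Hu).
- intros t Ht; apply Cmod_Q_le; assumption.
- eapply is_RInt_ext; [|apply (moebius_sum_identity_m1 zeta s x Hz Hs1 Hs Hx)].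
  intros t _; cbv beta; rewrite <- (RtoC_minus (m1 (x / t)) 1); reflexivity.
Qed.

Lemma Cmod_cpow_s1 : Cmod (cpow x (s - 1)) = Rpower x (Re s - 1).
Proof. rewrite Cmod_cpow; f_equal. Qed.

Lemma Cmod_moebius_sum_m_le :
  (Cmod (moebius_dirichlet_sum s x - RtoC (m x) / cpow x (s - 1) - 1 / zeta s)
   <= Cmod s / Rabs (Re s) * (Cmod (s - 1) / Cmod (zeta s)) * (1 / Rpower x (Re s - 1))
        * (1 / x * RInt (fun t => Rabs (m t)) 1 x)
      + Rabs (m1 x - 1) / (Cmod (zeta s) * Rpower x (Re s - 1)))%R.
Proof.
destruct (moebius_sum_identity_m zeta s x Hs1 Hx) as [_ E]. destruct integral_m_bound as [_ B].
set (I := CInt _ _ _) in *. set (J := RInt (fun t => Rabs (m t)) 1 x) in *.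
assert (PZ : (0 < Cmod (zeta s))%R) by (apply Cmod_gt_0, Hnz).
assert (PX := Rpower_pos x (Re s - 1)).
assert (NX := cpow_neq_0 x (s - 1)).
replace (_ - _ - _) with ((zeta s * (moebius_dirichlet_sum s x - RtoC (m x) / cpow x (s - 1)) - 1) / zeta s)
  by (field; split; assumption).
rewrite E.
replace (((RtoC (m1 x) - 1) / cpow x (s - 1) + 1 / cpow x (s - 1) * I) / zeta s)
  with ((RtoC (m1 x - 1) + I) / (zeta s * cpow x (s - 1)))
  by (rewrite RtoC_minus; field; split; assumption).
rewrite Cmod_div, Cmod_mult, Cmod_cpow_s1 by (apply Cmult_neq_0; assumption).
assert (T := Cmod_triangle (RtoC (m1 x - 1)) I); rewrite Cmod_R in T.
replace (Cmod s / Rabs (Re s) * (Cmod (s - 1) / Cmod (zeta s)) * (1 / Rpower x (Re s - 1)) * (1 / x * J)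
   + Rabs (m1 x - 1) / (Cmod (zeta s) * Rpower x (Re s - 1)))%R
 with ((Rabs (m1 x - 1) + K * (1 / x * J)) / (Cmod (zeta s) * Rpower x (Re s - 1)))%R
 by (unfold K; rewrite (Rabs_pos_eq (Re s)) by lra; field; repeat split; lra).
unfold Rdiv at 1 2; apply Rmult_le_compat_r; [apply Rlt_le, Rinv_0_lt_compat; nra|lra].
Qed.

Lemma Cmod_moebius_sum_m1_le :
  (Cmod (moebius_dirichlet_sum s x - RtoC (m x) / cpow x (s - 1)
         - (s - 1) * ((RtoC (m1 x) - 1) / cpow x (s - 1)) - 1 / zeta s)
   <= Cmod s / Rabs (Re s) * (Cmod (s - 1) ^ 2 / Cmod (zeta s)) * (1 / Rpower x (Re s - 1))
        * (1 / x * RInt (fun t => Rabs (m1 t - 1)) 1 x)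
      + Cmod (s - 1) / (Cmod (zeta s) * Rpower x (Re s - 1))
        * Rabs (1 / 2 * m2 x - ln x + euler_gamma)
      + 0.55 * Cmod (s - 1) ^ 2 / (Cmod (zeta s) * Rabs (Re s) * Rpower x (Re s)))%R.
Proof.
destruct (moebius_sum_identity_m1 zeta s x Hz Hs1 Hs Hx) as [_ E]. destruct integral_m1_bound as [_ B].
assert (D := Cmod_defect_integral zeta s x Hz Hs Hs1 Hx).
set (I := CInt _ _ _) in *. set (J := RInt (fun t => Rabs (m1 t - 1)) 1 x) in *.
set (W := zeta s / (1 - s) - defect_primitive s x) in *.
set (r := (1 / 2 * m2 x - ln x + euler_gamma)%R) in *.
assert (PZ : (0 < Cmod (zeta s))%R) by (apply Cmod_gt_0, Hnz).
assert (PX := Rpower_pos x (Re s - 1)). assert (PX' := Rpower_pos x (Re s)).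
assert (NX := cpow_neq_0 x (s - 1)).
replace (_ - _ - _ - _) with ((zeta s * (moebius_dirichlet_sum s x - RtoC (m x) / cpow x (s - 1)
   - (s - 1) * ((RtoC (m1 x) - 1) / cpow x (s - 1))) - 1) / zeta s)
  by (field; split; assumption).
rewrite E, Cmod_div by exact Hnz.
assert (T1 := Cmod_triangle_minus ((s - 1) / cpow x (s - 1) * RtoC r + (s - 1) / cpow x (s - 1) * I) ((s - 1) * (s - 1) * W)).
assert (T2 := Cmod_triangle ((s - 1) / cpow x (s - 1) * RtoC r) ((s - 1) / cpow x (s - 1) * I)).
rewrite !Cmod_mult, Cmod_div, Cmod_cpow_s1, Cmod_R in T2 by exact NX.
rewrite !Cmod_mult in T1.
rewrite Rpower_Ropp in D.
apply Rle_div_l; [exact PZ|].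
rewrite (Rabs_pos_eq (Re s)) in * by lra.
assert (Q := Cmod_ge_0 (s - 1)).
assert (D' : (Cmod (s - 1) * Cmod (s - 1) * Cmod W <= Cmod (s - 1) * Cmod (s - 1) * (0.55 / Re s * / Rpower x (Re s)))%R).
{ apply Rmult_le_compat_l; [nra|exact D]. }
assert (B' : (Cmod (s - 1) / Rpower x (Re s - 1) * Cmod I <= Cmod (s - 1) / Rpower x (Re s - 1) * (K * (1 / x * J)))%R).
{ apply Rmult_le_compat_l; [apply Rdiv_le_0_compat; assumption|exact B]. }
eapply Rle_trans; [exact T1|].
match goal with |- (_ <= ?R)%R => replace R with
  (Cmod (s - 1) / Rpower x (Re s - 1) * Rabs r + Cmod (s - 1) / Rpower x (Re s - 1) * (K * (1 / x * J))
   + Cmod (s - 1) * Cmod (s - 1) * (0.55 / Re s * / Rpower x (Re s)))%R end.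
- lra.
- unfold K; rewrite (Rabs_pos_eq (Re s)) by lra; field; repeat split; lra.
Qed.
End Bounds.

End Inequalities.

Theorem proposition4 (zeta : C -> C) (hzeta : is_riemann_zeta zeta)
    (s : C) (hs : s <> RtoC 1) (x : R) (hx : (1 <= x)%R) :
  (* (i) *)
  (ex_RInt (V := C_R_NormedModule)
     (fun t : R => (m (x / t)%R * Q zeta s t / (t ^ 2)%R)%C) 1 x /\
   (zeta s * (moebius_dirichlet_sum s x - m x / cpow x (s - 1)) - 1
    = (m1 x - 1) / cpow x (s - 1)
      + 1 / cpow x (s - 1)
        * RInt (V := C_R_CompleteNormedModule)
            (fun t : R => (m (x / t)%R * Q zeta s t / (t ^ 2)%R)%C) 1 x)%C)
  /\
  (* (ii) *)
  ((0 < Re s)%R ->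
   ex_RInt (V := C_R_NormedModule)
     (fun t : R => ((m1 (x / t)%R - 1) * Q zeta s t / (t ^ 2)%R)%C) 1 x /\
   ex_RInt_gen (V := C_R_NormedModule)
     (fun t : R =>
        ((ln t - sum_upto (fun j => / INR j) t + euler_gamma)%R
         * cpow t (- s))%C)
     (at_point x) (Rbar_locally p_infty) /\
   (zeta s * (moebius_dirichlet_sum s x - m x / cpow x (s - 1)
              - (s - 1) * ((m1 x - 1) / cpow x (s - 1))) - 1
    = (s - 1) / cpow x (s - 1) * (1 / 2 * m2 x - ln x + euler_gamma)%R
      + (s - 1) / cpow x (s - 1)
        * RInt (V := C_R_CompleteNormedModule)
            (fun t : R => ((m1 (x / t)%R - 1) * Q zeta s t / (t ^ 2)%R)%C) 1 x
      - (s - 1) * (s - 1)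
        * RInt_gen (V := C_R_CompleteNormedModule)
            (fun t : R =>
               ((ln t - sum_upto (fun j => / INR j) t + euler_gamma)%R
                * cpow t (- s))%C)
            (at_point x) (Rbar_locally p_infty))%C)
  /\
  (* (iii) *)
  ((0 < Re s)%R ->
   (forall t : R, (1 <= t)%R ->
      (Cmod (Q zeta s t) <= Cmod s / Rabs (Re s) * Cmod (s - 1))%R) /\
   (zeta s <> RtoC 0 ->
    (ex_RInt (fun t : R => Rabs (m t)) 1 x /\
     (Cmod (moebius_dirichlet_sum s x - m x / cpow x (s - 1) - 1 / zeta s)
      <= Cmod s / Rabs (Re s) * (Cmod (s - 1) / Cmod (zeta s))
           * (1 / Rpower x (Re s - 1))
           * (1 / x * RInt (fun t : R => Rabs (m t)) 1 x)
         + Rabs (m1 x - 1) / (Cmod (zeta s) * Rpower x (Re s - 1)))%R) /\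
    (ex_RInt (fun t : R => Rabs (m1 t - 1)) 1 x /\
     (Cmod (moebius_dirichlet_sum s x - m x / cpow x (s - 1)
            - (s - 1) * ((m1 x - 1) / cpow x (s - 1)) - 1 / zeta s)
      <= Cmod s / Rabs (Re s) * (Cmod (s - 1) ^ 2 / Cmod (zeta s))
           * (1 / Rpower x (Re s - 1))
           * (1 / x * RInt (fun t : R => Rabs (m1 t - 1)) 1 x)
         + Cmod (s - 1) / (Cmod (zeta s) * Rpower x (Re s - 1))
           * Rabs (1 / 2 * m2 x - ln x + euler_gamma)
         + 0.55 * Cmod (s - 1) ^ 2
           / (Cmod (zeta s) * Rabs (Re s) * Rpower x (Re s)))%R))).
Proof.
assert (Hgen : 0 < Re s -> is_RInt_gen (V := C_R_NormedModule)
  (fun t : R => ((ln t - sum_upto (fun j => / INR j) t + euler_gamma)%R * cpow t (- s))%C)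
  (at_point x) (Rbar_locally p_infty) (zeta s / (1 - s) - defect_primitive s x)%C).
{ intros Hs; exact (is_RInt_gen_defect zeta s x hzeta Hs hs hx). }
split; [|split].
- destruct (moebius_sum_identity_m zeta s x hs hx) as [H E].
  split; [eexists; exact H|exact E].
- intros Hs; destruct (moebius_sum_identity_m1 zeta s x hzeta hs Hs hx) as [H E].
  split; [eexists; exact H|split; [eexists; exact (Hgen Hs)|]].
  rewrite (is_RInt_gen_unique (V := C_R_CompleteNormedModule) _ _ (Hgen Hs)).
  exact E.
- intros Hs; split; [intros t Ht; apply Cmod_Q_le; assumption|].
  intros Hnz; split; split.
  + apply (integral_m_bound zeta s x hzeta hs Hs hx).
  + exact (Cmod_moebius_sum_m_le zeta s x hzeta hs Hs hx Hnz).
  + apply (integral_m1_bound zeta s x hzeta hs Hs hx).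
  + exact (Cmod_moebius_sum_m1_le zeta s x hzeta hs Hs hx Hnz).
Qed.
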